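(* Let $p$ be a prime and $\epsilon\in\mathbb{N}_0\cup\{\infty\}$. The theory $\operatorname{SDCF}^{\ell}_{p,\epsilon}$ is stable.
   Context: For a differential field $(K,\delta)$ of characteristic $p$, $C_K$ is its constant field, and $\epsilon$ with $[C_K:K^p]=p^\epsilon$ is the differential degree of imperfection. A set is differentially $p$-independent if it lies in $C_K$ and its $p$-monomials are linearly independent over $K^p$; a differential $p$-basis is a differentially $p$-independent set whose $p$-monomials span $C_K$ over $K^p$. For finite $\epsilon$: with $s=p^\epsilon-1$ and a fixed enumeration $m_0,\dots,m_s$ of monomials $y_1^{i_1}\cdots y_\epsilon^{i_\epsilon}$ ($0\le i_j<p$), $\operatorname{SDCF}^{\ell}_{p,\epsilon}$ is the theory, in the language of differential fields expanded by constants $a_1,\dots,a_\epsilon$ and unary functions $\ell_0,\dots,\ell_s$, of separably differentially closed fields of characteristic $p$ with $[C_K:K^p]=p^\epsilon$, where $\bar a$ is differentially $p$-independent, $\ell_i(b)=0$ for $b\notin C_K$ and $b=\sum_i\ell_i(b)^pm_i(\bar a)$ for $b\in C_K$. For $\epsilon=\infty$: the language has $(n+1)$-ary functions $\ell_{n,i}$ ($0\le i\le p^n-1$), with $\ell_{n,i}(a_1,\dots,a_n;b)=0$ unless all entries are constants, $(a_1,\dots,a_n)$ is differentially $p$-independent and $(a_1,\dots,a_n,b)$ is not, in which case $b=\sum_i\ell_{n,i}(\bar a;b)^p m_i(\bar a)$; the theory is that of separably differentially closed fields of characteristic $p$ with $[C_K:K^p]$ infinite with these functions. Separably differentially closed: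 existentially closed (in the language of differential fields) in every differential field extension that is separable as a field extension. *)

(* Defs.v *)
From mathcomp Require Import all_boot all_order all_algebra.

Set Implicit Arguments.
Unset Strict Implicit.
Unset Printing Implicit Defensive.

Import GRing.Theory.
Local Open Scope ring_scope.

(* There are no relation symbols besides equality: the languages of
   differential fields considered below are purely functional. *)
Record signature := Signature { fsym : Type; arity : fsym -> nat }.

(* [term L n] and [formula L n] are well scoped: their free variables are
   x_0, ..., x_(n-1).  [FEx] binds the last variable x_n of its body. *)
Inductive term (L : signature) (n : nat) : Type :=
| Var of 'I_n
| App (f : fsym L) of ('I_(arity f) -> term L n).
Arguments Var {L n}.
Arguments App {L n}.

Inductive formula (L : signature) : nat -> Type :=
| FEq n of term L n & term L n : formula L n
| FNot n of formula L n : formula L n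
| FAnd n of formula L n & formula L n : formula L n
| FEx n of formula L n.+1 : formula L n.

Fixpoint quantifier_free (L : signature) n (phi : formula L n) : bool :=
  match phi with
  | FEq _ _ _ => true
  | FNot _ psi => quantifier_free psi
  | FAnd _ psi chi => quantifier_free psi && quantifier_free chi
  | FEx _ _ => false
  end.

(* Tuples of length n in M are finite functions M ^ n = {ffun 'I_n -> M}. *)
Record structure (L : signature) := Structure {
  carrier :> Type;
  interp : forall f : fsym L, (carrier ^ arity f)%type -> carrier }.

Definition cat_ffun (M : Type) n m (a : (M ^ n)%type) (b : (M ^ m)%type) :
    (M ^ (n + m))%type :=
  [ffun i => match split i with inl j => a j | inr k => b k end].

Definition rcons_ffun (M : Type) n (a : (M ^ n)%type) (b : M) :
    (M ^ n.+1)%type :=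
  [ffun i => if unlift ord_max i is Some j then a j else b].

Fixpoint eval (L : signature) (M : structure L) n (e : (M ^ n)%type)
    (t : term L n) : M :=
  match t with
  | Var i => e i
  | App f ts => interp [ffun i => eval e (ts i)]
  end.

Fixpoint sat (L : signature) (M : structure L) n (phi : formula L n) :
    (M ^ n)%type -> Prop :=
  match phi in formula _ k return (M ^ k)%type -> Prop with
  | FEq _ t u => fun e => eval e t = eval e u
  | FNot _ psi => fun e => ~ sat psi e
  | FAnd _ psi chi => fun e => sat psi e /\ sat chi e
  | FEx _ psi => fun e => exists x : M, sat psi (rcons_ffun e x)
  end.

Definition sentence (L : signature) := formula L 0.
Definition theory (L : signature) := sentence L -> Prop.

(* The quantification over e is innocuous: M ^ 0 has exactly one element. *)
Definition holds (L : signature) (M : structure L) (s : sentence L) : Prop :=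
  forall e : (M ^ 0)%type, sat s e.

Definition model_of (L : signature) (T : theory L) (M : structure L) : Prop :=
  forall s, T s -> holds M s.

(* The first n variables of phi form the tuple x, the last m the tuple y, of a
   partitioned formula phi(x; y). *)
Definition order_property (L : signature) (T : theory L) n m
    (phi : formula L (n + m)) : Prop :=
  exists (M : structure L) (a : nat -> (M ^ n)%type) (b : nat -> (M ^ m)%type),
    model_of T M /\
    forall i j : nat, sat phi (cat_ffun (a i) (b j)) <-> (i < j)%N.

Definition stable (L : signature) (T : theory L) : Prop :=
  forall n m (phi : formula L (n + m)), ~ order_property T phi.

Record diffField := DiffField {
  diffField_sort :> fieldType;
  der : diffField_sort -> diffField_sort;
  derD : {morph der : x y / x + y};
  derM : forall x y, der (x * y) = der x * y + x * der y }.

Inductive df_fsym := Zero | One | Add | Opp | Mul | Inv | Der.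

Definition df_arity (f : df_fsym) : nat :=
  match f with
  | Zero | One => 0
  | Opp | Inv | Der => 1
  | Add | Mul => 2
  end.

Definition df_signature : signature := Signature df_arity.

Definition df_interp (K : diffField) (f : df_fsym) :
    (K ^ df_arity f)%type -> K :=
  match f return (K ^ df_arity f)%type -> K with
  | Zero => fun=> 0
  | One => fun=> 1
  | Add => fun v => v ord0 + v ord_max
  | Opp => fun v => - v ord0
  | Mul => fun v => v ord0 * v ord_max
  | Inv => fun v => (v ord0)^-1   (* 0^-1 = 0 *)
  | Der => fun v => der (v ord0)
  end.

Definition df_structure (K : diffField) : structure df_signature :=
  @Structure df_signature K (@df_interp K).

Definition lin_indep (F : fieldType) (k : F -> Prop) (I : finType)
    (b : I -> F) : Prop :=
  forall c : I -> F, (forall i, k (c i)) ->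
    \sum_i c i * b i = 0 -> forall i, c i = 0.

Definition spans (F : fieldType) (k V : F -> Prop) (I : finType)
    (b : I -> F) : Prop :=
  forall x, V x -> exists2 c : I -> F,
    forall i, k (c i) & x = \sum_i c i * b i.

(* [V : k] = d *)
Definition has_degree (F : fieldType) (k V : F -> Prop) (d : nat) : Prop :=
  exists b : 'I_d -> F,
    [/\ forall i, V (b i), lin_indep k b & spans k V b].

Definition linearly_disjoint (F : fieldType) (k A B : F -> Prop) : Prop :=
  forall n (b : 'I_n -> F),
    (forall i, A (b i)) -> lin_indep k b -> lin_indep B b.

Definition is_constant (K : diffField) (x : K) : Prop := der x = 0.

Definition is_pth_power (F : fieldType) (p : nat) (x : F) : Prop :=
  exists y : F, x = y ^+ p.

Definition imperfection_finite (p n : nat) (K : diffField) : Prop :=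
  has_degree (@is_pth_power K p) (@is_constant K) (p ^ n).

Definition imperfection_infinite (p : nat) (K : diffField) : Prop :=
  forall d, ~ has_degree (@is_pth_power K p) (@is_constant K) d.

Definition pmonomial (F : fieldType) p n (e : {ffun 'I_n -> 'I_p})
    (a : (F ^ n)%type) : F :=
  \prod_(j < n) a j ^+ e j.

(* The p-monomials are taken as a family indexed by their exponents, so the
   entries of a differentially p-independent tuple are pairwise distinct. *)
Definition diff_p_indep (p : nat) (K : diffField) n (a : (K ^ n)%type) : Prop :=
  (forall j, is_constant (a j)) /\
  lin_indep (@is_pth_power K p)
    (fun e : {ffun 'I_n -> 'I_p} => pmonomial e a).

(* For a field extension f : K -> L of characteristic p, not necessarily
   algebraic, separability is linear disjointness of K and L^p over K^p. *)
Definition separable_ext (p : nat) (K L : fieldType) (f : K -> L) : Prop :=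
  linearly_disjoint (fun z => exists x : K, z = f (x ^+ p))
    (fun z => exists x : K, z = f x) (@is_pth_power L p).

(* Every existential formula, with parameters in K, that holds in L holds
   in K. *)
Definition existentially_closed_in (K L : diffField) (f : K -> L) : Prop :=
  forall n m (phi : formula df_signature (n + m)) (c : (K ^ n)%type),
    quantifier_free phi ->
    (exists x : (L ^ m)%type,
       @sat _ (df_structure L) _ phi (cat_ffun [ffun i => f (c i)] x)) ->
    exists x : (K ^ m)%type,
       @sat _ (df_structure K) _ phi (cat_ffun c x).

Definition sep_diff_closed (p : nat) (K : diffField) : Prop :=
  forall (L : diffField) (f : {rmorphism K -> L}),
    (forall x, f (der x) = der (f x)) ->
    separable_ext p f -> existentially_closed_in f.

Inductive imperfection := FiniteDegree of nat | InfiniteDegree.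

(* For each n, the exponents of the monomials m_0, ..., m_(p^n - 1) in n
   variables; meant to be bijective for each n. *)
Definition monomial_enum (p : nat) :=
  forall n, 'I_(p ^ n) -> {ffun 'I_n -> 'I_p}.

Section FiniteImperfection.
Variables (p : nat) (mon : monomial_enum p) (n : nat).

Inductive fin_fsym :=
| FinDF of df_fsym
| FinConst of 'I_n
| FinEll of 'I_(p ^ n).

Definition fin_arity (f : fin_fsym) : nat :=
  match f with FinDF g => df_arity g | FinConst _ => 0 | FinEll _ => 1 end.

Definition fin_signature : signature := Signature fin_arity.

Definition fin_structure (K : diffField) (a : (K ^ n)%type)
    (ell : 'I_(p ^ n) -> K -> K) : structure fin_signature :=
  @Structure fin_signature K (fun f : fin_fsym =>
    match f return (K ^ fin_arity f)%type -> K with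
    | FinDF g => @df_interp K g
    | FinConst j => fun=> a j
    | FinEll i => fun v => ell i (v ord0)
    end).

Definition fin_ell_spec (K : diffField) (a : (K ^ n)%type)
    (ell : 'I_(p ^ n) -> K -> K) : Prop :=
  forall b : K,
    (~ is_constant b -> forall i, ell i b = 0) /\
    (is_constant b -> b = \sum_i ell i b ^+ p * pmonomial (mon i) a).

(* The theory consists of the sentences true in all the expanded fields. *)
Definition SDCF_fin : theory fin_signature := fun s =>
  forall (K : diffField) (a : (K ^ n)%type) (ell : 'I_(p ^ n) -> K -> K),
    p \in [pchar K] -> sep_diff_closed p K -> imperfection_finite p n K ->
    diff_p_indep p a -> fin_ell_spec a ell ->
    holds (fin_structure a ell) s.

End FiniteImperfection.

Section InfiniteImperfection.
Variables (p : nat) (mon : monomial_enum p).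

Inductive inf_fsym :=
| InfDF of df_fsym
| InfEll n of 'I_(p ^ n).

Definition inf_arity (f : inf_fsym) : nat :=
  match f with InfDF g => df_arity g | @InfEll n _ => n.+1 end.

Definition inf_signature : signature := Signature inf_arity.

Definition inf_structure (K : diffField)
    (ell : forall n, 'I_(p ^ n) -> (K ^ n)%type -> K -> K) :
    structure inf_signature :=
  @Structure inf_signature K (fun f : inf_fsym =>
    match f return (K ^ inf_arity f)%type -> K with
    | InfDF g => @df_interp K g
    | @InfEll n i => fun v =>
        ell n i [ffun j : 'I_n => v (lift ord_max j)] (v ord_max)
    end).

Definition inf_ell_spec (K : diffField)
    (ell : forall n, 'I_(p ^ n) -> (K ^ n)%type -> K -> K) : Prop :=
  forall n (a : (K ^ n)%type) (b : K),
    let defined := [/\ forall j, is_constant (a j), is_constant b,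
      diff_p_indep p a & ~ diff_p_indep p (rcons_ffun a b)] in
    (~ defined -> forall i, ell n i a b = 0) /\
    (defined -> b = \sum_i ell n i a b ^+ p * pmonomial (mon i) a).

Definition SDCF_inf : theory inf_signature := fun s =>
  forall (K : diffField) (ell : forall n, 'I_(p ^ n) -> (K ^ n)%type -> K -> K),
    p \in [pchar K] -> sep_diff_closed p K -> imperfection_infinite p K ->
    inf_ell_spec ell ->
    holds (inf_structure ell) s.

End InfiniteImperfection.

Definition SDCF_signature (p : nat) (eps : imperfection) : signature :=
  match eps with
  | FiniteDegree n => fin_signature p n
  | InfiniteDegree => inf_signature p
  end.

Definition SDCF (p : nat) (mon : monomial_enum p) (eps : imperfection) :
    theory (SDCF_signature p eps) :=
  match eps return theory (SDCF_signature p eps) with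
  | FiniteDegree n => SDCF_fin mon (n := n)
  | InfiniteDegree => SDCF_inf mon
  end.
Arguments SDCF {p} mon eps _.

(* Main.v *)
(* Existential closedness of K says that finite parts of a separable extension
   of K can be mapped back to K over K. This spreads out: if L is separable over
   C and C embeds in an ultraproduct of closed fields, then so do the finite
   parts of L, because finitely generated separable extensions are towers of
   transcendental and separable algebraic steps, along which the factors of the
   ultraproduct and their derivations can be extended. Hence two separable
   extensions of C amalgamate in an iterated ultrapower of one of them, and this
   gives quantifier elimination over separable subfields. For stability let M1 be
   an ultrapower of M over the natural numbers and N the same ultrapower of M1. The
   diagonal embedding of M1 in N and the ultrapower of the diagonal embedding of
   M have images that are linearly disjoint over M, so exchanging them is an
   isomorphism of subfields over which N is separable, and by quantifier
   elimination it preserves every formula. But on the classes of a sequence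
   witnessing the order property it turns a true instance into a false one. *)

Require Import Defs.
From HB Require Import structures.
From mathcomp Require Import all_boot all_order all_algebra.
From mathcomp Require Import boolp generic_quotient.
From mathcomp Require classical_sets filter.
From mathcomp Require Import falgebra fieldext separable mpoly ring.

Set Implicit Arguments.
Unset Strict Implicit.
Unset Printing Implicit Defensive.

Import GRing.Theory.
Local Open Scope ring_scope.

(** * Linear algebra over p-th powers *)

(** The theory is the set of sentences true in a class of fields that is not visibly elementary, so
    a model of it need not belong to the class. Such a model only provides finite chains; these are
    found again in members, and an ultraproduct makes them infinite. The argument therefore runs in
    a class closed under ultraproducts ([good_class]), where closedness is stated for finite parts
    of extensions. The first obstacle is that a finite part of a differential field generates a
    field not stable under the derivation. Fields and derivations are hence treated apart: towers
    are spread without derivation, and derivations, possibly with values in larger fields, are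
    lifted to the factors afterwards. The second obstacle is that an amalgam must be separable over
    both sides. Only constants can fail. For finite $\epsilon$ the named constants and the p-th
    powers generate them; otherwise the missing ones are matched with new constants of an
    ultrapower. The functions $\ell$ enter in one way: they are determined on separable differential
    subfields, provided these contain the named constants. *)

Definition subfield_pred (K : fieldType) (k : K -> Prop) : Prop :=
  [/\ k 1, forall x y, k x -> k y -> k (x - y),
      forall x y, k x -> k y -> k (x * y) & forall x, k x -> k x^-1].

Section SubfieldPred.
Variables (K : fieldType) (k : K -> Prop) (hk : subfield_pred k).

Lemma subf1 : k 1. Proof. by case: hk. Qed.
Lemma subfB x y : k x -> k y -> k (x - y). Proof. by case: hk => _ h _ _; apply: h. Qed.
Lemma subfM x y : k x -> k y -> k (x * y). Proof. by case: hk => _ _ h _; apply: h. Qed.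
Lemma subfV x : k x -> k x^-1. Proof. by case: hk => _ _ _ h; apply: h. Qed.
Lemma subf0 : k 0. Proof. by rewrite -(subrr 1); apply: subfB; apply: subf1. Qed.
Lemma subfN x : k x -> k (- x). Proof. by move=> h; rewrite -sub0r; apply: subfB => //; apply: subf0. Qed.
Lemma subfD x y : k x -> k y -> k (x + y).
Proof. by move=> hx hy; rewrite -(opprK y); apply: subfB => //; apply: subfN. Qed.
Lemma subfX x n : k x -> k (x ^+ n).
Proof. by move=> h; elim: n => [|n IH]; [apply: subf1 | rewrite exprS; apply: subfM]. Qed.
Lemma subf_sum (I : Type) (r : seq I) (P : pred I) (F : I -> K) :
  (forall i, P i -> k (F i)) -> k (\sum_(i <- r | P i) F i).
Proof. by move=> h; apply: (big_ind k) => //; [apply: subf0 | apply: subfD]. Qed.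
Lemma subf_prod (I : Type) (r : seq I) (P : pred I) (F : I -> K) :
  (forall i, P i -> k (F i)) -> k (\prod_(i <- r | P i) F i).
Proof. by move=> h; apply: (big_ind k) => //; [apply: subf1 | apply: subfM]. Qed.

(** A maximal independent subfamily plays the role of a basis of the span. Most arguments below
    expand a family in this way and compare coefficients, over a subfield that is only given as a
    predicate. *)
Lemma exists_max_indep (T : finType) (y : T -> K) :
  exists2 A : {set T},
    (forall c : T -> K, (forall t, k (c t)) ->
       \sum_(t in A) c t * y t = 0 -> forall t, t \in A -> c t = 0) &
    forall t, exists2 u : T -> K, forall s, k (u s) & y t = \sum_(s in A) u s * y s.
Proof.
pose ind (A : {set T}) := forall c : T -> K, (forall t, k (c t)) ->
  \sum_(t in A) c t * y t = 0 -> forall t, t \in A -> c t = 0.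
have ind0 : `[< ind set0 >] by apply/asboolP => c _ _ t; rewrite inE.
case: (@arg_maxnP _ set0 (fun A => `[< ind A >]) (fun A : {set T} => #|A|) ind0)
  => A /asboolP indA maxA.
exists A => // t; have [tA|tA] := boolP (t \in A).
  exists (fun s => if s == t then 1 else 0).
    by move=> s; case: eqP => _; [apply: subf1 | apply: subf0].
  by rewrite (bigD1 t) //= eqxx mul1r big1 ?addr0 // => s /andP[_ /negPf ->]; rewrite mul0r.
have /existsNP[c /not_implyP[ck /not_implyP[cs /existsNP[t0 /not_implyP[t0A /eqP ct0]]]]] :
    ~ ind (t |: A).
  move=> h; have /asboolP/maxA := h.
  by rewrite cardsU1 tA add1n /= ltnn.
move: cs; rewrite big_setU1 //= => cs.
have ct : c t != 0.
  apply/eqP => ct; move: cs; rewrite ct mul0r add0r => /indA -/(_ ck) h.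
  move: t0A; rewrite !inE => /orP[/eqP e|t0A]; first by rewrite e ct eqxx in ct0.
  by rewrite h // eqxx in ct0.
exists (fun s => - (c s / c t)).
  by move=> s; apply/subfN/subfM => //; apply/subfV.
move/eqP: cs; rewrite addr_eq0 => /eqP cs.
apply: (mulfI ct); rewrite cs mulr_sumr -sumrN; apply: eq_bigr => s _.
by rewrite mulrA mulrN mulrCA divff // mulr1 mulNr.
Qed.

End SubfieldPred.

Section Morph.
Variables (C N : fieldType) (f : {rmorphism C -> N}).

Lemma im_subfield : subfield_pred (fun x : N => exists c, x = f c).
Proof.
split; first by exists 1; rewrite rmorph1.
- by move=> _ _ [a ->] [b ->]; exists (a - b); rewrite rmorphB.
- by move=> _ _ [a ->] [b ->]; exists (a * b); rewrite rmorphM.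
- by move=> _ [a ->]; exists a^-1; rewrite fmorphV.
Qed.

Lemma exists_max_indep_morph (T : finType) (y : T -> N) :
  exists2 A : {set T},
    (forall c : T -> C, \sum_(t in A) f (c t) * y t = 0 ->
       forall t, t \in A -> c t = 0) &
    exists u : T -> T -> C, forall t, y t = \sum_(s in A) f (u t s) * y s.
Proof.
have [A indA spanA] := exists_max_indep im_subfield y.
exists A.
  move=> c /(indA (f \o c)) h t tA; apply: (fmorph_inj f); rewrite rmorph0.
  by apply: h => // s; exists (c s).
have h t : exists u : T -> C, y t = \sum_(s in A) f (u s) * y s.
  have [u /choice[v hv] ->] := spanA t; exists v.
  by apply: eq_bigr => s _; rewrite hv.
by have [u hu] := choice h; exists u.
Qed.

End Morph.

Lemma big_opt (V : nmodType) (T : finType) (F : option T -> V) :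
  \sum_t F t = F None + \sum_t F (Some t).
Proof.
rewrite (bigD1 None) //=; congr (_ + _).
rewrite (reindex_omap Some id) /=; last by case.
by apply: eq_bigl => t; rewrite eqxx.
Qed.

Lemma big_setT (V : nmodType) (T : finType) (F : T -> V) :
  \sum_(t in setT) F t = \sum_t F t.
Proof. by apply: eq_bigl => t; rewrite inE. Qed.

(** * p-independence and separable embeddings *)

Section Powers.
Variables (p : nat).

(* The coefficients, which are p-th powers, are given by their roots. *)
Definition pind (K : fieldType) (T : finType) (A : {set T}) (y : T -> K) : Prop :=
  forall c : T -> K, \sum_(t in A) c t ^+ p * y t = 0 ->
    forall t, t \in A -> c t = 0.

Lemma pcharP_sum (K : comNzRingType) (chK : p \in [pchar K]) (I : Type) (r : seq I)
  (P : pred I) (F : I -> K) :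
  (\sum_(i <- r | P i) F i) ^+ p = \sum_(i <- r | P i) F i ^+ p.
Proof. exact: (raddf_sum (pFrobenius_aut chK)). Qed.

Lemma pcharP_opp (K : fieldType) (chK : p \in [pchar K]) (x : K) :
  (- x) ^+ p = - x ^+ p.
Proof. exact: (raddfN (pFrobenius_aut chK)). Qed.

Lemma pcharP_eq0 (K : fieldType) (chK : p \in [pchar K]) (x : K) :
  x ^+ p = 0 -> x = 0.
Proof. by move/eqP; rewrite expf_eq0 => /andP[_ /eqP]. Qed.

Lemma exists_max_pind (K : fieldType) (chK : p \in [pchar K]) (T : finType) (y : T -> K) :
  exists2 A : {set T}, pind A y &
    exists u : T -> T -> K, forall t, y t = \sum_(s in A) u t s ^+ p * y s.
Proof. exact: (exists_max_indep_morph (pFrobenius_aut chK)). Qed.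

Lemma pind_inj (K : fieldType) (chK : p \in [pchar K]) (T : finType)
    (A : {set T}) (y : T -> K) (S : finType) (B : {set S}) (h : S -> T) :
  {in B &, injective h} -> {in B, forall s, h s \in A} -> pind A y -> pind B (y \o h).
Proof.
move=> hinj hBA indA c hc s sB.
pose d t := if [pick s in B | h s == t] is Some s then c s else 0.
have dh : {in B, forall s, d (h s) = c s}.
  move=> r rB; rewrite /d; case: pickP => [r' /andP[r'B /eqP e]|/(_ r)]; last by rewrite /= rB eqxx.
  by rewrite (hinj _ _ r'B rB e).
rewrite -(dh s sB); apply: indA; last exact: hBA.
rewrite -[RHS]hc (bigID (mem [set h s | s in B])) /= [X in _ + X]big1 ?addr0.
  rewrite (eq_bigl (fun t => t \in [set h s | s in B])); last first.
    by move=> t; rewrite andbC; case: imsetP => [[r rB ->]|] //=; apply: hBA.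
  by rewrite big_imset //=; apply: eq_bigr => r rB; rewrite dh.
move=> t /andP[_ /imsetP ht]; rewrite /d; case: pickP => [r /andP[rB /eqP e]|_].
  by case: ht; exists r.
by rewrite expr0n eqn0Ngt (prime_gt0 (pcharf_prime chK)) mul0r.
Qed.

(** MacLane's criterion: [N^p] and the image of [C] are linearly disjoint over the image of [C^p].
    It is stated for a bare map so that it also applies to the maps of [Ext]. *)
Definition sep (C N : fieldType) (f : C -> N) : Prop :=
  forall (T : finType) (A : {set T}) (g : T -> C), pind A g -> pind A (f \o g).

Lemma pind_sum_set (K : fieldType) (T : finType) (y : T -> K) :
  pind setT y <-> forall c : T -> K, \sum_t c t ^+ p * y t = 0 -> forall t, c t = 0.
Proof.
split=> h c hc t; first by apply: h; rewrite ?inE // -[RHS]hc; apply: eq_bigl => s; rewrite inE.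
by move=> _; apply: h; rewrite -[RHS]hc; apply: eq_bigl => s; rewrite inE.
Qed.

Lemma lin_indep_pind (K : fieldType) (chK : p \in [pchar K]) (T : finType) (y : T -> K) :
  lin_indep (@is_pth_power K p) y <-> pind setT y.
Proof.
rewrite pind_sum_set; split=> h c hc.
  move=> t; apply: (pcharP_eq0 chK); apply: (h (fun t => c t ^+ p)) => // s.
  by exists (c s).
have [d hd] := choice hc => cs t; rewrite hd (h d) ?expr0n -?lt0n ?(prime_gt0 (pcharf_prime chK)) //.
  by rewrite eqn0Ngt (prime_gt0 (pcharf_prime chK)).
by rewrite -[RHS]cs; apply: eq_bigr => s _; rewrite hd.
Qed.

Section Separable.
Variables (C N : fieldType) (f : {rmorphism C -> N}).
Hypotheses (chC : p \in [pchar C]) (chN : p \in [pchar N]).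

Lemma separable_ext_sep : separable_ext p f <-> sep f.
Proof.
split=> [h T A g hg|h n b fb hb].
  have hg' : pind [set: 'I_#|A|] (g \o enum_val).
    apply: (pind_inj chC _ _ hg) => [i j _ _|i _]; [exact: enum_val_inj | exact: enum_valP].
  have : pind [set: 'I_#|A|] (f \o g \o enum_val).
    apply/(lin_indep_pind chN)/h => [i|c hc]; first by exists (g (enum_val i)).
    have [d hd] := choice hc => cs; have: \sum_i d i ^+ p * (g (enum_val i)) = 0.
      apply: (fmorph_inj f); rewrite rmorph0 -[RHS]cs rmorph_sum; apply: eq_bigr => i _.
      by rewrite hd (rmorphM f).
    move/pind_sum_set: hg' => hg' /hg' d0 i.
    by rewrite hd d0 expr0n eqn0Ngt (prime_gt0 (pcharf_prime chC)) rmorph0.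
  move=> /pind_sum_set hf c hc t tA.
  have := hf (c \o enum_val) _ (enum_rank_in tA t).
  rewrite /= enum_rankK_in //; apply.
  by rewrite -[RHS]hc [in RHS]big_enum_val.
have [g hg] := choice fb; rewrite (_ : b = f \o g); last by apply/funext => i; apply: hg.
apply/(lin_indep_pind chN)/h/pind_sum_set => c hc i.
apply: (pcharP_eq0 chC); apply: (fmorph_inj f); rewrite rmorph0.
apply: (hb (fun i => f (c i ^+ p))) => [j|]; first by exists (c j).
transitivity (f (\sum_i c i ^+ p * g i)); last by rewrite hc rmorph0.
by rewrite raddf_sum; apply: eq_bigr => j _; rewrite hg -rmorphM.
Qed.

(** This takes the p-th root of a relation: over a p-independent subfamily [B] its coefficients
    become p-th powers, and [f] keeps [B] p-independent, so their roots vanish. *)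
Lemma sep_relP : sep f -> forall (T : finType) (A : {set T}) (g : T -> C) (z : T -> N),
  \sum_(t in A) z t ^+ p * f (g t) = 0 ->
  exists (B : {set T}) (u : T -> T -> C),
    (forall t, g t = \sum_(s in B) u t s ^+ p * g s) /\
    (forall s, s \in B -> \sum_(t in A) z t * f (u t s) = 0).
Proof.
move=> hf T A g z hz; have [B indB [u hu]] := exists_max_pind chC g.
exists B, u; split=> // s sB; apply: (hf _ _ _ indB (fun s => \sum_(t in A) z t * f (u t s))) => //.
rewrite -[RHS]hz; under eq_bigr do rewrite (pcharP_sum chN) mulr_suml.
rewrite exchange_big /=; apply: eq_bigr => t tA.
rewrite [X in f X](hu t) raddf_sum mulr_sumr; apply: eq_bigr => r _.
by rewrite exprMn /= rmorphM rmorphXn mulrA.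
Qed.

(** The linear equations of [sep_relP] have coefficients in [C]. Writing [z] over a [C]-independent
    subfamily makes it a combination of solutions in [C], and each solution is a relation between
    the [g t] over [C^p]. *)
Lemma sep_rel : sep f -> forall (T : finType) (A : {set T}) (g : T -> C) (z : T -> N),
  \sum_(t in A) z t ^+ p * f (g t) = 0 ->
  exists (B : {set T}) (v : T -> T -> C),
    (forall t, z t = \sum_(s in B) f (v t s) * z s) /\
    (forall s, s \in B -> \sum_(t in A) v t s ^+ p * g t = 0).
Proof.
move=> hf T A g z hz; have [D [u [hu hzu]]] := sep_relP hf hz.
have [B indB [v hv]] := exists_max_indep_morph f z.
exists B, v; split=> // s sB.
have huv r : r \in D -> \sum_(t in A) v t s * u t r = 0.
  move=> rD; apply: (indB (fun s => \sum_(t in A) v t s * u t r)) => //.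
  rewrite -[RHS](hzu r rD); under eq_bigr do rewrite raddf_sum mulr_suml.
  rewrite exchange_big /=; apply: eq_bigr => t _.
  rewrite [X in X * _](hv t) mulr_suml; apply: eq_bigr => q _.
  by rewrite rmorphM mulrAC.
under eq_bigr do rewrite [X in _ * X]hu mulr_sumr.
rewrite exchange_big /= big1 // => r rD.
transitivity ((\sum_(t in A) v t s * u t r) ^+ p * g r).
  rewrite (pcharP_sum chC) mulr_suml; apply: eq_bigr => t _; by rewrite exprMn mulrA.
by rewrite huv // expr0n eqn0Ngt (prime_gt0 (pcharf_prime chC)) mul0r.
Qed.

(** In the relation where [b] has coefficient 1, some solution given by [sep_rel] is nonzero at [b],
    since 1 is a combination of their values there. That solution can be solved for [b]. *)
Lemma sep_descend : sep f -> forall (T : finType) (g : T -> C) (b : C) (z : T -> N),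
  f b = \sum_t z t ^+ p * f (g t) -> exists u : T -> C, b = \sum_t u t ^+ p * g t.
Proof.
move=> hf T g b z hb.
pose g' (t : option T) := if t is Some t then g t else b.
pose z' (t : option T) := if t is Some t then - z t else 1.
have [|B [v [hv hB]]] := @sep_rel hf _ [set: option T] g' z'.
  rewrite big_setT big_opt /= expr1n mul1r hb -big_split /= big1 // => t _.
  by rewrite (pcharP_opp chN) mulNr subrr.
have [s sB /eqP vs] : exists2 s, s \in B & v None s <> 0.
  apply: contrapT => h; have := hv None; rewrite big1 /=.
    by move/eqP; rewrite oner_eq0.
  move=> s sB; have [->|v0] := eqVneq (v None s) 0; first by rewrite rmorph0 mul0r.
  by case: h; exists s => //; apply/eqP.
have := hB s sB; rewrite big_setT big_opt /=.
move=> /eqP; rewrite addr_eq0 => /eqP e.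
exists (fun t => - (v (Some t) s / v None s)).
have vp : v None s ^+ p != 0 by rewrite expf_neq0.
apply: (mulfI vp); rewrite e -sumrN mulr_sumr; apply: eq_bigr => t _;
  rewrite mulrA -exprMn mulrN mulrCA divff // mulr1.
by rewrite (pcharP_opp chC) mulNr.
Qed.

Lemma sep_pind : sep f -> forall (T : finType) (A : {set T}) (g : T -> C),
  pind A (f \o g) <-> pind A g.
Proof.
move=> hf T A g; split; last exact: hf.
move=> h c hc t tA; apply: (fmorph_inj f); rewrite rmorph0; apply: (h (f \o c)) => //.
by rewrite -[RHS](rmorph0 f) -hc raddf_sum; apply: eq_bigr => s _; rewrite /= rmorphM rmorphXn.
Qed.

(** The coefficients [w] lie in [C], so a relation between the [f (g t)] amounts to linear equations
    over [C] on its roots; these have enough solutions in [C], and each is a relation between the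
    [g t]. The factors [b t] serve to clear denominators when [C] is a field of fractions. *)
Lemma span_pind (T S : finType) (A : {set T}) (B : {set S}) (g b : T -> C) (h : S -> N)
    (w : T -> S -> C) : (forall t, b t != 0) -> pind B h ->
  (forall t, f (g t) * f (b t) ^+ p = \sum_(s in B) f (w t s) ^+ p * h s) ->
  pind A g -> pind A (f \o g).
Proof.
move=> b0 indB hw indA z hz t0 t0A.
have fb0 t : f (b t) != 0 by rewrite fmorph_eq0.
pose z' t := z t / f (b t).
have hzw s : s \in B -> \sum_(t in A) z' t * f (w t s) = 0.
  apply: (indB (fun s => \sum_(t in A) z' t * f (w t s))).
  rewrite -[RHS]hz; under eq_bigr do rewrite (pcharP_sum chN) mulr_suml.
  rewrite exchange_big /=; apply: eq_bigr => t _.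
  under eq_bigr do rewrite exprMn -mulrA.
  by rewrite -mulr_sumr -hw mulrCA mulrC -exprMn divfK.
have [D indD [v hv]] := exists_max_indep_morph f z'.
suff v0 r : r \in D -> v t0 r = 0.
  have : z' t0 = 0 by rewrite hv big1 // => r /v0 ->; rewrite rmorph0 mul0r.
  by move/eqP; rewrite mulf_eq0 invr_eq0 (negPf (fb0 t0)) orbF => /eqP.
move=> rD.
have vw s : s \in B -> \sum_(t in A) v t r * w t s = 0.
  move=> sB; apply: (indD (fun r => \sum_(t in A) v t r * w t s)) => //.
  rewrite -[RHS](hzw s sB); under eq_bigr do rewrite raddf_sum mulr_suml.
  rewrite exchange_big /=; apply: eq_bigr => t _.
  rewrite [X in X * _](hv t) mulr_suml; apply: eq_bigr => q _.
  by rewrite rmorphM mulrAC.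
suff /indA/(_ t0 t0A)/eqP : \sum_(t in A) (v t r * b t) ^+ p * g t = 0.
  by rewrite mulf_eq0 (negPf (b0 t0)) orbF => /eqP.
apply: (fmorph_inj f); rewrite rmorph0 raddf_sum /=.
transitivity (\sum_(s in B) f (\sum_(t in A) v t r * w t s) ^+ p * h s).
  under [RHS]eq_bigr do rewrite raddf_sum (pcharP_sum chN) mulr_suml.
  rewrite exchange_big /=; apply: eq_bigr => t _.
  under [RHS]eq_bigr do rewrite rmorphM exprMn -mulrA.
  by rewrite -mulr_sumr -hw rmorphM rmorphXn rmorphM exprMn mulrCA mulrC.
rewrite big1 // => s sB.
by rewrite vw // rmorph0 expr0n eqn0Ngt (prime_gt0 (pcharf_prime chC)) mul0r.
Qed.

Lemma sep_span :
  (forall (T : finType) (g : T -> C), exists2 b : T -> C, forall t, b t != 0 &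
     exists (S : finType) (B : {set S}) (h : S -> N) (w : T -> S -> C), pind B h /\
       forall t, f (g t) * f (b t) ^+ p = \sum_(s in B) f (w t s) ^+ p * h s) ->
  sep f.
Proof.
move=> H T A g indA; have [b b0 [S [B [h [w [indB hw]]]]]] := H T g.
exact: span_pind b0 indB hw indA.
Qed.

End Separable.

Lemma sep_comp (A B C : fieldType) (f : A -> B) (g : B -> C) :
  sep f -> sep g -> sep (g \o f).
Proof. by move=> hf hg T S y /hf /hg. Qed.

End Powers.

(** * Fields of fractions in a product, derivations *)

Lemma pair_inv (A B : fieldType) (a : A) (b : B) : a != 0 -> b != 0 ->
  ((a, b) : A * B)^-1 = (a^-1, b^-1).
Proof.
move=> a0 b0; have u : ((a, b) : A * B) \is a GRing.unit.
  by apply/andP; split; rewrite /= unitfE.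
by apply: (mulrI u); rewrite mulrV //; congr (_, _); rewrite /= divff.
Qed.

Section GraphField.
Variables (N N' : fieldType) (G : N -> N' -> Prop).
Hypotheses (G1 : G 1 1)
  (GB : forall x y z w, G x y -> G z w -> G (x - z) (y - w))
  (GM : forall x y z w, G x y -> G z w -> G (x * z) (y * w))
  (G0 : forall x y, G x y -> (x = 0 <-> y = 0)).

(** [G] is the graph of an isomorphism between a subring of [N] and one of [N']. Its fractions,
    formed inside the product ring, are a field, and the two projections make it a common subfield
    of [N] and [N']. *)
Definition graph_frac (u : N * N') : Prop :=
  exists x y z w, [/\ G x y, G z w, z != 0, w != 0 & u = (x / z, y / w)].

Definition graph_pred : {pred N * N'} := fun u => `[< graph_frac u >].

Lemma graph_pred_closed : divring_closed graph_pred.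
Proof.
split; first by apply/asboolP; exists 1, 1, 1, 1; split; rewrite ?oner_neq0 // !divr1.
  move=> u v /asboolP[x [y [z [w [h1 h2 z0 w0 ->]]]]].
  move=> /asboolP[x' [y' [z' [w' [h1' h2' z0' w0' ->]]]]]; apply/asboolP.
  exists (x * z' - x' * z), (y * w' - y' * w), (z * z'), (w * w').
  split; rewrite ?mulf_neq0 //; [exact/GB/GM/h2/h1'/GM | exact: GM |].
  by rewrite -!mulNr -!addf_div ?mulNr.
move=> u v /asboolP[x [y [z [w [h1 h2 z0 w0 ->]]]]].
move=> /asboolP[x' [y' [z' [w' [h1' h2' z0' w0' ->]]]]]; apply/asboolP.
have [x0|x0] := eqVneq x' 0.
  have y0 : y' = 0 by apply/(G0 h1').
  have -> : (x / z, y / w) / (x' / z', y' / w') = 0.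
    by rewrite x0 y0 !mul0r -[(0, 0)]/(0 : N * N') invr0 mulr0.
  by exists 0, 0, 1, 1; split; rewrite ?oner_neq0 ?mul0r // -(subrr 1) -[X in G _ X](subrr 1); apply: GB.
have y0 : y' != 0 by apply/eqP => /(G0 h1') /eqP; rewrite (negPf x0).
exists (x * z'), (y * w'), (z * x'), (w * y').
split; rewrite ?mulf_neq0 //; [exact: GM | exact: GM |].
rewrite [(x' / z', _)^-1](@pair_inv _ _ (x' / z') (y' / w')) ?mulf_neq0 ?invr_eq0 //.
by congr (_, _); rewrite /= invf_div mulf_div.
Qed.

HB.instance Definition _ := GRing.isDivringClosed.Build _ graph_pred graph_pred_closed.

Record graph_field := GraphField { graph_val : N * N'; _ : graph_val \in graph_pred }.

HB.instance Definition _ := [isSub for graph_val].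
HB.instance Definition _ := [Choice of graph_field by <:].
HB.instance Definition _ := [SubChoice_isSubComUnitRing of graph_field by <:].

Lemma graph_field_axiom (c : graph_field) : c != 0 -> c \is a GRing.unit.
Proof.
case: c => u hu c0; have := hu => /asboolP[x [y [z [w [h1 h2 z0 w0 e]]]]].
have [x0|x0] := eqVneq x 0.
  have y0 : y = 0 by apply/(G0 h1).
  case/eqP: c0; apply: val_inj; rewrite /= e x0 y0 !mul0r //.
have y0 : y != 0 by apply/eqP => /(G0 h1) /eqP; rewrite (negPf x0).
have uu : u \is a GRing.unit.
  by rewrite e; apply/andP; split; rewrite /= unitfE mulf_neq0 // invr_eq0.
apply/unitrP.
have vh : u^-1 \in graph_pred by apply: rpredVr.
by exists (GraphField vh); split; apply: val_inj; rewrite /= ?mulVr ?mulrV.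
Qed.

HB.instance Definition _ := GRing.ComUnitRing_isField.Build graph_field graph_field_axiom.

Lemma graph_field_exists : exists (Q : fieldType) (q1 : {rmorphism Q -> N}) (q2 : {rmorphism Q -> N'}),
  (forall x y, G x y -> exists2 c, q1 c = x & q2 c = y) /\
  (forall c, exists a b, [/\ G (q1 a) (q2 a), G (q1 b) (q2 b), b != 0 & c = a / b]).
Proof.
exists graph_field, (fst \o (val : graph_field -> N * N')), (snd \o (val : graph_field -> N * N')).
have key x y : G x y -> (x, y) \in graph_pred.
  by move=> h; apply/asboolP; exists x, y, 1, 1; split; rewrite ?oner_neq0 // !divr1.
split=> [x y h|[u hu]]; first by exists (GraphField (key _ _ h)).
have := hu => /asboolP[x [y [z [w [h1 h2 z0 w0 e]]]]].
exists (GraphField (key _ _ h1)), (GraphField (key _ _ h2)).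
have b0 : GraphField (key _ _ h2) != 0.
  by apply/eqP => /(congr1 (fst \o graph_val)) /= /eqP; rewrite (negPf z0).
split=> //; apply: (mulIf b0); rewrite divfK //; apply: val_inj; rewrite /= e.
by congr (_, _); rewrite /= divfK.
Qed.

End GraphField.

Lemma subfield_exists (K : fieldType) (k : K -> Prop) : subfield_pred k ->
  exists (S : fieldType) (s : {rmorphism S -> K}), forall x, k x <-> exists a, s a = x.
Proof.
move=> hk; have [|||| S [s [s2 [hS fS]]]] := @graph_field_exists K K (fun a b => a = b /\ k a).
- by split=> //; apply: subf1.
- by move=> x y z w [-> h1] [-> h2]; split=> //; apply: subfB.
- by move=> x y z w [-> h1] [-> h2]; split=> //; apply: subfM.
- by move=> x y [-> _].
exists S, s => x; split=> [kx|[a <-]]; first by have [|a] := hS x x; last by exists a.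
have [u [v [[_ h1] [_ h2] v0 ->]]] := fS a.
by rewrite fmorph_div; apply: (subfM hk) => //; apply: (subfV hk).
Qed.

Lemma lift_rmorphism (R : nzRingType) (Q N : fieldType) (q : {rmorphism Q -> N})
    (k : {rmorphism R -> N}) :
  (forall r, exists c, q c = k r) -> exists r : {rmorphism R -> Q}, forall x, q (r x) = k x.
Proof.
move=> h; pose f x := projT1 (cid (h x)).
have hf x : q (f x) = k x by rewrite /f; case: cid.
have fB : zmod_morphism f by move=> x y; apply: (fmorph_inj q); rewrite rmorphB !hf rmorphB.
have fM : monoid_morphism f.
  by split=> [|x y]; apply: (fmorph_inj q); rewrite ?rmorph1 ?rmorphM !hf ?rmorph1 ?rmorphM.
pose fA := GRing.isZmodMorphism.Build R Q f fB.
pose fMm := GRing.isMonoidMorphism.Build R Q f fM.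
pose F : {rmorphism R -> Q} := HB.pack f fA fMm.
by exists F.
Qed.

(** * Derivations along a ring morphism *)

Definition deriv_over (A B : pzRingType) (f D : A -> B) : Prop :=
  (forall x y, D (x + y) = D x + D y) /\ (forall x y, D (x * y) = D x * f y + f x * D y).

Section DerivOver.
Variables (A : pzRingType) (B : pzRingType) (f : {rmorphism A -> B}) (D : A -> B).
Hypothesis hD : deriv_over f D.

Lemma der_D x y : D (x + y) = D x + D y. Proof. by case: hD. Qed.
Lemma der_M x y : D (x * y) = D x * f y + f x * D y. Proof. by case: hD. Qed.
Lemma der_0 : D 0 = 0.
Proof. by apply: (addrI (D 0)); rewrite -der_D !addr0. Qed.
Lemma der_N x : D (- x) = - D x.
Proof. by apply/eqP; rewrite -subr_eq0 opprK -der_D addNr der_0. Qed.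
Lemma der_B x y : D (x - y) = D x - D y.
Proof. by rewrite der_D der_N. Qed.
Lemma der_1 : D 1 = 0.
Proof. by apply: (addrI (D 1)); rewrite addr0 -[in RHS](mul1r 1) der_M rmorph1 mulr1 mul1r. Qed.
Lemma der_sum (I : Type) (r : seq I) (P : pred I) (F : I -> A) :
  D (\sum_(i <- r | P i) F i) = \sum_(i <- r | P i) D (F i).
Proof. by apply: (big_morph D der_D der_0). Qed.

End DerivOver.

Section DerivOverCom.
Variables (A B : comNzRingType) (f : {rmorphism A -> B}) (D : A -> B).
Hypothesis hD : deriv_over f D.

Lemma der_X x n : D (x ^+ n) = (f x ^+ n.-1 * D x) *+ n.
Proof.
elim: n => [|n IH]; first by rewrite expr0 (der_1 hD) mulr0n.
rewrite exprS (der_M hD) IH /= rmorphXn; case: n {IH} => [|n].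
  by rewrite expr0 !mulr0n mulr0 addr0 mulr1 mulr1n mul1r.
by rewrite [in RHS]mulrS mulrnAr mulrA -exprS mulrC.
Qed.

Lemma der_Xp p (chB : p \in [pchar B]) x : D (x ^+ p) = 0.
Proof. by rewrite der_X -mulr_natr (pcharf0 chB) mulr0. Qed.

End DerivOverCom.

Lemma der_div (A B : fieldType) (f : {rmorphism A -> B}) (D : A -> B) (hD : deriv_over f D) x y :
  y != 0 -> D (x / y) = (D x * f y - f x * D y) / f y ^+ 2.
Proof.
move=> y0; have fy : f y != 0 by rewrite fmorph_eq0.
have e := der_M hD (x / y) y; rewrite divfK // in e.
by rewrite e fmorph_div; field.
Qed.

Section ExtendDeriv.
Variables (R : comNzRingType) (S H : fieldType) (r : {rmorphism R -> S}) (t : {rmorphism S -> H}).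
Hypothesis frac : forall s, exists a b, r b != 0 /\ s = r a / r b.

Lemma deriv_frac_unique (D1 D2 : S -> H) :
  deriv_over t D1 -> deriv_over t D2 -> (forall a, D1 (r a) = D2 (r a)) -> D1 =1 D2.
Proof.
move=> h1 h2 e s; have [a [b [b0 ->]]] := frac s.
by rewrite (der_div h1) // (der_div h2) // !e.
Qed.

(** The quotient rule. It does not depend on the chosen fraction, because [a * d - c * b] lies in
    the kernel of [r] when [a / b] and [c / d] have the same image, and [E] vanishes on that
    kernel. *)
Lemma extend_deriv_frac (E : R -> H) :
  deriv_over (t \o r) E -> (forall x, r x = 0 -> E x = 0) ->
  exists2 D : S -> H, deriv_over t D & forall x, D (r x) = E x.
Proof.
move=> hE ker.
have [num hnum] := choice frac; have [den hden] := choice hnum.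
have den0 s : r (den s) != 0 by case: (hden s).
have numden s : s = r (num s) / r (den s) by case: (hden s).
pose trE := (t \o r) : {rmorphism R -> H}.
have hE' : deriv_over trE E by [].
pose Q a b := (E a * t (r b) - t (r a) * E b) / t (r b) ^+ 2.
have tr0 b : r b != 0 -> t (r b) != 0 by rewrite fmorph_eq0.
have wd a b c d : r b != 0 -> r d != 0 -> r a / r b = r c / r d -> Q a b = Q c d.
  move=> b0 d0 e.
  have e1 : r a * r d = r c * r b.
    by move/eqP: e; rewrite eqr_div // => /eqP.
  have : E (a * d - c * b) = 0 by apply: ker; rewrite rmorphB !rmorphM e1 subrr.
  rewrite (der_B hE') !(der_M hE') /= => /eqP; rewrite subr_eq0 => /eqP e2.
  have te1 : t (r a) * t (r d) = t (r c) * t (r b) by rewrite -[LHS]rmorphM -[RHS]rmorphM e1.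
  have tb := tr0 _ b0; have td := tr0 _ d0.
  rewrite /Q; apply/eqP; rewrite eqr_div ?expf_neq0 //; apply/eqP.
  have -> : t (r a) = t (r c) * t (r b) / t (r d) by rewrite -te1 mulfK.
  have -> : E a = (E c * t (r b) + t (r c) * E b - t (r a) * E d) / t (r d).
    by rewrite -e2 addrK mulfK.
  have -> : t (r a) = t (r c) * t (r b) / t (r d) by rewrite -te1 mulfK.
  move: (t (r b)) (t (r d)) (t (r c)) (E b) (E c) (E d) tb td => B D C EB EC ED tb td.
  apply: (mulIf td); apply: (mulIf td).
  by field; rewrite td.
exists (fun s => Q (num s) (den s)); last first.
  move=> x; rewrite (@wd _ _ x 1) ?rmorph1 ?oner_neq0 ?divr1 -?numden //.
  by rewrite /Q (der_1 hE') !rmorph1 mulr1 mulr0 subr0 expr1n divr1.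
split=> x y.
  rewrite (@wd _ _ (num x * den y + num y * den x) (den x * den y)) //; last 2 first.
  - by rewrite rmorphM mulf_neq0.
  - by rewrite -numden [in LHS](numden x) [in LHS](numden y) addf_div // rmorphD !rmorphM.
  rewrite /Q !(der_D hE') !(der_M hE') /= !(rmorphD, rmorphM).
  have := tr0 _ (den0 x); have := tr0 _ (den0 y).
  move: (t (r (num x))) (t (r (den x))) (t (r (num y))) (t (r (den y))).
  move: (E (num x)) (E (den x)) (E (num y)) (E (den y)) => ? ? ? ? ? ? ? ? h1 h2.
  by field; rewrite h1 h2.
rewrite (@wd _ _ (num x * num y) (den x * den y)) //; last 2 first.
- by rewrite rmorphM mulf_neq0.
- by rewrite -numden [in LHS](numden x) [in LHS](numden y) mulf_div !rmorphM.
have tE z : t z = t (r (num z)) / t (r (den z)) by rewrite -fmorph_div -numden.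
rewrite /Q !(der_M hE') /= !rmorphM (tE x) (tE y).
have := tr0 _ (den0 x); have := tr0 _ (den0 y).
move: (t (r (num x))) (t (r (den x))) (t (r (num y))) (t (r (den y))).
move: (E (num x)) (E (den x)) (E (num y)) (E (den y)) => ? ? ? ? ? ? ? ? h1 h2.
by field; rewrite h1 h2.
Qed.

End ExtendDeriv.

(** The value that an extension of [D] sending [x] to [d] has to take at [P(x)]. It is a derivation
    on polynomials for every [d]; the relations satisfied by [x] are the only obstruction to passing
    to the field that [x] generates. *)
Lemma deriv_poly (A B : fieldType) (f : {rmorphism A -> B}) (D : A -> B) (x d : B) :
  deriv_over f D ->
  deriv_over (fun P : {poly A} => (map_poly f P).[x])
    (fun P => (map_poly D P).[x] + (map_poly f P^`()).[x] * d).
Proof.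
move=> hD; have D0 := der_0 hD.
have cD P k : (map_poly D P)`_k = D P`_k by rewrite coef_map_id0.
split=> P Q.
  have -> : map_poly D (P + Q) = map_poly D P + map_poly D Q.
    by apply/polyP => i; rewrite coefD !cD coefD (der_D hD).
  by rewrite derivD rmorphD !hornerD; ring.
have -> : map_poly D (P * Q) = map_poly D P * map_poly f Q + map_poly f P * map_poly D Q.
  apply/polyP => i; rewrite coefD !coefM cD coefM (der_sum hD) -big_split /=.
  by apply: eq_bigr => j _; rewrite (der_M hD) !cD !coef_map.
rewrite derivM rmorphD !rmorphM !hornerD !hornerM.
by ring.
Qed.

(** * Ultraproducts *)

Local Open Scope quotient_scope.

Record ultrafilter (I : Type) := Ultrafilter {
  large :> (I -> Prop) -> Prop;
  largeS : forall P Q, large P -> (forall i, P i -> Q i) -> large Q;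
  largeI : forall P Q, large P -> large Q -> large (fun i => P i /\ Q i);
  largeC : forall P, large P \/ large (fun i => ~ P i);
  large0 : ~ large (fun=> False) }.

Lemma dchoice (I : Type) (X : I -> Type) (P : forall i, X i -> Prop) :
  (forall i, exists x, P i x) -> exists f : forall i, X i, forall i, P i (f i).
Proof. by move=> h; exists (fun i => projT1 (cid (h i))) => i; case: (cid (h i)). Qed.

Section Ultra.
Variables (I : Type) (U : ultrafilter I).

Lemma large_true (P : I -> Prop) : (forall i, P i) -> U P.
Proof.
move=> h; have [//|hC] := largeC U P.
by case: (large0 (u := U)); apply: largeS hC _ => i /(_ (h i)).
Qed.

Lemma large_ex (P : I -> Prop) : U P -> exists i, P i.
Proof.
move=> h; apply: contrapT => hn; case: (large0 (u := U)).
by apply: largeS h _ => i Pi; apply: hn; exists i.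
Qed.

Lemma largeN (P : I -> Prop) : U (fun i => ~ P i) <-> ~ U P.
Proof.
split=> [h h'|h]; last by case: (largeC U P).
by case: (large0 (u := U)); apply: largeS (largeI h h') _ => i [].
Qed.

Lemma large_fin (T : finType) (P : T -> I -> Prop) :
  (forall t, U (P t)) -> U (fun i => forall t, P t i).
Proof.
move=> h; have : U (fun i => forall t, t \in enum T -> P t i).
  elim: (enum T) => [|t s IH]; first exact: large_true.
  apply: largeS (largeI (h t) IH) _ => i [ht hs] t'.
  by rewrite inE => /orP[/eqP ->|/hs].
by move/largeS; apply=> i hi t; apply: hi; rewrite mem_enum.
Qed.

Lemma large_seq (T : eqType) (s : seq T) (P : T -> I -> Prop) :
  (forall t, t \in s -> U (P t)) -> U (fun i => forall t, t \in s -> P t i).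
Proof.
elim: s => [|t s IH] h; first exact: large_true.
have hs : U (fun i => forall t, t \in s -> P t i).
  by apply: IH => t' ht'; apply: h; rewrite inE ht' orbT.
apply: largeS (largeI (h t (mem_head t s)) hs) _ => i [ht hi] t'.
by rewrite inE => /orP[/eqP ->|/hi].
Qed.

End Ultra.

Lemma ultrafilter_exists (I J : Type) (b : J -> I -> Prop) (j0 : J) :
  (forall j, exists i, b j i) ->
  (forall j k, exists l, forall i, b l i -> b j i /\ b k i) ->
  exists U : ultrafilter I, forall j, U (b j).
Proof.
move=> b0 bd; pose F := fun P : classical_sets.set I => exists j, forall i, b j i -> P i.
have pF : filter.ProperFilter F.
  split; first by case=> j /= h; have [i /h] := b0 j.
  split; first by exists j0.
    move=> P Q [j hj] [k hk]; have [l hl] := bd j k.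
    by exists l => i /hl[/hj ? /hk ?].
  by move=> P Q PQ [j hj]; exists j => i /hj/PQ.
have [G [UG FG]] := filter.ultraFilterLemma pF.
have pG := @filter.ultra_proper _ _ UG.
unshelve eexists (@Ultrafilter I G _ _ _ _).
- by move=> P Q hP PQ; apply: (@filter.filterS _ G _ P).
- by move=> P Q hP hQ; apply: (@filter.filterI _ G).
- by move=> P; have := filter.in_ultra_setVsetC P UG.
- exact: (@filter.filter_not_empty _ G).
by move=> j; apply: FG; exists j.
Qed.

(** The principal ultrafilter on a point allows results on ultraproducts to be applied to a single
    field. *)
Definition ultra_unit : ultrafilter unit.
Proof.
refine (@Ultrafilter unit (fun P => P tt) _ _ _ _).
- by move=> P Q h; apply.
- by move=> P Q.
- by move=> P; have [h|h] := pselect (P tt); [left | right].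
- by [].
Defined.

Section UltraProduct.
Variables (I : Type) (U : ultrafilter I) (E : I -> fieldType).

(* Depends on [U] so that it is nontrivial: the index set is not empty. *)
Definition uprod := (fun (_ : ultrafilter I) => forall i, E i) U.

HB.instance Definition _ := gen_eqMixin uprod.
HB.instance Definition _ := gen_choiceMixin uprod.

Implicit Types f g h : uprod.

Definition uprod_add f g : uprod := fun i => f i + g i.
Definition uprod_opp f : uprod := fun i => - f i.
Definition uprod_mul f g : uprod := fun i => f i * g i.
Definition uprod0 : uprod := fun i => 0.
Definition uprod1 : uprod := fun i => 1.

Lemma uprodP f g : (forall i, f i = g i) -> f = g.
Proof. exact: functional_extensionality_dep. Qed.

Lemma uprod_addA : associative uprod_add.
Proof. by move=> f g h; apply: uprodP => i; rewrite /uprod_add addrA. Qed.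
Lemma uprod_addC : commutative uprod_add.
Proof. by move=> f g; apply: uprodP => i; rewrite /uprod_add addrC. Qed.
Lemma uprod_add0 : left_id uprod0 uprod_add.
Proof. by move=> f; apply: uprodP => i; rewrite /uprod_add add0r. Qed.
Lemma uprod_addN : left_inverse uprod0 uprod_opp uprod_add.
Proof. by move=> f; apply: uprodP => i; rewrite /uprod_add addNr. Qed.
HB.instance Definition _ := GRing.isZmodule.Build uprod
  uprod_addA uprod_addC uprod_add0 uprod_addN.

Lemma uprod_mulA : associative uprod_mul.
Proof. by move=> f g h; apply: uprodP => i; rewrite /uprod_mul mulrA. Qed.
Lemma uprod_mulC : commutative uprod_mul.
Proof. by move=> f g; apply: uprodP => i; rewrite /uprod_mul mulrC. Qed.
Lemma uprod_mul1 : left_id uprod1 uprod_mul.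
Proof. by move=> f; apply: uprodP => i; rewrite /uprod_mul mul1r. Qed.
Lemma uprod_mulD : left_distributive uprod_mul uprod_add.
Proof. by move=> f g h; apply: uprodP => i; rewrite /uprod_mul mulrDl. Qed.
Lemma uprod_1_neq0 : uprod1 != 0.
Proof.
apply/eqP => e; have [i _] := large_ex (large_true U (fun i : I => Logic.I)).
by have /eqP := congr1 (fun f : uprod => f i) e; rewrite oner_eq0.
Qed.
HB.instance Definition _ := GRing.Zmodule_isComNzRing.Build uprod
  uprod_mulA uprod_mulC uprod_mul1 uprod_mulD uprod_1_neq0.

Definition uev (i : I) (f : uprod) : E i := f i.
Lemma uev_is_zmod i : zmod_morphism (uev i). Proof. by []. Qed.
Lemma uev_is_monoid i : monoid_morphism (uev i). Proof. by []. Qed.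
HB.instance Definition _ i := GRing.isZmodMorphism.Build uprod (E i) (uev i) (uev_is_zmod i).
HB.instance Definition _ i := GRing.isMonoidMorphism.Build uprod (E i) (uev i) (uev_is_monoid i).

Definition ueq f g : bool := `[< U (fun i => f i = g i) >].
Lemma ueq_refl : reflexive ueq.
Proof. by move=> f; apply/asboolP/large_true. Qed.
Lemma ueq_sym : ssrbool.symmetric ueq.
Proof. by move=> f g; apply/asboolP/asboolP => h; apply: largeS h _ => i ->. Qed.
Lemma ueq_trans : transitive ueq.
Proof.
move=> g f h /asboolP h1 /asboolP h2; apply/asboolP.
by apply: largeS (largeI h1 h2) _ => i [-> ->].
Qed.
Canonical ueq_equiv := EquivRel ueq ueq_refl ueq_sym ueq_trans.

Definition UP := {eq_quot ueq}.
HB.instance Definition _ := EqQuotient.on UP.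
HB.instance Definition _ := Choice.on UP.

Definition upi (f : uprod) : UP := \pi_UP f.
Definition urep (x : UP) : uprod := repr x.

Lemma urepK x : upi (urep x) = x. Proof. exact: reprK. Qed.

Lemma upi_eq f g : upi f = upi g <-> U (fun i => f i = g i).
Proof.
split; first by move/eqmodP/asboolP.
by move=> h; apply/eqmodP/asboolP.
Qed.

Lemma urep_pi f : U (fun i => urep (upi f) i = f i).
Proof. by apply/upi_eq; rewrite urepK. Qed.

Lemma upi_surj x : exists f, x = upi f.
Proof. by exists (urep x); rewrite urepK. Qed.

Definition UP_add x y := upi (urep x + urep y).
Definition UP_opp x := upi (- urep x).
Definition UP_mul x y := upi (urep x * urep y).
Definition UP_inv x := upi (fun i => (urep x i)^-1).

Lemma UP_addE f g : UP_add (upi f) (upi g) = upi (f + g).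
Proof.
by apply/upi_eq; apply: largeS (largeI (urep_pi f) (urep_pi g)) _ => i [h1 h2]; congr (_ + _).
Qed.
Lemma UP_oppE f : UP_opp (upi f) = upi (- f).
Proof. by apply/upi_eq; apply: largeS (urep_pi f) _ => i h1; congr (- _). Qed.
Lemma UP_mulE f g : UP_mul (upi f) (upi g) = upi (f * g).
Proof.
by apply/upi_eq; apply: largeS (largeI (urep_pi f) (urep_pi g)) _ => i [h1 h2]; congr (_ * _).
Qed.
Lemma UP_invE f : UP_inv (upi f) = upi (fun i => (f i)^-1).
Proof. by apply/upi_eq; apply: largeS (urep_pi f) _ => i ->. Qed.

Lemma UP_ind (P : UP -> Prop) : (forall f, P (upi f)) -> forall x, P x.
Proof. by move=> h x; have [f ->] := upi_surj x. Qed.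

Lemma UP_addA : associative UP_add.
Proof. by do 3!elim/UP_ind=> ?; rewrite !UP_addE addrA. Qed.
Lemma UP_addC : commutative UP_add.
Proof. by do 2!elim/UP_ind=> ?; rewrite !UP_addE addrC. Qed.
Lemma UP_add0 : left_id (upi 0) UP_add.
Proof. by elim/UP_ind=> ?; rewrite !UP_addE add0r. Qed.
Lemma UP_addN : left_inverse (upi 0) UP_opp UP_add.
Proof. by elim/UP_ind=> ?; rewrite UP_oppE !UP_addE addNr. Qed.
HB.instance Definition _ := GRing.isZmodule.Build UP UP_addA UP_addC UP_add0 UP_addN.

Lemma UP_mulA : associative UP_mul.
Proof. by do 3!elim/UP_ind=> ?; rewrite !UP_mulE mulrA. Qed.
Lemma UP_mulC : commutative UP_mul.
Proof. by do 2!elim/UP_ind=> ?; rewrite !UP_mulE mulrC. Qed.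
Lemma UP_mul1 : left_id (upi 1) UP_mul.
Proof. by elim/UP_ind=> ?; rewrite !UP_mulE mul1r. Qed.
Lemma UP_mulD : left_distributive UP_mul UP_add.
Proof. by do 3!elim/UP_ind=> ?; rewrite !(UP_mulE, UP_addE) mulrDl. Qed.
Lemma UP_1_neq0 : upi 1 != upi 0.
Proof. by apply/eqP => /upi_eq/large_ex[i /eqP]; rewrite oner_eq0. Qed.
HB.instance Definition _ := GRing.Zmodule_isComNzRing.Build UP
  UP_mulA UP_mulC UP_mul1 UP_mulD UP_1_neq0.

Lemma upi_is_zmod : zmod_morphism upi.
Proof.
by move=> f g; rewrite -[RHS]/(UP_add (upi f) (UP_opp (upi g))) UP_oppE UP_addE.
Qed.
Lemma upi_is_monoid : monoid_morphism upi.
Proof. by split=> // f g; rewrite -[RHS]/(UP_mul (upi f) (upi g)) UP_mulE. Qed.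
HB.instance Definition _ := GRing.isZmodMorphism.Build uprod UP upi upi_is_zmod.
HB.instance Definition _ := GRing.isMonoidMorphism.Build uprod UP upi upi_is_monoid.

Lemma UP_mulV x : x != 0 -> UP_inv x * x = 1.
Proof.
elim/UP_ind: x => f f0; rewrite UP_invE -[LHS]/(UP_mul _ _) UP_mulE; apply/upi_eq.
have /largeN h : ~ U (fun i => f i = 0) by move/upi_eq/eqP; rewrite (negPf f0).
by apply: largeS h _ => i /eqP fi; rewrite -[LHS]/(_ * _) mulVf.
Qed.
Lemma UP_inv0 : UP_inv 0 = 0.
Proof. by rewrite UP_invE; apply/upi_eq/large_true => i; rewrite invr0. Qed.
HB.instance Definition _ := GRing.ComNzRing_isField.Build UP UP_mulV UP_inv0.

Lemma upiV f : (upi f)^-1 = upi (fun i => (f i)^-1).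
Proof. exact: UP_invE. Qed.

Lemma upi_eq0 f : upi f = 0 <-> U (fun i => f i = 0).
Proof. by rewrite -(rmorph0 upi); apply: upi_eq. Qed.

Lemma upi_poly_eq0 (P : {poly uprod}) :
  map_poly upi P = 0 <-> U (fun i => map_poly (uev i) P = 0).
Proof.
split=> [/polyP h|h].
  have : U (fun i => forall k : 'I_(size P), uev i P`_k = 0).
    by apply: large_fin => k; apply/upi_eq0; rewrite -coef_map h coef0.
  move/largeS; apply=> i hi; apply/polyP => k; rewrite coef_map coef0.
  case: (ltnP k (size P)) => hk; first exact: (hi (Ordinal hk)).
  by rewrite nth_default // rmorph0.
apply/polyP => k; rewrite coef_map coef0; apply/upi_eq0; apply: largeS h _ => i h.
by rewrite -[P`_k i]/(uev i P`_k) -coef_map h coef0.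
Qed.

Lemma upi_poly_surj (P : {poly UP}) : exists Q : {poly uprod}, map_poly upi Q = P.
Proof.
exists (\poly_(k < size P) urep P`_k); apply/polyP => k.
rewrite coef_map coef_poly; case: ltnP => h; first exact: urepK.
by rewrite nth_default //; exact: (rmorph0 (@upi I U E)).
Qed.

Lemma UP_pchar p : (forall i, p \in [pchar E i]) -> p \in [pchar UP].
Proof.
move=> ch; have [i _] := large_ex (large_true U (fun i : I => Logic.I)).
rewrite inE (pcharf_prime (ch i)) /=; apply/eqP.
rewrite -(rmorph_nat upi); apply/upi_eq0/large_true => j.
by rewrite -[LHS]/(uev j _) rmorph_nat (pcharf0 (ch j)).
Qed.

End UltraProduct.

Section UltraMap.
Variables (I : Type) (U : ultrafilter I) (E F : I -> fieldType).

Definition UPmap (f : forall i, E i -> F i) (x : UP U E) : UP U F :=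
  upi (fun i => f i (urep x i)).

Lemma UPmapE (f : forall i, E i -> F i) g :
  UPmap f (upi g) = upi (fun i => f i (g i)).
Proof. by apply/upi_eq; apply: largeS (urep_pi g) _ => i ->. Qed.

Variable f : forall i, {rmorphism E i -> F i}.

Lemma UPmap_is_zmod : zmod_morphism (UPmap f).
Proof.
elim/UP_ind=> g; elim/UP_ind=> h; rewrite -rmorphB !UPmapE -rmorphB.
by congr upi; apply: uprodP => i; rewrite -[LHS]/(f i (g i - h i)) rmorphB.
Qed.
Lemma UPmap_is_monoid : monoid_morphism (UPmap f).
Proof.
split; first by rewrite -(rmorph1 (@upi I U E)) UPmapE -(rmorph1 (@upi I U F)); congr upi;
  apply: uprodP => i; rewrite -[LHS]/(f i 1) rmorph1.
elim/UP_ind=> g; elim/UP_ind=> h; rewrite -rmorphM !UPmapE -rmorphM.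
by congr upi; apply: uprodP => i; rewrite -[LHS]/(f i (g i * h i)) rmorphM.
Qed.
HB.instance Definition _ := GRing.isZmodMorphism.Build _ _ (UPmap f) UPmap_is_zmod.
HB.instance Definition _ := GRing.isMonoidMorphism.Build _ _ (UPmap f) UPmap_is_monoid.

End UltraMap.

Section Diagonal.
Variables (I : Type) (U : ultrafilter I) (K : fieldType).

Definition diag (x : K) : UP U (fun=> K) := upi (fun=> x).
Lemma diag_is_zmod : zmod_morphism diag.
Proof. by move=> x y; rewrite /diag -rmorphB. Qed.
Lemma diag_is_monoid : monoid_morphism diag.
Proof. by split=> // x y; rewrite /diag -rmorphM. Qed.
HB.instance Definition _ := GRing.isZmodMorphism.Build _ _ diag diag_is_zmod.
HB.instance Definition _ := GRing.isMonoidMorphism.Build _ _ diag diag_is_monoid.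

End Diagonal.

Section UltraDiff.
Variables (I : Type) (U : ultrafilter I) (K : I -> diffField).

Definition UPder : UP U K -> UP U K := UPmap (fun i => @der (K i)).

Lemma UPderD : {morph UPder : x y / x + y}.
Proof.
elim/UP_ind=> g; elim/UP_ind=> h; rewrite -rmorphD /UPder !UPmapE -rmorphD.
by congr upi; apply: uprodP => i; rewrite -[LHS]/(der (g i + h i)) derD.
Qed.
Lemma UPderM : forall x y, UPder (x * y) = UPder x * y + x * UPder y.
Proof.
elim/UP_ind=> g; elim/UP_ind=> h; rewrite -rmorphM /UPder !UPmapE -!rmorphM -rmorphD.
by congr upi; apply: uprodP => i; rewrite -[LHS]/(der (g i * h i)) derM.
Qed.

Definition UPdiff : diffField := DiffField UPderD UPderM.

Lemma UPdiffE f : @der UPdiff (upi f) = upi (fun i => der (f i)).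
Proof. exact: UPmapE. Qed.

End UltraDiff.

Section UltraPind.
Variables (p : nat) (I : Type) (U : ultrafilter I) (E : I -> fieldType).

Lemma upi_sum (T : Type) (r : seq T) (P : pred T) (F : T -> uprod U E) :
  \sum_(t <- r | P t) upi (F t) = upi (fun i => \sum_(t <- r | P t) F t i).
Proof.
rewrite -rmorph_sum; congr upi; apply: uprodP => i.
by rewrite -[LHS]/(uev i _) rmorph_sum.
Qed.

Lemma upi_psum (T : Type) (r : seq T) (P : pred T) (c y : T -> uprod U E) :
  \sum_(t <- r | P t) upi (c t) ^+ p * upi (y t) =
  upi (fun i => \sum_(t <- r | P t) c t i ^+ p * y t i).
Proof.
under eq_bigr do rewrite -rmorphXn -rmorphM; rewrite upi_sum; congr upi.
apply: uprodP => i; apply: eq_bigr => t _.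
by rewrite -[LHS]/(uev i _) rmorphM rmorphXn.
Qed.

(** The theorem of Los for p-independence. Relations chosen in the bad factors assemble to one in
    the ultraproduct, and it is nontrivial because [T] is finite. *)
Lemma upi_pind (T : finType) (A : {set T}) (y : T -> uprod U E) :
  pind p A (fun t => upi (y t)) <-> U (fun i => pind p A (fun t => y t i)).
Proof.
split=> [h|h c hc t tA]; last first.
  pose d t := urep (c t); have cd s : c s = upi (d s) by rewrite urepK.
  move: hc; under eq_bigr do rewrite cd; rewrite upi_psum => /upi_eq0 hc.
  rewrite cd; apply/upi_eq0; apply: largeS (largeI h hc) _ => i [hi ci].
  exact: (hi (fun t => d t i)).
apply: contrapT => /largeN hn.
have /dchoice[c hc] : forall i, exists c : T -> E i, ~ pind p A (fun t => y t i) ->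
    \sum_(t in A) c t ^+ p * y t i = 0 /\ exists t, t \in A /\ c t <> 0.
  move=> i; have [h'|/existsNP[c /not_implyP[hc /existsNP[t /not_implyP[tA ct]]]]] :=
    pselect (pind p A (fun t => y t i)); first by exists (fun=> 0).
  by exists c => _; split=> //; exists t.
pose d t : uprod U E := fun i => c i t.
have hd : \sum_(t in A) upi (d t) ^+ p * upi (y t) = 0.
  by rewrite upi_psum; apply/upi_eq0; apply: largeS hn _ => i /hc[].
have d0 := h _ hd.
have : U (fun i => forall t, t \in A -> d t i = 0).
  apply: large_fin => t; have [tA|tA] := boolP (t \in A); last exact: large_true.
  by have /upi_eq0 h' := d0 t tA; apply: largeS h' _.
move=> h'; have [i [/hc[_ [t [tA ct]]] /(_ t tA) ci]] := large_ex (largeI hn h').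
by apply: ct.
Qed.

End UltraPind.

Local Close Scope quotient_scope.

(** * Simple extensions *)

Definition hm (G Q : fieldType) (i : {rmorphism G -> Q}) (x : Q) : {rmorphism {poly G} -> Q} :=
  horner_eval x \o map_poly i.

Lemma hmE (G Q : fieldType) (i : {rmorphism G -> Q}) x P : hm i x P = (map_poly i P).[x].
Proof. by []. Qed.

Lemma hmC (G Q : fieldType) (i : {rmorphism G -> Q}) x c : hm i x c%:P = i c.
Proof. by rewrite hmE map_polyC hornerC. Qed.

Lemma hmX (G Q : fieldType) (i : {rmorphism G -> Q}) x : hm i x 'X = x.
Proof. by rewrite hmE map_polyX hornerX. Qed.

Lemma map_poly_cons (A B : nzRingType) (f : {rmorphism A -> B}) P c :
  map_poly f (P * 'X + c%:P) = map_poly f P * 'X + (f c)%:P.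
Proof. by rewrite rmorphD rmorphM /= map_polyX map_polyC. Qed.

Lemma hm_cons (G Q : fieldType) (i : {rmorphism G -> Q}) x P c :
  hm i x (P * 'X + c%:P) = hm i x P * x + i c.
Proof. by rewrite rmorphD rmorphM hmX hmC. Qed.

Lemma hm_comp (G Q H : fieldType) (i : {rmorphism G -> Q}) (j : {rmorphism Q -> H}) x P :
  hm (j \o i) (j x) P = j (hm i x P).
Proof. by rewrite !hmE map_poly_comp horner_map. Qed.

Definition frac_gen (G Q : fieldType) (i : {rmorphism G -> Q}) (x : Q) : Prop :=
  forall c, exists P R : {poly G}, hm i x R != 0 /\ c = hm i x P / hm i x R.

(** Equal kernels make the two images of [R] isomorphic, and [Q] is their common field of
    fractions. *)
Lemma graph_ext (R : comNzRingType) (N N' : fieldType) (r1 : {rmorphism R -> N})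
    (r2 : {rmorphism R -> N'}) :
  (forall P, r1 P = 0 <-> r2 P = 0) ->
  exists (Q : fieldType) (q1 : {rmorphism Q -> N}) (q2 : {rmorphism Q -> N'})
    (r : {rmorphism R -> Q}),
    [/\ forall P, q1 (r P) = r1 P, forall P, q2 (r P) = r2 P &
        forall c, exists P S, r S != 0 /\ c = r P / r S].
Proof.
move=> hP; pose Gr a b := exists P, a = r1 P /\ b = r2 P.
have [|||| Q [q1 [q2 [hQ fQ]]]] := @graph_field_exists N N' Gr.
- by exists 1; rewrite !rmorph1.
- by move=> _ _ _ _ [P [-> ->]] [S [-> ->]]; exists (P - S); rewrite !rmorphB.
- by move=> _ _ _ _ [P [-> ->]] [S [-> ->]]; exists (P * S); rewrite !rmorphM.
- by move=> _ _ [P [-> ->]]; apply: hP.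
have [P|r hr] := @lift_rmorphism _ _ _ q1 r1.
  by have [|c h1 _] := hQ (r1 P) (r2 P); [exists P | exists c].
have hr2 P : q2 (r P) = r2 P.
  have [|c h1 h2] := hQ (r1 P) (r2 P); first by exists P.
  by have -> : r P = c by [apply: (fmorph_inj q1); rewrite h1 hr].
exists Q, q1, q2, r; split=> // c.
have [a [b [[P [ha _]] [S [hb _]] b0 ->]]] := fQ c.
have ea : a = r P by apply: (fmorph_inj q1); rewrite ha hr.
have eb : b = r S by apply: (fmorph_inj q1); rewrite hb hr.
by exists P, S; rewrite -ea -eb.
Qed.

Lemma simple_ext (G N N' : fieldType) (g1 : {rmorphism G -> N}) (g2 : {rmorphism G -> N'})
    (y : N) (y' : N') :
  (forall P, hm g1 y P = 0 <-> hm g2 y' P = 0) ->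
  exists (Q : fieldType) (q1 : {rmorphism Q -> N}) (q2 : {rmorphism Q -> N'})
    (i : {rmorphism G -> Q}) (x : Q),
    [/\ forall c, q1 (i c) = g1 c, forall c, q2 (i c) = g2 c,
        q1 x = y, q2 x = y' & frac_gen i x].
Proof.
move=> hP; have [Q [q1 [q2 [r [h1 h2 fQ]]]]] := graph_ext hP.
pose i : {rmorphism G -> Q} := r \o polyC.
have rE P : r P = hm i (r 'X) P.
  elim/poly_ind: P => [|P c IH]; first by rewrite !rmorph0.
  by rewrite rmorphD rmorphM IH [in RHS]rmorphD rmorphM hmX hmC.
exists Q, q1, q2, i, (r 'X); split=> [c|c|||c]; rewrite ?h1 ?h2 ?hmC ?hmX //.
by have [P [S [S0 ->]]] := fQ c; exists P, S; rewrite -!rE.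
Qed.

Lemma frac_gen_deriv (G Q H : fieldType) (i : {rmorphism G -> Q}) (x : Q)
    (t : {rmorphism Q -> H}) (D : G -> H) (d : H) :
  frac_gen i x -> deriv_over (t \o i) D ->
  (forall P, hm i x P = 0 -> (map_poly D P).[t x] + t (hm i x P^`()) * d = 0) ->
  exists D' : Q -> H, [/\ deriv_over t D', forall c, D' (i c) = D c & D' x = d].
Proof.
move=> fQ hD ker.
have hE := deriv_poly (t x) d hD.
have [|P /ker|D' hD' eD'] := extend_deriv_frac fQ (t := t)
   (E := fun P => (map_poly D P).[t x] + t (hm i x P^`()) * d).
- by case: hE => h1 h2; split=> P R; rewrite /= -!hm_comp; [apply: h1 | apply: h2].
- by [].
exists D'; split=> // [c|].
  rewrite -(hmC i x) eD' derivC rmorph0 rmorph0 mul0r addr0.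
  suff -> : map_poly D c%:P = (D c)%:P by rewrite hornerC.
  apply/polyP => k; rewrite coef_map_id0 ?(der_0 hD) // !coefC.
  by case: eqP; rewrite ?(der_0 hD).
rewrite -[in LHS](hmX i x) eD' derivX !rmorph1 mul1r.
suff -> : map_poly D 'X = 0 by rewrite horner0 add0r.
apply/polyP => k; rewrite coef_map_id0 ?(der_0 hD) // coefX coef0.
by case: eqP => _; rewrite ?(der_1 hD) ?(der_0 hD).
Qed.

Lemma frac_gen_deriv_unique (G Q H : fieldType) (i : {rmorphism G -> Q}) (x : Q)
    (t : {rmorphism Q -> H}) (D1 D2 : Q -> H) :
  frac_gen i x -> deriv_over t D1 -> deriv_over t D2 ->
  (forall c, D1 (i c) = D2 (i c)) -> D1 x = D2 x -> D1 =1 D2.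
Proof.
move=> fQ h1 h2 e ex; apply: (deriv_frac_unique fQ h1 h2) => P.
elim/poly_ind: P => [|P c IH]; first by rewrite rmorph0 (der_0 h1) (der_0 h2).
by rewrite rmorphD rmorphM hmX hmC (der_D h1) (der_D h2) e (der_M h1) (der_M h2) IH ex.
Qed.

Lemma der_hm (G Q H : fieldType) (i : {rmorphism G -> Q}) (x : Q)
    (t : {rmorphism Q -> H}) (D : Q -> H) P :
  deriv_over t D ->
  D (hm i x P) = (map_poly (D \o i) P).[t x] + t (hm i x P^`()) * D x.
Proof.
move=> hD; have hDi : deriv_over (t \o i) (D \o i).
  by split=> a b; rewrite /= ?rmorphD ?rmorphM ?(der_D hD) ?(der_M hD).
have hE := deriv_poly (t x) (D x) hDi.
have D0 : (D \o i) 0 = 0 by apply: (der_0 hDi).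
have D1 : (D \o i) 1 = 0 by apply: (der_1 hDi).
have tE R : t (hm i x R) = (map_poly (t \o i) R).[t x] by rewrite -hm_comp.
rewrite tE; elim/poly_ind: P => [|P c IH].
  by rewrite rmorph0 (der_0 hD) deriv0 rmorph0 horner0 mul0r addr0 map_poly0 horner0.
have e1 : map_poly (D \o i) c%:P = (D (i c))%:P.
  by apply/polyP => k; rewrite coef_map_id0 // !coefC; case: eqP.
have e2 : map_poly (D \o i) 'X = 0.
  by apply/polyP => k; rewrite coef_map_id0 // coefX coef0; case: eqP.
rewrite hm_cons (der_D hD) (der_M hD) IH.
have /= := der_D (f := hm (t \o i) (t x)) hE (P * 'X) c%:P => ->.
have /= := der_M (f := hm (t \o i) (t x)) hE P 'X => ->.
rewrite e1 e2 derivC derivX.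
have e3 : t (horner_eval x (map_poly i P)) = (map_poly (t \o i) P).[t x] := tE P.
by rewrite e3 /horner_eval !rmorph1 !rmorph0 !hornerC map_polyX hornerX; ring.
Qed.

(** * Adjoining p-th roots *)

Section InseparableStep.
Variables (p : nat) (S F : fieldType) (s : {rmorphism S -> F}).
Hypothesis chS : p \in [pchar S].
Let chF : p \in [pchar F]. Proof. by rewrite (fmorph_pchar s). Qed.

(** Differentiating lowers the exponent by one and multiplies by an exponent below p, hence
    invertible; the final linear polynomial exhibits [y] as a quotient of coefficients. *)
Lemma root_power_rational k : (k.+1 < p)%N -> forall (Q : {poly S}) (u y : F), u != 0 ->
  map_poly s Q = u *: ('X - y%:P) ^+ k.+1 -> exists b, s b = y.
Proof.
elim: k => [|k IH] kp Q u y u0 e.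
  exists (- (Q`_0 / Q`_1)).
  have e0 := congr1 (fun P : {poly F} => P`_0) e; have e1 := congr1 (fun P : {poly F} => P`_1) e.
  rewrite /= coef_map coefZ expr1 coefB coefX coefC /= sub0r in e0.
  rewrite /= coef_map coefZ expr1 coefB coefX coefC /= subr0 mulr1 in e1.
  by rewrite rmorphN fmorph_div e0 e1 mulrN mulNr opprK mulrC mulKf.
apply: (IH (ltnW kp) Q^`() (u * k.+2%:R) y).
  rewrite mulf_neq0 // -(dvdn_pcharf chF) gtnNdvd //.
rewrite -deriv_map e derivZ deriv_exp derivXsubC mul1r /=.
by rewrite -scaler_nat scalerA.
Qed.

(** Over [F] the polynomial ['X^p - a%:P] is the p-th power of ['X - y%:P], so its gcd with [P] is a
    power of the latter. The exponent is positive since [P] vanishes at [y], and an exponent below p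
    would put [y] in [S]. *)
Lemma inseparable_dvdp (y : F) (a : S) (P : {poly S}) :
  y ^+ p = s a -> (forall b, s b <> y) -> hm s y P = 0 -> 'X^p - a%:P %| P.
Proof.
move=> ya yS Py.
have ep : map_poly s ('X^p - a%:P) = ('X - y%:P) ^+ p.
  rewrite rmorphB rmorphXn /= map_polyX map_polyC /= -ya.
  have chP : p \in [pchar {poly F}] by rewrite pchar_poly.
  have -> : ('X - y%:P) ^+ p = 'X^p - y%:P ^+ p by exact: (rmorphB (pFrobenius_aut chP)).
  by rewrite polyC_exp.
pose m := gcdp P ('X^p - a%:P).
have rm : root (map_poly s m) y.
  by rewrite gcdp_map root_gcd ep !rootE -hmE Py eqxx horner_exp hornerXsubC subrr expr0n eqn0Ngt (prime_gt0 (pcharf_prime chF)) /=.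
have : map_poly s m %| ('X - y%:P) ^+ p by rewrite -ep dvdp_map dvdp_gcdr.
case/dvdp_exp_XsubCP => k [kp /eqpP [[u v] /andP[/= u0 v0] e]].
have em : map_poly s m = (v / u) *: ('X - y%:P) ^+ k.
  by apply: (scalerI u0); rewrite e scalerA mulrC divfK.
have vu : v / u != 0 by rewrite mulf_neq0 // invr_eq0.
case: k kp e em => [|k] kp e em.
  by move: rm; rewrite em expr0 rootE hornerZ hornerC mulr1 (negPf vu).
have [kp'|kp'] := ltnP k.+1 p.
  by have [b /yS] := root_power_rational kp' vu em.
have ek : k.+1 = p by apply/eqP; rewrite eqn_leq kp kp'.
have mP : m %| P by apply: dvdp_gcdl.
apply: dvdp_trans mP; suff : m %= 'X^p - a%:P by move=> /eqp_dvdr ->; rewrite dvdpp.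
rewrite -dvdp_size_eqp ?dvdp_gcdr // -(size_map_poly s) em size_scale //.
by rewrite -(size_map_poly s ('X^p - _)) ep ek.
Qed.

End InseparableStep.

(** A new root may be given derivative 0: its p-th power [a] has derivative 0, and all its relations
    are multiples of ['X^p - a%:P]. The hypothesis on p-th powers persists, so roots are adjoined
    one at a time. *)
Lemma extend_deriv_inseparable (p : nat) (S F : fieldType) (s : {rmorphism S -> F}) (D : S -> F)
    (ys : seq F) :
  p \in [pchar S] -> deriv_over s D -> (forall x, exists2 a, s a = x ^+ p & D a = 0) ->
  exists (S' : fieldType) (s' : {rmorphism S' -> F}) (D' : S' -> F),
    [/\ deriv_over s' D', forall c, exists2 c', s' c' = s c & D' c' = D c &
        forall y, y \in ys -> exists b, s' b = y].
Proof.
elim: ys S s D => [|y ys IH] S s D chS hD hp.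
  by exists S, s, D; split=> // c; exists c.
have [[b sb]|/forallNP yS] := pselect (exists b, s b = y).
  have [S' [s' [D' [hD' eD' hys]]]] := IH S s D chS hD hp.
  exists S', s', D'; split=> // y'; rewrite inE => /orP[/eqP ->|/hys //].
  by have [b' h _] := eD' b; exists b'; rewrite h.
have [Q [q1 [q2 [i [x [e1 _ ex _ fQ]]]]]] := @simple_ext S F F s s y y (fun P => iff_refl _).
have [a sa Da] := hp y.
have e1' : (q1 \o i) =1 s by [].
have hDi : deriv_over (q1 \o i) D.
  by case: hD => h1 h2; split=> u v; rewrite ?h1 // h2 /= !e1.
have [|D1 [hD1 eD1 D1x]] := frac_gen_deriv (d := 0) fQ hDi.
  move=> P hP; rewrite mulr0 addr0.
  have : 'X^p - a%:P %| P.
    apply: (inseparable_dvdp chS (esym sa) yS).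
    have := congr1 q1 hP; rewrite rmorph0 -hm_comp ex => <-.
    by rewrite !hmE; congr _.[_]; apply: eq_map_poly => c; rewrite /= e1.
  case/dvdpP => R ->.
  have hE := deriv_poly y 0 hD.
  have := der_M (f := hm s y) hE R ('X^p - a%:P).
  rewrite !mulr0 !addr0 ex => ->.
  have -> : hm s y ('X^p - a%:P) = 0.
    by rewrite rmorphB rmorphXn hmX hmC sa subrr.
  rewrite mulr0 add0r.
  suff -> : map_poly D ('X^p - a%:P) = 0 by rewrite horner0 mulr0.
  apply/polyP => k; rewrite coef_map_id0 ?(der_0 hD) // coefB coefXn coefC coef0 (der_B hD).
  by case: eqP => _; case: eqP => _; rewrite ?(der_1 hD) ?(der_0 hD) ?Da subrr.
have chQ : p \in [pchar Q] by rewrite (fmorph_pchar i).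
have [z|S' [s' [D' [hD' eD' hys]]]] := IH Q q1 D1 chQ hD1.
  by have [a' h1 h2] := hp z; exists (i a'); rewrite ?e1 ?eD1.
exists S', s', D'; split=> //.
  by move=> c; have [c' h1 h2] := eD' (i c); exists c'; rewrite ?h1 ?h2 ?e1 ?eD1.
move=> y'; rewrite inE => /orP[/eqP ->|/hys //].
by have [b' h1 _] := eD' x; exists b'; rewrite h1.
Qed.

(** * Separating towers *)

Section MacLane.
Variables (p : nat) (C L : fieldType) (f : {rmorphism C -> L}).
Hypotheses (chC : p \in [pchar C]) (chL : p \in [pchar L]) (sf : sep p f).

Definition gen (ys : seq L) (x : L) : Prop :=
  forall S, subfield_pred S -> (forall c, S (f c)) -> (forall y, y \in ys -> S y) -> S x.

Definition sepalg (ys : seq L) (y : L) : Prop :=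
  exists P : {poly L}, [/\ forall k, gen ys P`_k, P.[y] = 0 & P^`().[y] != 0].

Definition alg_indep n (y : 'I_n -> L) : Prop :=
  forall P : {mpoly C[n]}, mmap f y P = 0 -> P = 0.

(** Evaluating all variables but the one of index [j] gives a polynomial in one variable, whose
    formal derivative at [y j] is the partial derivative of [P] at [y]. *)
Lemma sepalg_mderiv n (y : 'I_n -> L) (P : {mpoly C[n]}) (j : 'I_n) (ys : seq L) :
  (forall k, k != j -> y k \in ys) -> mmap f y P = 0 -> mmap f y P^`M(j) != 0 ->
  sepalg ys (y j).
Proof.
move=> hys P0 Pj.
pose w (m : 'X_{1..n}) := f P@_m * \prod_(k | k != j) y k ^+ m k.
have prodE (m : 'X_{1..n}) : mmap1 y m = \prod_(k | k != j) y k ^+ m k * y j ^+ m j.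
  by rewrite /mmap1 (bigD1 j) //= mulrC.
exists (\sum_(m <- msupp P) w m *: 'X^(m j)); split.
- move=> k S hS hC hy; rewrite coef_sum; apply: subf_sum => // m _.
  rewrite coefZ coefXn; apply: subfM => //; last by case: eqP => _; [apply: subf1 | apply: subf0].
  by apply: subfM => //; apply: subf_prod => // i ij; apply: subfX => //; apply/hy/hys.
- rewrite horner_sum -[RHS]P0; apply: eq_bigr => m _.
  by rewrite hornerZ hornerXn prodE mulrA.
rewrite (_ : _.[_] = mmap f y P^`M(j)) //.
rewrite raddf_sum horner_sum raddf_sum /=; apply: eq_bigr => m _.
rewrite mmapZ mmapX derivZ hornerZ derivXn hornerMn hornerXn rmorphM rmorph_nat.
rewrite /w prodE mnmBE mnm1E eqxx subn1.
have -> : \prod_(k | k != j) y k ^+ (m - U_(j))%MM k = \prod_(k | k != j) y k ^+ m k.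
  by apply: eq_bigr => k kj; rewrite mnmBE mnm1E eq_sym (negPf kj) subn0.
by rewrite -[y j ^+ _ *+ _]mulr_natl; ring.
Qed.

(* If all partial derivatives vanished, a relation of minimal degree would be
   a polynomial in the p-th powers, and separability would yield a smaller one. *)
Lemma alg_dep_sepalg n (y : 'I_n -> L) : ~ alg_indep y ->
  exists j, forall ys, (forall k, k != j -> y k \in ys) -> sepalg ys (y j).
Proof.
move=> /existsNP[P1 /not_implyP[P1y /eqP P1n]].
pose rel d := `[< exists P : {mpoly C[n]}, [/\ P != 0, mmap f y P = 0 & msize P = d] >].
have ex : exists d, rel d by exists (msize P1); apply/asboolP; exists P1.
case: (ex_minnP ex) => d /asboolP[P [Pn Py <-]] minP.
have {}minP Q : Q != 0 -> mmap f y Q = 0 -> (msize P <= msize Q)%N.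
  by move=> Qn Qy; apply: minP; apply/asboolP; exists Q.
apply: contrapT => hn.
have Pj j : mmap f y P^`M(j) = 0.
  by apply: contrapT => /eqP h; apply: hn; exists j => ys hys; apply: (sepalg_mderiv hys Py h).
have Psz : (1 < msize P)%N.
  rewrite ltnNge; apply/negP => /msize1_polyC e.
  move: Py; rewrite e mmapC => /eqP; rewrite fmorph_eq0 => /eqP c0.
  by move: Pn; rewrite e c0 mpolyC0 eqxx.
have dj j : P^`M(j) = 0.
  apply: contrapT => /eqP h; have := minP _ h (Pj j).
  rewrite leqNgt => /negP; apply.
  have [Q0|Qn] := eqVneq (msize P^`M(j)) 0%N; first by rewrite Q0 (ltn_trans _ Psz).
  rewrite [X in (X < _)%N]msizeE -ltnS -(ltn_predK Psz) ltnS ltnS.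
  apply/bigmax_leqP_seq => m; rewrite mcoeff_msupp mcoeff_deriv => hm _.
  have : (m + U_(j))%MM \in msupp P.
    by rewrite mcoeff_msupp; apply: contraNneq hm => ->; rewrite mul0rn.
  by move/msize_mdeg_lt; rewrite mdegD mdeg1 addn1 -(ltn_predK Psz) ltnS.
have pm m j : m \in msupp P -> (p %| m j)%N.
  move=> hm; have [->|mj] := eqVneq (m j) 0%N; first by rewrite dvdn0.
  have := congr1 (mcoeff (m - U_(j))%MM) (dj j).
  rewrite mcoeff0 mcoeff_deriv mnmBE mnm1E eqxx subn1 prednK ?lt0n //.
  rewrite submK; last first.
    by apply/mnm_lepP => l; rewrite mnm1E; case: eqP => // <-; rewrite lt0n.
  rewrite -mulr_natr => /eqP; rewrite mulf_eq0 -(dvdn_pcharf chC).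
  by move: hm; rewrite mcoeff_msupp => /negPf ->.
pose s := msupp P; pose T : finType := 'I_(size s).
pose mt (t : T) : 'X_{1..n} := nth 0%MM s t.
have mts t : mt t \in msupp P by apply: mem_nth.
pose mq (t : T) : 'X_{1..n} := [multinom (mt t i %/ p)%N | i < n].
have mqE t i : (mq t i * p)%N = mt t i by rewrite mnmE divnK // pm.
have mq_inj : injective mq.
  move=> t t' e; have e' : mt t = mt t' by apply/mnmP => i; rewrite -!mqE e.
  by apply/val_inj/eqP; rewrite -(nth_uniq 0%MM (ltn_ord t) (ltn_ord t') (msupp_uniq P)); apply/eqP.
have rel0 : \sum_(t in [set: T]) mmap1 y (mq t) ^+ p * f P@_(mt t) = 0.
  rewrite big_setT -[RHS]Py /mmap (big_nth 0%MM) big_mkord; apply: eq_bigr => t _.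
  rewrite mulrC; congr (_ * _); rewrite /mmap1 -prodrXl; apply: eq_bigr => i _.
  by rewrite -exprM mqE.
(* The relation has p-th powers of the monomials [mq t] in [y] as coefficients. Taking roots gives
   one relation for each [r] in [B]; [r] is then chosen so that the new relation [Q] is nonzero at
   [t0]. *)
have [B [u [hu hz]]] := sep_relP chC chL sf rel0.
have t0 : T.
  have : (0 < size s)%N by rewrite lt0n size_eq0 msupp_eq0.
  by move=> h; exact: (Ordinal h).
have [r rB ur] : exists2 r, r \in B & u t0 r != 0.
  apply: contrapT => h; move: (mts t0); rewrite mcoeff_msupp hu big1 ?eqxx //.
  move=> r rB; have [->|ur] := eqVneq (u t0 r) 0; last by case: h; exists r.
  by rewrite expr0n eqn0Ngt (prime_gt0 (pcharf_prime chC)) mul0r.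
pose Q : {mpoly C[n]} := \sum_t u t r *: 'X_[mq t].
have Qc t : Q@_(mq t) = u t r.
  rewrite raddf_sum /= (bigD1 t) //= mcoeffZ mcoeffX eqxx mulr1 big1 ?addr0 // => t' tt'.
  by rewrite mcoeffZ mcoeffX (inj_eq mq_inj) (negPf tt') mulr0.
have Qn : Q != 0 by apply: contraNneq ur => Q0; rewrite -Qc Q0 mcoeff0.
have Qy : mmap f y Q = 0.
  rewrite raddf_sum /= -[RHS](hz r rB) big_setT; apply: eq_bigr => t _.
  by rewrite mmapZ mmapX mulrC.
have := minP _ Qn Qy; rewrite leqNgt => /negP; apply.
rewrite [X in (X < _)%N]msizeE -(ltn_predK Psz) ltnS.
apply/bigmax_leqP_seq => m hm _.
have [t ->] : exists t, m = mq t.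
  apply: contrapT => h; move: hm; rewrite mcoeff_msupp raddf_sum big1 ?eqxx //= => t _.
  rewrite mcoeffZ mcoeffX; case: eqP => [e|_]; last by rewrite mulr0.
  by case: h; exists t.
have dle : (mdeg (mq t) * p)%N = mdeg (mt t).
  by rewrite !mdegE big_distrl; apply: eq_bigr => i _; apply: mqE.
have := msize_mdeg_lt (mts t); rewrite -dle -(ltn_predK Psz) ltnS.
have := prime_gt1 (pcharf_prime chC).
case: (mdeg (mq t)) => [|k] p1 h; first by rewrite -ltnS (ltn_predK Psz).
apply: leq_trans h; apply: leq_trans (leq_mul (leqnn k.+1) p1).
by rewrite muln2 doubleS !ltnS -addnn leq_addr.
Qed.

Inductive tower : seq L -> Prop :=
| tower_base n (b : 'I_n -> L) : alg_indep b -> tower (codom b)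
| tower_step ys y : tower ys -> sepalg ys y -> tower (y :: ys).

(** In a dependent family some member is separable algebraic over the others; it goes on top of a
    tower containing those. *)
Lemma tower_exists n (y : 'I_n -> L) : exists2 ys, tower ys & forall k, y k \in ys.
Proof.
elim: n y => [|n IH] y.
  have [h|/alg_dep_sepalg[[]]//] := pselect (alg_indep y).
  by exists (codom y); [apply: tower_base | case].
have [h|/alg_dep_sepalg[j hj]] := pselect (alg_indep y).
  by exists (codom y); [apply: tower_base | move=> k; apply: codom_f].
have [ys tys hys] := IH (y \o lift j).
exists (y j :: ys).
  apply: tower_step => //; apply: hj => k; case: (unliftP j k) => [k' -> _|->]; first exact: hys.
  by rewrite eqxx.
move=> k; case: (unliftP j k) => [k' ->|->]; last exact: mem_head.
by rewrite inE hys orbT.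
Qed.

End MacLane.

(** * Extensions of one field along a tower *)

Lemma fraction_repr (R : idomainType) (x : {fraction R}) :
  exists a b : R, b != 0 /\ x = FracField.tofrac a / FracField.tofrac b.
Proof.
elim/quotW: x => r; exists \n_r, \d_r; split; first exact: denom_ratioP.
have d0 : FracField.tofrac \d_r != 0 by rewrite tofrac_eq0 denom_ratioP.
apply: (mulIf d0); rewrite divfK //; unlock FracField.tofrac.
rewrite -[LHS]FracField.pi_mul; apply/eqmodP => /=.
rewrite FracField.equivfE /FracField.mulf /= !numden_Ratio ?mulf_neq0 ?denom_ratioP ?oner_neq0 //.
by rewrite !mulr1 mulrC.
Qed.

Lemma mcoeff_expp p n (K : fieldType) (chK : p \in [pchar K]) (P : {mpoly K[n]}) (m : 'X_{1..n}) :
  (P ^+ p)@_(m *+ p) = P@_m ^+ p.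
Proof.
have p0 := prime_gt0 (pcharf_prime chK).
have chP : p \in [pchar {mpoly K[n]}].
  by rewrite inE (pcharf_prime chK) /= -mpolyC_nat (pcharf0 chK) mpolyC0.
have -> : P ^+ p = \sum_(m <- msupp P) P@_m ^+ p *: 'X_[m *+ p].
  rewrite {1}[P]mpolyE (pcharP_sum chP).
  by apply: eq_bigr => k _; rewrite exprZn mpolyXn.
have inj (a b : 'X_{1..n}) : (a *+ p == b *+ p)%MM = (a == b).
  apply/eqP/eqP => [e|-> //]; apply/mnmP => i.
  have := congr1 (fun m : 'X_{1..n} => m i) e; rewrite /= !mulmnE => /eqP.
  by rewrite eqn_pmul2r // => /eqP.
rewrite raddf_sum /=; have [h|h] := boolP (m \in msupp P).
  rewrite (bigD1_seq m) ?msupp_uniq //= mcoeffZ mcoeffX eqxx mulr1 big1 ?addr0 // => k km.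
  by rewrite mcoeffZ mcoeffX inj (negPf km) mulr0.
rewrite (memN_msupp_eq0 h) expr0n eqn0Ngt p0 big1_seq // => k /= hk.
rewrite mcoeffZ mcoeffX inj; case: eqP => [e|_]; last by rewrite mulr0.
by rewrite -e hk in h.
Qed.

Section MpolyDeriv.
Variables (n : nat) (K H : fieldType) (f : {rmorphism K -> H}) (D : K -> H) (hD : deriv_over f D).
Variables (x d : 'I_n -> H).

Let D_is_zmod : zmod_morphism D.
Proof. by move=> a b; rewrite (der_B hD). Qed.

Lemma mmapD_additive (P Q : {mpoly K[n]}) : mmap D x (P + Q) = mmap D x P + mmap D x Q.
Proof.
pose DA := GRing.isZmodMorphism.Build K H D D_is_zmod.
pose F : {additive K -> H} := HB.pack D DA.
exact: (mmapD x F).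
Qed.

Lemma mmapD_mono (c : K) (m : 'X_{1..n}) : mmap D x (c *: 'X_[m]) = D c * mmap1 x m.
Proof.
have [->|c0] := eqVneq c 0; first by rewrite scale0r /mmap msupp0 big_nil (der_0 hD) mul0r.
by rewrite /mmap msuppMCX // big_seq1 mcoeffZ mcoeffX eqxx mulr1.
Qed.

Lemma deriv_mpoly : deriv_over (mmap f x)
  (fun P : {mpoly K[n]} => mmap D x P + \sum_j mmap f x P^`M(j) * d j).
Proof.
split=> P Q.
  rewrite mmapD_additive addrACA -big_split; congr (_ + _); apply: eq_bigr => j _.
  by rewrite raddfD rmorphD mulrDl.
have -> : \sum_j mmap f x (P * Q)^`M(j) * d j =
   (\sum_j mmap f x P^`M(j) * d j) * mmap f x Q + mmap f x P * \sum_j mmap f x Q^`M(j) * d j.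
  rewrite mulr_suml mulr_sumr -big_split; apply: eq_bigr => j _ /=.
  by rewrite mderivM rmorphD !rmorphM; ring.
suff -> : mmap D x (P * Q) = mmap D x P * mmap f x Q + mmap f x P * mmap D x Q by ring.
have m0 : mmap D x (0 : {mpoly K[n]}) = 0 by rewrite /mmap msupp0 big_nil.
elim/mpolyind: P => [|c m P _ _ IH].
  by rewrite mul0r m0 rmorph0 !mul0r addr0.
rewrite mulrDl !mmapD_additive IH rmorphD.
suff -> : mmap D x (c *: 'X_[m] * Q) = mmap D x (c *: 'X_[m]) * mmap f x Q
   + mmap f x (c *: 'X_[m]) * mmap D x Q by ring.
elim/mpolyind: Q {IH} => [|c' m' Q _ _ IH].
  by rewrite mulr0 m0 rmorph0 !mulr0 addr0.
rewrite mulrDr !mmapD_additive IH rmorphD.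
suff -> : mmap D x (c *: 'X_[m] * (c' *: 'X_[m'])) =
   mmap D x (c *: 'X_[m]) * mmap f x (c' *: 'X_[m'])
   + mmap f x (c *: 'X_[m]) * mmap D x (c' *: 'X_[m']) by ring.
rewrite -scalerAl -scalerAr scalerA -mpolyXD !mmapD_mono !mmapZ !mmapX.
have -> : mmap1 x (m + m') = mmap1 x m * mmap1 x m'.
  by rewrite -!(mmapX x f) mpolyXD rmorphM.
by rewrite (der_M hD); ring.
Qed.

End MpolyDeriv.

(** The field of rational functions. Once denominators are cleared, a relation with p-th powers of
    polynomials as coefficients is read at the monomials [m *+ p], where it becomes a relation over
    [K^p]. *)
Lemma transcendental_ext (n : nat) (K : fieldType) :
  exists (E : fieldType) (e : {rmorphism K -> E}) (X : 'I_n -> E),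
  [/\ forall P, mmap e X P = 0 -> P = 0,
      forall p, p \in [pchar K] -> sep p e &
      forall (H : fieldType) (t : {rmorphism E -> H}) (D : K -> H) (d : 'I_n -> H),
        deriv_over (t \o e) D ->
        exists D' : E -> H, [/\ deriv_over t D', forall c, D' (e c) = D c & forall j, D' (X j) = d j]].
Proof.
pose tf : {rmorphism {mpoly K[n]} -> {fraction {mpoly K[n]}}} := @FracField.tofrac _.
pose e : {rmorphism K -> {fraction {mpoly K[n]}}} := tf \o @mpolyC n K.
pose X j := tf 'X_j.
have eX P : mmap e X P = tf P.
  rewrite {2}[P]mpolyE rmorph_sum; apply: eq_bigr => m _.
  rewrite -mul_mpolyC rmorphM /=; congr (_ * _).
  by rewrite mpolyXE_id rmorph_prod; apply: eq_bigr => i _; rewrite rmorphXn.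
exists {fraction {mpoly K[n]}}, e, X; split.
- by move=> P; rewrite eX => /eqP; rewrite tofrac_eq0 => /eqP.
- move=> p chK T A g indA z hz.
  have [a [b hab]] : exists a b : T -> {mpoly K[n]}, forall t, b t != 0 /\ z t = tf (a t) / tf (b t).
    have [a /choice[b hab]] := choice (fun t => fraction_repr (z t)).
    by exists a, b.
  have chE : p \in [pchar {fraction {mpoly K[n]}}] by rewrite (fmorph_pchar e).
  pose B := \prod_t b t; have B0 : B != 0 by apply/prodf_neq0 => t _; case: (hab t).
  pose a' t := a t * \prod_(s | s != t) b s.
  have za t : z t * tf B = tf (a' t).
    have [bt ->] := hab t; rewrite /B /a' (bigD1 t) //= rmorphM mulrA divfK ?rmorphM //.
    by rewrite tofrac_eq0.
  have h0 : \sum_(t in A) a' t ^+ p * (g t)%:MP = 0.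
    apply/eqP; rewrite -tofrac_eq0 -[FracField.tofrac _]/(tf _) rmorph_sum.
    have -> : \sum_(t in A) tf (a' t ^+ p * (g t)%:MP) = tf B ^+ p * \sum_(t in A) z t ^+ p * e (g t).
      rewrite mulr_sumr; apply: eq_bigr => t _.
      by rewrite rmorphM rmorphXn -za exprMn /=; ring.
    by rewrite hz mulr0.
  have ha t : t \in A -> a' t = 0.
    move=> tA; apply/mpolyP => m; rewrite mcoeff0.
    apply: (indA (fun t => (a' t)@_m)) => //.
    have := congr1 (mcoeff (m *+ p)%MM) h0; rewrite mcoeff0 raddf_sum /= => h.
    rewrite -[RHS]h; apply: eq_bigr => s _.
    by rewrite [_ * _%:MP]mulrC mul_mpolyC mcoeffZ (mcoeff_expp chK) mulrC.
  move=> t tA; apply/eqP; rewrite -(mulIr_eq0 _ (mulIf (_ : tf B != 0))); last by rewrite tofrac_eq0.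
  by rewrite za ha // rmorph0.
move=> H t D d hD.
have hE := deriv_mpoly hD (t \o X) d.
have etX P : mmap (t \o e) (t \o X) P = t (tf P).
  rewrite -eX /mmap rmorph_sum; apply: eq_bigr => m _.
  rewrite rmorphM /mmap1 rmorph_prod; congr (_ * _); apply: eq_bigr => i _.
  by rewrite rmorphXn.
have [||P|D' hD' eD'] := @extend_deriv_frac {mpoly K[n]} {fraction {mpoly K[n]}} H tf t _
  (fun P => mmap D (t \o X) P + \sum_j mmap (t \o e) (t \o X) P^`M(j) * d j).
- by move=> s; have [a [b [b0 es]]] := fraction_repr s; exists a, b;
    rewrite -[tf b]/(FracField.tofrac b) tofrac_eq0.
- by case: hE => h1 h2; split=> P Q; [apply: h1 | rewrite /= -!etX; apply: h2].
- move=> /eqP; rewrite -[tf P]/(FracField.tofrac P) tofrac_eq0 => /eqP ->.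
  rewrite /mmap msupp0 big_nil add0r big1 // => j _.
  by rewrite mderiv0 msupp0 big_nil mul0r.
exists D'; split=> // [c|j].
  rewrite -[e c]/(tf c%:MP) eD' big1 ?addr0 => [|j _]; last by rewrite mderivC rmorph0 mul0r.
  by rewrite -[c%:MP]mulr1 mul_mpolyC -mpolyX0 (mmapD_mono hD) mmap11 mulr1.
rewrite eD' -['X_j]scale1r (mmapD_mono hD) (der_1 hD) mul0r add0r scale1r.
have U0 : (U_(j) - U_(j) = 0 :> 'X_{1..n})%MM by apply/mnmP => i; rewrite mnmBE subnn mnm0E.
rewrite (bigD1 j) //= mderivX mnm1E eqxx scale1r U0 mpolyX0 rmorph1 mul1r.
by rewrite big1 ?addr0 // => k kj; rewrite mderivX mnm1E eq_sym (negPf kj) scale0r rmorph0 mul0r.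
Qed.

Lemma irreducible_factor (K : fieldType) (f : {poly K}) : (1 < size f)%N ->
  exists2 q, irreducible_poly q & q %| f.
Proof.
elim: {f}(size f) {-2}f (leqnn (size f)) => [|n IH] f hf f1.
  by move: f1; rewrite ltnNge (leq_trans hf).
have [irr|] := pselect (irreducible_poly f); first by exists f.
move=> /not_andP[//|/existsNP[q /not_implyP[q1 /not_implyP[qf qn]]]].
have f0 : f != 0 by rewrite -size_poly_gt0 (ltn_trans _ f1).
have q0 : q != 0 by apply: contraTneq qf => ->; rewrite dvd0p.
have sq : (size q < size f)%N.
  rewrite ltn_neqAle dvdp_leq // andbT; apply/negP => e.
  by apply: qn; rewrite -dvdp_size_eqp.
have [||r irr rq] := IH q; first by rewrite -ltnS (leq_trans sq).
  by rewrite ltn_neqAle eq_sym q1 size_poly_gt0.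
by exists r => //; apply: dvdp_trans rq qf.
Qed.

(** In the application [f] comes from a minimal polynomial over a small field, which may factor over
    the fields used here; its Bezout identity with the derivative survives. A root of an irreducible
    factor of [f] is adjoined. *)
Lemma algebraic_ext (K : fieldType) (f A B : {poly K}) :
  A * f + B * f^`() = 1 -> (1 < size f)%N ->
  exists (E : fieldType) (e : {rmorphism K -> E}) (x : E),
  [/\ hm e x f = 0,
      forall p, p \in [pchar K] -> sep p e &
      forall (H : fieldType) (t : {rmorphism E -> H}) (D : K -> H),
        deriv_over (t \o e) D ->
        exists D' : E -> H, deriv_over t D' /\ forall c, D' (e c) = D c].
Proof.
move=> bez f1; have [q irr qf] := irreducible_factor f1.
have [L dimL [z rz genz]] := irredp_FAdjoin irr.
pose e : {rmorphism K -> L} := GRing.in_alg L.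
have qz : hm e z q = 0 by apply/eqP.
have [r fE] := dvdpP _ _ qf.
have fz : hm e z f = 0 by rewrite fE rmorphM qz mulr0.
have q'z : hm e z q^`() != 0.
  have : hm e z (A * f + B * f^`()) = 1 by rewrite bez rmorph1.
  rewrite rmorphD !rmorphM fz mulr0 add0r fE derivM rmorphD !rmorphM qz mulr0 add0r.
  by apply: contra_eqN => /eqP ->; rewrite !mulr0 eq_sym oner_eq0.
have inj_alg c : c \in 1%VS -> exists b, c = e b.
  by move=> /vlineP[b ->]; exists b.
have polyE (x : L) : exists c : 'I_(adjoin_degree 1 z) -> K, x = \sum_j e (c j) * z ^+ j.
  have xz : x \in <<1; z>>%VS by rewrite genz memvf.
  have hc j : exists b, (Fadjoin_poly 1 z x)`_j = e b.
    exact/inj_alg/polyOverP/Fadjoin_polyOver.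
  have [c hc'] := choice hc; exists (fun j => c j).
  rewrite -[LHS](Fadjoin_poly_eq xz) (horner_coef_wide _ (size_Fadjoin_poly _ _ _)).
  by apply: eq_bigr => j _; rewrite hc'.
exists L, e, z; split=> //.
- move=> p chK T S g indS w hw.
  have chL : p \in [pchar L] by rewrite (fmorph_pchar e).
  have sepz : separable_element 1 z.
    apply/separable_elementP; exists (map_poly e f); split.
    + by apply/polyOverP => i; rewrite coef_map /=; apply/rpredZ/mem1v.
    + by rewrite rootE -hmE fz.
    + rewrite separable_poly.unlock deriv_map coprimep_map; apply/Bezout_eq1_coprimepP.
      by exists (A, B).
  (* A separable [z] generates the same field as [z ^+ p], so the powers of [z ^+ p] below the
     degree are independent. The given relation is the value at [z ^+ p] of the polynomial [W]
     below, which therefore vanishes. *)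
  have zp : z \in <<1; z ^+ p>>%VS by rewrite -[p]expn1 -(pcharf_p_separable _ _ 0 chL).
  have gen_zp : <<1; z ^+ p>>%VS = fullv.
    apply/eqP; rewrite eqEsubv subvf -genz /=; apply/FadjoinP; split=> //; exact: sub1v.
  have [c hc] := choice (fun t => polyE (w t)).
  pose W : {poly K} := \sum_j (\sum_(t in S) c t j ^+ p * g t)%:P * 'X^j.
  have Wc (j : 'I_(adjoin_degree 1 z)) : W`_j = \sum_(t in S) c t j ^+ p * g t.
    rewrite coef_sum (bigD1 j) //= [X in _ + X]big1 ?addr0 => [|i ij].
      by rewrite coefCM coefXn eqxx mulr1.
    by rewrite coefCM coefXn eq_sym (inj_eq val_inj) (negPf ij) mulr0.
  have Wsz : (size W <= adjoin_degree 1 z)%N.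
    apply: (leq_trans (size_sum _ _ _)); apply/bigmax_leqP => j _.
    rewrite mul_polyC (leq_trans (size_scale_leq _ _)) // size_polyXn; exact: ltn_ord.
  have Wz : hm e (z ^+ p) W = 0.
    rewrite -[RHS]hw rmorph_sum.
    have -> : \sum_(t in S) w t ^+ p * (e \o g) t =
        \sum_(t in S) \sum_j e (c t j) ^+ p * (z ^+ j) ^+ p * e (g t).
      apply: eq_bigr => t _; rewrite {1}hc (pcharP_sum chL) mulr_suml.
      by apply: eq_bigr => j _; rewrite exprMn.
    rewrite exchange_big; apply: eq_bigr => j _; rewrite rmorphM hmC rmorphXn hmX rmorph_sum mulr_suml.
    by apply: eq_bigr => t _; rewrite rmorphM rmorphXn -!exprM mulnC; ring.
  have W0 : W = 0.
    apply/eqP; rewrite -(map_poly_eq0 e); apply: contraT => Wn.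
    have pO : map_poly e W \is a polyOver 1%VS.
      by apply/polyOverP => i; rewrite coef_map /=; apply/rpredZ/mem1v.
    have rW : root (map_poly e W) (z ^+ p) by rewrite rootE -hmE Wz.
    have := dvdp_leq Wn (minPoly_dvdp pO rW); rewrite size_minPoly size_map_poly.
    rewrite (leqNgt _ (size W)) ltnS (leq_trans Wsz) //.
    have := dim_Fadjoin 1 (z ^+ p); rewrite gen_zp -genz dim_Fadjoin.
    by rewrite !dimv1 !muln1 => ->.
  move=> t tS; rewrite (hc t) big1 // => j _.
  by rewrite (indS (fun t => c t j)) ?rmorph0 ?mul0r // -Wc W0 coef0.
move=> H t D hD.
have fr : frac_gen e z.
  move=> x; have [c ->] := polyE x; exists (\sum_j (c j)%:P * 'X^j), 1.
  rewrite rmorph1 oner_neq0 divr1 rmorph_sum; split=> //; apply: eq_bigr => j _.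
  by rewrite rmorphM hmC rmorphXn hmX.
(* The value at [z] forced by differentiating [q(z) = 0]. *)
pose d := - (map_poly D q).[t z] / t (hm e z q^`()).
have [|D' [hD' eD' _]] := frac_gen_deriv (d := d) fr hD.
  move=> P Pz; have : q %| P.
    have q0 : q != 0 by rewrite -size_poly_gt0 (ltn_trans _ irr.1).
    have g0 : gcdp q P != 0 by rewrite gcdp_eq0 (negPf q0).
    have rg : root (map_poly e (gcdp q P)) z.
      by rewrite gcdp_map root_gcd !rootE -!hmE qz Pz eqxx.
    have g1 : size (gcdp q P) != 1%N.
      have := root_size_gt1 _ rg; rewrite map_poly_eq0 size_map_poly => /(_ g0).
      by case: (size _) => [|[]].
    by rewrite -(eqp_dvdl _ (irr.2 _ g1 (dvdp_gcdl _ _))) dvdp_gcdr.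
  case/dvdpP => R ->.
  have hE := deriv_poly (t z) d hD.
  have := der_M (f := hm (t \o e) (t z)) hE R q.
  rewrite -(hm_comp e t) => ->; rewrite (hm_comp e t z q) qz rmorph0 mulr0 add0r.
  rewrite -(hmE (t \o e) (t z) q^`()) [X in X * d](hm_comp e t).
  by rewrite /d [X in _ + X]mulrC divfK ?fmorph_eq0 // addrN mulr0.
by exists D'.
Qed.

(** * Extensions of ultraproducts along a tower *)

Section UltraFacts.
Variables (I : Type) (U : ultrafilter I).

Lemma UPmap_comp (A B C : I -> fieldType) (f : forall i, A i -> B i) (g : forall i, B i -> C i) x :
  UPmap g (UPmap f x) = UPmap (fun i => g i \o f i) x :> UP U C.
Proof. by elim/UP_ind: x => x; rewrite !UPmapE. Qed.

Lemma UPmap_id (A : I -> fieldType) (x : UP U A) : UPmap (fun i => id) x = x.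
Proof. by elim/UP_ind: x => x; rewrite UPmapE. Qed.

Lemma UPmap_deriv (A B : I -> fieldType) (f : forall i, {rmorphism A i -> B i})
    (D : forall i, A i -> B i) :
  U (fun i => deriv_over (f i) (D i)) -> deriv_over (@UPmap I U A B f) (@UPmap I U A B D).
Proof.
move=> h; split; elim/UP_ind=> x; elim/UP_ind=> y.
  rewrite -rmorphD !UPmapE -rmorphD; apply/upi_eq; apply: largeS h _ => i h.
  by rewrite -[LHS]/(D i (x i + y i)) (der_D h).
rewrite -rmorphM !UPmapE -!rmorphM -rmorphD; apply/upi_eq; apply: largeS h _ => i h.
by rewrite -[LHS]/(D i (x i * y i)) (der_M h).
Qed.

Lemma hm_upi (A B : I -> fieldType) (f : forall i, {rmorphism A i -> B i}) (x : uprod U B)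
    (P : {poly uprod U A}) :
  hm (UPmap f) (upi x) (map_poly (@upi I U A) P) =
  upi (fun i => hm (f i) (x i) (map_poly (@uev I U A i) P)).
Proof.
elim/poly_ind: P => [|P c IH].
  rewrite !rmorph0 -(rmorph0 (@upi I U B)); congr upi; apply: uprodP => i.
  by rewrite !rmorph0.
rewrite map_poly_cons hm_cons IH.
transitivity (upi (fun i => hm (f i) (x i) (map_poly (@uev I U A i) P)) * upi x
  + @upi I U B (fun i => f i (c i))); first by congr (_ + _); exact: UPmapE.
rewrite -rmorphM -rmorphD; congr upi.
by apply: uprodP => i; rewrite map_poly_cons hm_cons.
Qed.

Lemma mmap1_upi n (A : I -> fieldType) (x : 'I_n -> uprod U A) (m : 'X_{1..n}) :
  mmap1 (fun j => upi (x j)) m = upi (fun i => mmap1 (fun j => x j i) m).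
Proof.
rewrite /mmap1; under eq_bigr do rewrite -rmorphXn.
rewrite -rmorph_prod; congr upi; apply: uprodP => i.
rewrite -[LHS]/(uev i _) rmorph_prod; apply: eq_bigr => j _.
by rewrite rmorphXn.
Qed.

End UltraFacts.

Section Claim.
Variables (p : nat) (I : Type) (U : ultrafilter I) (K : I -> diffField) (C : diffField).
Variables (h : {rmorphism C -> UP U K}) (L : fieldType) (f : {rmorphism C -> L}).
Hypotheses (chK : forall i, p \in [pchar K i]).

(** The targets [H] are arbitrary for the sake of induction: one step up the tower, a derivation of
    the new field restricts to [G] with values outside the ultraproduct of the [E i]. *)
Definition deriv_lift (G : fieldType) (c : {rmorphism C -> G}) (E : I -> fieldType)
    (e : forall i, {rmorphism K i -> E i}) (k : {rmorphism G -> UP U E}) : Prop :=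
  forall (H : I -> fieldType) (t : forall i, {rmorphism E i -> H i}) (D : G -> UP U H),
    deriv_over (@UPmap I U E H t \o k) D ->
    (forall x, D (c x) = UPmap (fun i => t i \o e i) (UPmap (fun i => @der (K i)) (h x))) ->
    exists D' : forall i, E i -> H i,
      U (fun i => deriv_over (t i) (D' i) /\ forall x, D' i (e i x) = t i (e i (der x))) /\
      forall x, D x = UPmap D' (k x).

Definition has_spread (ys : seq L) : Prop :=
  exists (G : fieldType) (c : {rmorphism C -> G}) (g : {rmorphism G -> L})
    (E : I -> fieldType) (e : forall i, {rmorphism K i -> E i}) (k : {rmorphism G -> UP U E}),
    [/\ (forall x, g (c x) = f x) /\ (forall x, gen f ys (g x)),
        forall y, y \in ys -> exists b, g b = y,
        forall i, sep p (e i),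
        forall x, k (c x) = UPmap e (h x) &
        deriv_lift c e k].

(** Independent elements are sent to the classes of the variables in rational function fields over
    the [K i]. A derivation is determined by its values on [C] and at the variables, and
    representatives of the latter prescribe derivations in the factors. *)
Lemma spread_base n (b : 'I_n -> L) : alg_indep f b -> has_spread (codom b).
Proof.
move=> indb.
have /dchoice[S hS] : forall i, exists S : {E : fieldType & {e : {rmorphism K i -> E} & 'I_n -> E}},
  [/\ forall P, mmap (projT1 (projT2 S)) (projT2 (projT2 S)) P = 0 -> P = 0,
      forall p, p \in [pchar K i] -> sep p (projT1 (projT2 S)) &
      forall (H : fieldType) (t : {rmorphism projT1 S -> H}) (D : K i -> H) (d : 'I_n -> H),
        deriv_over (t \o projT1 (projT2 S)) D ->
        exists D' : projT1 S -> H, [/\ deriv_over t D',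
          forall c, D' (projT1 (projT2 S) c) = D c & forall j, D' (projT2 (projT2 S) j) = d j]].
  by move=> i; have [E [e [X hX]]] := transcendental_ext n (K i); exists (existT _ E (existT _ e X)).
pose E i : fieldType := projT1 (S i).
pose e i : {rmorphism K i -> E i} := projT1 (projT2 (S i)).
pose X i : 'I_n -> E i := projT2 (projT2 (S i)).
pose XX j : uprod U E := fun i => X i j.
pose k0 : {rmorphism C -> UP U E} := @UPmap I U K E e \o h.
have indX P : mmap k0 (fun j => upi (XX j)) P = 0 -> P = 0.
  pose c (m : 'X_{1..n}) : uprod U K := urep (h P@_m).
  have hc m : h P@_m = upi (c m) by rewrite urepK.
  rewrite /mmap.
  have -> : \sum_(m <- msupp P) k0 P@_m * mmap1 (fun j => upi (XX j)) m =
      upi (fun i => \sum_(m <- msupp P) e i (c m i) * mmap1 (X i) m).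
    rewrite -upi_sum; apply: eq_bigr => m _.
    by rewrite mmap1_upi /= hc UPmapE -rmorphM.
  move/upi_eq0 => h0; apply/mpolyP => m; rewrite mcoeff0.
  have [mP|/memN_msupp_eq0 //] := boolP (m \in msupp P).
  apply: (fmorph_inj h); rewrite rmorph0 hc; apply/upi_eq0; apply: largeS h0 _ => i h0.
  pose Q := \sum_(m <- msupp P) c m i *: 'X_[m] : {mpoly K i[n]}.
  have [/(_ Q) + _ _] := hS i; rewrite raddf_sum /=.
  have -> : \sum_(m <- msupp P) mmap (projT1 (projT2 (S i))) (projT2 (projT2 (S i))) (c m i *: 'X_[m]) = 0.
    by rewrite -[RHS]h0; apply: eq_bigr => m' _; rewrite mmapZ mmapX.
  move=> /(_ erefl) /(congr1 (mcoeff m)); rewrite mcoeff0 raddf_sum /= (bigD1_seq m) ?msupp_uniq //=.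
  rewrite mcoeffZ mcoeffX eqxx mulr1 big1 ?addr0 // => m' mm'.
  by rewrite mcoeffZ mcoeffX (negPf mm') mulr0.
have [|Q [q1 [q2 [r [h1 h2 fQ]]]]] :=
    @graph_ext _ _ _ (mmap f b) (mmap k0 (fun j => upi (XX j))).
  by move=> P; split=> [/indb ->|/indX ->]; rewrite rmorph0.
pose c : {rmorphism C -> Q} := r \o @mpolyC n C.
exists Q, c, q1, E, e, q2; split.
- split=> x; first by etransitivity; [exact: h1 | exact: mmapC].
  have [P [R [R0 ->]]] := fQ x; rewrite fmorph_div !h1 => T hT hC hy.
  have mT P' : T (mmap f b P').
    apply: subf_sum => // m _; apply: subfM => //; apply: subf_prod => // j _.
    by apply: subfX => //; apply/hy/codom_f.
  by apply: (subfM hT); [exact: mT | exact/(subfV hT)/mT].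
- by move=> y /codomP[j ->]; exists (r 'X_j); rewrite h1; etransitivity; [exact: mmapX | exact: mmap1U].
- by move=> i; have [_ hs _] := hS i; apply: hs.
- by move=> x; etransitivity; [exact: h2 | exact: mmapC].
move=> H t D hD Dc.
pose d j : uprod U H := urep (D (r 'X_j)).
have /dchoice[D' hD'] : forall i, exists D' : E i -> H i,
    [/\ deriv_over (t i) D', forall x, D' (e i x) = t i (e i (der x)) & forall j, D' (X i j) = d j i].
  move=> i; have [_ _ hl] := hS i; apply: hl.
  by split=> x y; rewrite ?derD ?derM !rmorphD ?rmorphM.
exists D'; split; first by apply: large_true => i; case: (hD' i).
have hU : deriv_over (@UPmap I U E H t) (@UPmap I U E H D').
  by apply: UPmap_deriv; apply: large_true => i; case: (hD' i).
have hD2 : deriv_over (@UPmap I U E H t \o q2) (@UPmap I U E H D' \o q2).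
  by case: hU => u1 u2; split=> x y; rewrite /= ?rmorphD ?rmorphM ?u1 ?u2.
apply: (deriv_frac_unique fQ hD hD2).
have DcE x : D (r x%:MP) = (@UPmap I U E H D' \o q2) (r x%:MP).
  have e2 : q2 (r x%:MP) = UPmap e (h x) by etransitivity; [exact: h2 | exact: mmapC].
  rewrite -[LHS]/(D (c x)) Dc [RHS]/= e2; elim/UP_ind: (h x) => y; rewrite !UPmapE.
  by congr upi; apply: uprodP => i; have [_ -> _] := hD' i.
have DXE j : D (r 'X_j) = (@UPmap I U E H D' \o q2) (r 'X_j).
  have e2 : q2 (r 'X_j) = upi (XX j).
    by rewrite h2; etransitivity; [exact: mmapX | exact: mmap1U].
  rewrite [RHS]/= e2 UPmapE -[LHS]urepK; congr upi; apply: uprodP => i.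
  by have [_ _ ->] := hD' i.
have DM P R : D (r P) = (@UPmap I U E H D' \o q2) (r P) ->
    D (r R) = (@UPmap I U E H D' \o q2) (r R) ->
    D (r (P * R)) = (@UPmap I U E H D' \o q2) (r (P * R)).
  by move=> eP eR; rewrite rmorphM (der_M hD) (der_M hD2) eP eR.
elim/mpolyind => [|a m P _ _ IH]; first by rewrite rmorph0 (der_0 hD) (der_0 hD2).
rewrite rmorphD (der_D hD) (der_D hD2) IH; congr (_ + _).
rewrite -mul_mpolyC; apply: (DM _ _) => //; rewrite mpolyXE_id.
have D1 : D (r 1) = (@UPmap I U E H D' \o q2) (r 1) by rewrite rmorph1 (der_1 hD) (der_1 hD2).
apply: (big_ind (fun P => D (r P) = (@UPmap I U E H D' \o q2) (r P))) => [//|P1 P2 hP1 hP2|j _];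
  first exact: (DM _ _).
elim: (m j) => [//|l IHl]; rewrite exprS; exact: (DM _ _).
Qed.

(** [y] is a simple root of its minimal polynomial [q] over [G]. Almost every factor admits a root
    of the corresponding polynomial by [algebraic_ext], and the class of these roots satisfies the
    same relations over [G] as [y]. *)
Lemma spread_step ys y : has_spread ys -> sepalg f ys y -> has_spread (y :: ys).
Proof.
move=> [G [c [g [E [e [k [[gc geng] hys se kc lift]]]]]]] [P0 [P0c P0y P0'y]].
have imS z : gen f ys z -> exists b, z = g b.
  move/(_ (fun z => exists b, z = g b)); apply; first exact: im_subfield.
    by move=> x; exists (c x).
  by move=> y' /hys[b <-]; exists b.
have [b hb] := choice (fun j => imS _ (P0c j)).
pose f1 := \poly_(j < size P0) b j.
have ef1 : map_poly g f1 = P0.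
  apply/polyP => j; rewrite coef_map coef_poly; case: ltnP => hj; first by rewrite hb.
  by rewrite nth_default //; exact: (rmorph0 g).
have f1y : hm g y f1 = 0 by rewrite hmE ef1.
have f1n : f1 != 0.
  by apply: contra_neq P0'y => f10; rewrite -ef1 f10 rmorph0 deriv0 horner0.
pose rel d := `[< exists P : {poly G}, [/\ P != 0, hm g y P = 0 & size P = d] >].
have ex : exists d, rel d by exists (size f1); apply/asboolP; exists f1.
case: (ex_minnP ex) => d /asboolP[q [qn qy <-]] minq.
have {}minq Q : Q != 0 -> hm g y Q = 0 -> (size q <= size Q)%N.
  by move=> Qn Qy; apply: minq; apply/asboolP; exists Q.
have dvdq Q : hm g y Q = 0 -> q %| Q.
  move=> Qy; apply: contrapT => /negP nd.
  have Qm : hm g y (Q %% q) = 0.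
    by move: Qy; rewrite {1}(divp_eq Q q) rmorphD rmorphM qy mulr0 add0r.
  by have := minq (Q %% q) nd Qm; rewrite leqNgt ltn_modp qn.
have copq Q : hm g y Q != 0 -> coprimep q Q.
  move=> Qy; rewrite /coprimep.
  have [s qE] := dvdpP _ _ (dvdp_gcdl q Q); have [w QE] := dvdpP _ _ (dvdp_gcdr q Q).
  have gy : hm g y (gcdp q Q) != 0.
    by apply: contra_neq Qy => g0; rewrite QE rmorphM g0 mulr0.
  have sy : hm g y s = 0.
    by apply/eqP; move: qy; rewrite qE rmorphM => /eqP; rewrite mulf_eq0 (negPf gy) orbF.
  have sn : s != 0 by apply: contra_neq qn => s0; rewrite qE s0 mul0r.
  have gn : gcdp q Q != 0 by rewrite gcdp_eq0 (negPf qn).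
  have := minq s sn sy; rewrite {1}qE size_mul //.
  move: gn; rewrite -size_poly_gt0; case: (size (gcdp q Q)) => [//|[//|l]] _.
  by rewrite !addnS /= ltnNge leq_addr.
have q'y : hm g y q^`() != 0.
  have [s f1E] := dvdpP _ _ (dvdq _ f1y).
  apply: contra_neq P0'y => q'0; rewrite -ef1 deriv_map -hmE f1E derivM rmorphD !rmorphM qy q'0.
  by rewrite !mulr0 addr0.
have qsz : (1 < size q)%N.
  rewrite ltnNge; apply/negP => /size1_polyC qE; move: qy qn; rewrite qE hmC => /eqP.
  by rewrite fmorph_eq0 => /eqP ->; rewrite eqxx.
have [[A B] /= bez] := Bezout_eq1_coprimepP _ _ (copq _ q'y).
have [qh hq] := upi_poly_surj (map_poly k q).
have [Ah hA] := upi_poly_surj (map_poly k A).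
have [Bh hB] := upi_poly_surj (map_poly k B).
pose qi i := map_poly (@uev I U E i) qh.
(* Both conditions concern finitely many coefficients: a Bezout identity, and a nonzero leading
   coefficient of [q], whose image is nonzero in almost all factors. *)
pose good i := (exists A B, A * qi i + B * (qi i)^`() = 1) /\ (1 < size (qi i))%N.
have goodU : U good.
  apply: largeI.
    have : map_poly (@upi I U E) (Ah * qh + Bh * qh^`() - 1) = 0.
      have -> : map_poly (@upi I U E) (Ah * qh + Bh * qh^`() - 1) =
          map_poly (@upi I U E) Ah * map_poly (@upi I U E) qh +
          map_poly (@upi I U E) Bh * (map_poly (@upi I U E) qh)^`() - 1.
        by rewrite rmorphB rmorphD !rmorphM rmorph1 deriv_map.
      by rewrite hA hB hq deriv_map -!rmorphM -rmorphD bez rmorph1 subrr.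
    move/upi_poly_eq0 => hh; apply: largeS hh _ => i.
    move=> hi; exists (map_poly (@uev I U E i) Ah), (map_poly (@uev I U E i) Bh).
    by apply/eqP; rewrite -subr_eq0 -hi rmorphB rmorphD !rmorphM rmorph1 /qi deriv_map.
  have : ~ U (fun i => qh`_(size q).-1 i = 0).
    move/upi_eq0/eqP; rewrite -[upi _](coef_map (@upi I U E)) hq coef_map fmorph_eq0.
    by rewrite -/(lead_coef q) lead_coef_eq0 (negPf qn).
  move/largeN/largeS; apply=> i hi; rewrite ltnNge; apply/negP => hs; apply: hi.
  rewrite -[LHS](coef_map (@uev I U E i)) nth_default // (leq_trans hs) //.
  by rewrite -ltnS prednK // (ltn_trans _ qsz).
have /dchoice[S hS] : forall i, exists S : {F : fieldType & {e' : {rmorphism E i -> F} & F}},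
    sep p (projT1 (projT2 S)) /\ (good i ->
     hm (projT1 (projT2 S)) (projT2 (projT2 S)) (qi i) = 0 /\
      forall (H : fieldType) (t : {rmorphism projT1 S -> H}) (D : E i -> H),
        deriv_over (t \o projT1 (projT2 S)) D ->
        exists D' : projT1 S -> H, deriv_over t D' /\ forall c, D' (projT1 (projT2 S) c) = D c).
  move=> i; have [[[Ai [Bi bi]] si]|ng] := pselect (good i).
    have [F [e' [x [hx hs hl]]]] := algebraic_ext bi si.
    exists (existT _ F (existT _ e' x)); split=> //=; apply: hs.
    by rewrite (fmorph_pchar (e i)).
  (* At the remaining indices nothing is adjoined, which keeps every embedding separable. *)
  by exists (existT (fun F : fieldType => {_ : {rmorphism E i -> F} & F}) (E i)
    (existT (fun _ : {rmorphism E i -> E i} => GRing.Field.sort (E i)) (idfun :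
      {rmorphism E i -> E i}) 0)); split=> // T A' g'.
pose E' i : fieldType := projT1 (S i).
pose e' i : {rmorphism E i -> E' i} := projT1 (projT2 (S i)).
pose x' : uprod U E' := fun i => projT2 (projT2 (S i)).
pose k' : {rmorphism G -> UP U E'} := @UPmap I U E E' e' \o k.
have k'E Q : hm k' (upi x') Q = hm (@UPmap I U E E' e') (upi x') (map_poly k Q).
  by rewrite !hmE map_poly_comp.
have qx' : hm k' (upi x') q = 0.
  rewrite k'E -hq hm_upi; apply/upi_eq0; apply: largeS goodU _ => i gi.
  by have [_ /(_ gi)[-> _]] := hS i.
have [Q|Q [q1 [q2 [i [x [e1 e2 x1 x2 fQ]]]]]] := @simple_ext G L _ g k' y (upi x').
  split=> [/dvdq/dvdpP[s ->]|]; first by rewrite rmorphM qx' mulr0.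
  move=> Qx; apply: contrapT => /eqP/copq/Bezout_eq1_coprimepP[[u v] /= uv].
  have := congr1 (hm k' (upi x')) uv; rewrite rmorphD !rmorphM Qx qx' !mulr0 addr0 rmorph1.
  by move/eqP; rewrite eq_sym oner_eq0.
have q1hm P : q1 (hm i x P) = hm g y P.
  by rewrite -hm_comp x1 !hmE; congr _.[_]; apply: eq_map_poly.
exists Q, (i \o c), q1, E', (fun j => e' j \o e j), q2; split.
- split=> z; first by rewrite /= e1 gc.
  have [P [R [R0 ->]]] := fQ z; rewrite fmorph_div !q1hm => T hT hC hy.
  have mT P' : T (hm g y P').
    rewrite hmE horner_coef; apply: subf_sum => // j _; apply: subfM => //.
      rewrite coef_map; apply: geng => // y' hy'; apply: hy; rewrite inE hy' orbT //.
    by apply: subfX => //; apply/hy/mem_head.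
  by apply: (subfM hT); [exact: mT | exact/(subfV hT)/mT].
- move=> y'; rewrite inE => /orP[/eqP ->|/hys[a <-]]; first by exists x.
  by exists (i a); rewrite e1.
- by move=> j; apply: sep_comp => //; case: (hS j).
- by move=> z; rewrite /= e2 /= kc UPmap_comp.
move=> H t D hD Dc.
have [||D1 [hD1 eD1]] := lift H (fun j => t j \o e' j) (D \o i).
- split=> a b'; rewrite /= ?rmorphD ?rmorphM ?(der_D hD) ?(der_M hD) //=.
  by rewrite !e2 /= !UPmap_comp.
- exact: Dc.
have /dchoice[D2 hD2] : forall j, exists D2 : E' j -> H j,
   good j -> deriv_over (t j \o e' j) (D1 j) ->
   deriv_over (t j) D2 /\ forall z, D2 (e' j z) = D1 j z.
  move=> j; have [gj|ng] := pselect (good j); last by exists (fun=> 0).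
  have [dj|nd] := pselect (deriv_over (t j \o e' j) (D1 j)); last by exists (fun=> 0).
  have [_ /(_ gj)[_ /(_ _ (t j) _ dj)[D2 h2]]] := hS j.
  by exists D2.
exists D2; split.
  apply: largeS (largeI goodU hD1) _ => j [gj [dj ej]].
  have [h1 h2] := hD2 j gj dj; split=> // z.
  by rewrite /= h2 ej.
have hU : deriv_over (@UPmap I U E' H t) (@UPmap I U E' H D2).
  apply: UPmap_deriv; apply: largeS (largeI goodU hD1) _ => j [gj [dj ej]].
  by have [] := hD2 j gj dj.
have hD2' : deriv_over (@UPmap I U E' H t \o q2) (@UPmap I U E' H D2 \o q2).
  by case: hU => u1 u2; split=> u v; rewrite /= ?rmorphD ?rmorphM ?u1 ?u2.
have ei z : D (i z) = (@UPmap I U E' H D2 \o q2) (i z).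
  rewrite -[LHS]/((D \o i) z) eD1 /= e2 /=; elim/UP_ind: (k z) => w; rewrite !UPmapE.
  apply/upi_eq; apply: largeS (largeI goodU hD1) _ => j [gj [dj ej]].
  by have [_ ->] := hD2 j gj dj.
apply: (frac_gen_deriv_unique fQ hD hD2' ei).
(* Differentiating [q(x) = 0] forces both derivations to agree at [x], since [q'(x)] is nonzero. *)
have qix : hm i x q = 0 by apply: (fmorph_inj q1); rewrite q1hm qy rmorph0.
have := der_hm i x q hD; have := der_hm i x q hD2'.
rewrite qix (der_0 hD) (der_0 hD2').
have -> : map_poly (D \o i) q = map_poly ((@UPmap I U E' H D2 \o q2) \o i) q.
  by apply: eq_map_poly => z; rewrite /= ei.
move=> h2 h1; have e3 := addrI _ (etrans (esym h1) h2).
apply: (mulfI _ e3); rewrite fmorph_eq0.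
by apply: contra_neq q'y => z0; rewrite -q1hm z0 rmorph0.
Qed.

End Claim.

(** * Existential closedness *)

(** Equations alone are recorded: glued over all finite [X], such maps form a morphism of fields,
    and this is injective. *)
Definition pmorph (L K : diffField) (X : seq L) (t : L -> K) : Prop :=
  [/\ forall x y, x \in X -> y \in X -> x + y \in X -> t (x + y) = t x + t y,
      forall x y, x \in X -> y \in X -> x * y \in X -> t (x * y) = t x * t y,
      1 \in X -> t 1 = 1 &
      forall x, x \in X -> der x \in X -> t (der x) = der (t x)].

Definition diff_emb (C L : diffField) (f : C -> L) : Prop := forall x, f (der x) = der (f x).

(* Existential closedness in separable extensions, with finite partial
   morphisms in place of quantifier-free formulas. *)
Definition sem_closed (p : nat) (K : diffField) : Prop :=
  forall (E : diffField) (f : {rmorphism K -> E}), diff_emb f -> sep p f ->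
  forall X : seq E, exists t : E -> K, pmorph X t /\ forall c, f c \in X -> t (f c) = c.

Lemma der_deriv (K : diffField) : deriv_over (@idfun K) (@der K).
Proof. by split=> x y; rewrite ?derD ?derM. Qed.

Section AtomicDiagram.
Variable n : nat.
Local Notation fm := (formula df_signature n).
Local Notation tm := (term df_signature n).

Definition fm_true : fm := FEq (@App df_signature n One (fun i => False_rect _ (notF (valP i))))
  (@App df_signature n One (fun i => False_rect _ (notF (valP i)))).
Definition fm_guard (b : bool) (phi : fm) : fm := if b then phi else fm_true.
Definition fm_all (T : finType) (phi : T -> fm) : fm :=
  foldr (fun t psi => FAnd (phi t) psi) fm_true (enum T).
Definition tm_add (a b : tm) : tm :=
  @App df_signature n Add (fun i : 'I_2 => if i == ord0 then a else b).
Definition tm_mul (a b : tm) : tm :=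
  @App df_signature n Mul (fun i : 'I_2 => if i == ord0 then a else b).
Definition tm_der (a : tm) : tm := @App df_signature n Der (fun i : 'I_1 => a).
Definition tm_one : tm := @App df_signature n One (fun i => False_rect _ (notF (valP i))).

Lemma fm_all_qf (T : finType) (phi : T -> fm) :
  (forall t, quantifier_free (phi t)) -> quantifier_free (fm_all phi).
Proof. by move=> h; rewrite /fm_all; elim: (enum T) => //= t s ->; rewrite h. Qed.

Lemma fm_guard_qf b phi : quantifier_free phi -> quantifier_free (fm_guard b phi).
Proof. by case: b. Qed.

Variables (K : diffField) (e : (K ^ n)%type).
Local Notation ssat phi := (@sat _ (df_structure K) _ phi e).
Local Notation ev a := (@eval _ (df_structure K) _ e a).

Lemma sat_all (T : finType) (phi : T -> fm) : ssat (fm_all phi) <-> forall t, ssat (phi t).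
Proof.
split=> [h t|h].
  move: h; rewrite /fm_all; have : t \in enum T by rewrite mem_enum.
  elim: (enum T) => //= t' s IH; rewrite inE => /orP[/eqP <- []//|ts [_]]; exact: IH.
by rewrite /fm_all; elim: (enum T) => //= t s IH; split.
Qed.

Lemma sat_guard b phi : ssat (fm_guard b phi) <-> (b -> ssat phi).
Proof. by case: b => /=; split=> // h; apply: h. Qed.

Lemma eval_add a b : ev (tm_add a b) = ev a + ev b.
Proof. by rewrite /= !ffunE. Qed.
Lemma eval_mul a b : ev (tm_mul a b) = ev a * ev b.
Proof. by rewrite /= !ffunE. Qed.
Lemma eval_der a : ev (tm_der a) = der (ev a).
Proof. by rewrite /= !ffunE. Qed.
Lemma eval_one : ev tm_one = 1.
Proof. by []. Qed.

End AtomicDiagram.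

(** The positive atomic diagram of [X], with the elements of [X] that come from [K] as parameters,
    is a quantifier-free formula satisfied in [E]; a solution in [K] is the partial morphism. *)
Lemma sep_diff_closed_sem (p : nat) (K : diffField) :
  p \in [pchar K] -> sep_diff_closed p K -> sem_closed p K.
Proof.
move=> chK hK E f df sf X.
have chE : p \in [pchar E] by rewrite (fmorph_pchar f).
have sx : separable_ext p f by apply/(separable_ext_sep f chK chE).
pose m := size X; pose z (k : 'I_m) := X`_k.
(* Outside the image of [f] the parameter defaults to 0; the guard [f (c k) == z k] then discards
   the equation. *)
have /choice[c hc] : forall k, exists c : K, (exists a, f a = z k) -> f c = z k.
  move=> k; have [[a ha]|h] := pselect (exists a, f a = z k); first by exists a.
  by exists 0.
pose P k : term df_signature (m + m) := Var (lshift m k).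
pose V k : term df_signature (m + m) := Var (rshift m k).
pose phi := FAnd (fm_all (fun k => fm_guard (f (c k) == z k) (FEq (V k) (P k))))
  (FAnd (fm_all (fun k : 'I_m * 'I_m * 'I_m =>
      fm_guard (z k.1.1 + z k.1.2 == z k.2) (FEq (tm_add (V k.1.1) (V k.1.2)) (V k.2))))
  (FAnd (fm_all (fun k : 'I_m * 'I_m * 'I_m =>
      fm_guard (z k.1.1 * z k.1.2 == z k.2) (FEq (tm_mul (V k.1.1) (V k.1.2)) (V k.2))))
  (FAnd (fm_all (fun k => fm_guard (z k == 1) (FEq (V k) (tm_one _))))
    (fm_all (fun k : 'I_m * 'I_m => fm_guard (der (z k.1) == z k.2) (FEq (tm_der (V k.1)) (V k.2))))))).
have qf : quantifier_free phi.
  by rewrite /= !fm_all_qf // => k; apply: fm_guard_qf.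
have EP (F : diffField) (a b : (F ^ m)%type) k :
    @eval _ (df_structure F) _ (cat_ffun a b) (P k) = a k.
  by rewrite /= ffunE (unsplitK (inl k)).
have EV (F : diffField) (a b : (F ^ m)%type) k :
    @eval _ (df_structure F) _ (cat_ffun a b) (V k) = b k.
  by rewrite /= ffunE (unsplitK (inr k)).
have [|x] := hK E f df sx m m phi (finfun c) qf.
  exists (finfun z); rewrite /phi /sat -/sat.
  split; [|split; [|split; [|split]]]; apply/sat_all => k; apply/sat_guard => /eqP h; rewrite /sat.
  - by rewrite EV EP !ffunE h.
  - by rewrite eval_add !EV !ffunE.
  - by rewrite eval_mul !EV !ffunE.
  - by rewrite eval_one EV ffunE.
  - by rewrite eval_der !EV !ffunE.
rewrite /phi /sat -/sat => -[/sat_all h1 [/sat_all h2 [/sat_all h3 [/sat_all h4 /sat_all h5]]]].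
pose t (a : E) : K := if insub (index a X) is Some k then x k else 0.
have tz a : a \in X -> exists2 k : 'I_m, t a = x k & z k = a.
  move=> aX; have hk : (index a X < m)%N by rewrite index_mem.
  by exists (Ordinal hk); rewrite /t ?insubT // /z nth_index.
exists t; split; last first.
  move=> a /tz[k -> zk]; have := h1 k => /sat_guard; rewrite hc; last by exists a.
  rewrite eqxx => /(_ isT); rewrite /sat EV EP ffunE => ->.
  by apply: (fmorph_inj f); rewrite hc //; exists a.
split.
- move=> a b /tz[i -> zi] /tz[j -> zj] /tz[k -> zk]; have /sat_guard e := h2 (i, j, k).
  have /e : z i + z j == z k by rewrite zi zj zk.
  by rewrite /sat eval_add !EV.
- move=> a b /tz[i -> zi] /tz[j -> zj] /tz[k -> zk]; have /sat_guard e := h3 (i, j, k).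
  have /e : z i * z j == z k by rewrite zi zj zk.
  by rewrite /sat eval_mul !EV.
- by move=> /tz[k -> zk]; have /sat_guard := h4 k; rewrite zk eqxx => /(_ isT); rewrite /sat EV.
- move=> a /tz[i -> zi] /tz[k -> zk]; have /sat_guard e := h5 (i, k).
  have /e : der (z i) == z k by rewrite zi zk.
  by rewrite /sat eval_der !EV.
Qed.

Section UltraPmorph.
Variables (I : Type) (U : ultrafilter I) (K : I -> diffField) (L : diffField) (X : seq L).

Lemma pmorph_ultra (t : forall i, L -> K i) :
  U (fun i => pmorph X (t i)) -> pmorph X (fun x => upi (fun i => t i x) : UPdiff U K).
Proof.
move=> h; split.
- move=> x y xX yX sX; rewrite -[RHS]rmorphD; apply/upi_eq; apply: largeS h _ => i [h1 _ _ _].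
  exact: h1.
- move=> x y xX yX sX; rewrite -[RHS]rmorphM; apply/upi_eq; apply: largeS h _ => i [_ h1 _ _].
  exact: h1.
- move=> x1; rewrite -[RHS](rmorph1 (@upi I U K)); apply/upi_eq.
  by apply: largeS h _ => i [_ _ h1 _]; apply: h1.
- move=> x xX dX; rewrite UPdiffE; apply/upi_eq; apply: largeS h _ => i [_ _ _ h1].
  exact: h1.
Qed.

End UltraPmorph.

Section GraphDerivation.
Variables (Q : fieldType) (N1 N2 : diffField) (q1 : {rmorphism Q -> N1}) (q2 : {rmorphism Q -> N2}).

Definition graph_der (c c' : Q) : Prop := q1 c' = der (q1 c) /\ q2 c' = der (q2 c).

Lemma graph_der_subfield : subfield_pred (fun c => exists c', graph_der c c').
Proof.
have h1 := der_deriv N1; have h2 := der_deriv N2; split.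
- by exists 0; split; rewrite !rmorph0 !rmorph1 ?(der_1 h1) ?(der_1 h2).
- move=> x y [x' [a1 a2]] [y' [b1 b2]]; exists (x' - y').
  by split; rewrite !rmorphB ?(der_B h1) ?(der_B h2) ?a1 ?a2 ?b1 ?b2.
- move=> x y [x' [a1 a2]] [y' [b1 b2]]; exists (x' * y + x * y').
  by split; rewrite rmorphD !rmorphM derM ?a1 ?a2 ?b1 ?b2.
move=> x [x' [a1 a2]]; have [->|x0] := eqVneq x 0.
  by exists 0; split; rewrite invr0 !rmorph0 ?(der_0 h1) ?(der_0 h2).
exists (- x' / x ^+ 2); split.
  rewrite fmorphV -[(q1 x)^-1]mul1r (der_div h1) ?fmorph_eq0 // (der_1 h1) -a1 mul0r sub0r mul1r.
  by rewrite fmorph_div rmorphN rmorphXn.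
rewrite fmorphV -[(q2 x)^-1]mul1r (der_div h2) ?fmorph_eq0 // (der_1 h2) -a2 mul0r sub0r mul1r.
by rewrite fmorph_div rmorphN rmorphXn.
Qed.

Lemma graph_der_exists : (forall c, exists c', graph_der c c') ->
  exists D : Q -> Q, [/\ {morph D : x y / x + y},
    forall x y, D (x * y) = D x * y + x * D y & forall c, graph_der c (D c)].
Proof.
move=> /choice[D hD]; have h c : q1 (D c) = der (q1 c) by case: (hD c).
exists D; split=> // x y; apply: (@fmorph_inj _ _ q1); rewrite h.
  by rewrite !(rmorphD q1) derD !h.
by rewrite (rmorphD q1) !(rmorphM q1) derM !h.
Qed.

End GraphDerivation.

Section Spread.
Variables (p : nat) (I : Type) (U : ultrafilter I) (K : I -> diffField) (C L : diffField).
Variables (h : {rmorphism C -> UP U K}) (f : {rmorphism C -> L}).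
Hypotheses (chK : forall i, p \in [pchar K i]) (dh : forall x, h (der x) = UPder (h x)).
Hypotheses (df : diff_emb f) (sf : sep p f).

Let chC : p \in [pchar C].
Proof. by rewrite -(fmorph_pchar h); apply: UP_pchar. Qed.
Let chL : p \in [pchar L]. Proof. by rewrite (fmorph_pchar f). Qed.

Lemma spread_exists (X : seq L) : exists2 ys, (forall x, x \in X -> x \in ys) & has_spread p h f ys.
Proof.
have [ys tys hys] := tower_exists chC chL sf (tnth (in_tuple X)).
exists ys; last by elim: tys => [n b|zs y _ ih sy]; [apply: spread_base | apply: spread_step].
by move=> x xX; have /tnthP[k ->] : x \in in_tuple X by []; apply: hys.
Qed.

(* On the subfield of those x whose derivative stays in G the derivation of L
   may be kept; it contains the p-th powers, hence it extends to all of G. *)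
Lemma adapt_deriv (ys : seq L) (G : fieldType) (c : {rmorphism C -> G}) (g : {rmorphism G -> L}) :
  (forall x, g (c x) = f x) -> (forall x, gen f ys (g x)) ->
  (forall y, y \in ys -> exists b, g b = y) ->
  exists D : G -> G, deriv_over (@idfun G) D /\ forall x x', der (g x) = g x' -> D x = x'.
Proof.
move=> gc geng hys; have sub := graph_der_subfield g g.
have [S [s hS]] := subfield_exists sub.
have /choice[D hD] : forall a, exists x', der (g (s a)) = g x'.
  by move=> a; have [x' [e _]] := (hS (s a)).2 (ex_intro _ a erefl); exists x'.
have chS : p \in [pchar S] by rewrite -(fmorph_pchar (g \o s)).
have dD : deriv_over s D.
  split=> x y; apply: (fmorph_inj g); rewrite -hD.
    by rewrite (rmorphD s) (rmorphD g) derD !hD -rmorphD.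
  by rewrite (rmorphM s) (rmorphM g) derM !hD rmorphD !rmorphM.
have [bs hbs] : exists bs : seq G, [seq g b | b <- bs] = ys.
  elim: (ys) hys => [|y zs IH] hzs; first by exists [::].
  have [b hb] := hzs y (mem_head _ _).
  have [|bs hbs] := IH; first by move=> z hz; apply: hzs; rewrite inE hz orbT.
  by exists (b :: bs); rewrite /= hb hbs.
have [|S' [s' [D' [dD' eD' hs']]]] := @extend_deriv_inseparable p S G s D bs chS dD.
  move=> x; have d0 : der (g (x ^+ p)) = g 0 by rewrite rmorph0 rmorphXn (der_Xp (der_deriv L) chL).
  have [|a sa] := (hS (x ^+ p)).1; first by exists 0; split; rewrite d0.
  by exists a => //; apply: (fmorph_inj g); rewrite -hD sa d0.
have sS x y : der (g x) = g y -> exists2 a, s' a = x & forall x', der (g x) = g x' -> D' a = x'.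
  move=> xy; have [|a sa] := (hS x).1; first by exists y; split; rewrite xy.
  have [a' h1 h2] := eD' a; exists a'; rewrite ?h1 // => x' hx'.
  by rewrite h2; apply: (fmorph_inj g); rewrite -hD sa.
(* The image of [s'] contains [C], on which the derivation stays in [G], and the generators, which
   were adjoined as p-th roots; so it is all of [G]. *)
have surj x : exists a, s' a = x.
  have /(_ (fun z => exists a, z = g (s' a)))[] := geng x.
  - by have := im_subfield (g \o s').
  - move=> z; rewrite -gc; have [|a <- _] := sS (c z) (c (der z)); last by exists a.
    by rewrite !gc df.
  - move=> y; rewrite -hbs => /mapP[b /hs'[a <-] ->]; by exists a.
  by move=> a /(fmorph_inj g) ->; exists a.
have [inv hinv] := choice surj.
exists (D' \o inv); split.
  split=> x y /=.
    have -> : inv (x + y) = inv x + inv y by apply: (fmorph_inj s'); rewrite rmorphD !hinv.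
    by rewrite (der_D dD').
  have -> : inv (x * y) = inv x * inv y by apply: (fmorph_inj s'); rewrite rmorphM !hinv.
  by rewrite (der_M dD') !hinv.
move=> x x' hx; have [a sa ha] := sS x x' hx.
by rewrite /= -(ha _ hx); congr D'; apply: (fmorph_inj s'); rewrite hinv.
Qed.

Hypothesis cK : forall i, sem_closed p (K i).

(** [G] is made to contain [X] and its derivatives, so the adapted derivation agrees with that of
    [L] on [X]. Its lifts turn almost all [E i] into separable differential extensions of [K i], and
    closedness of [K i] sends the finite image of [X] back to [K i]. *)
Lemma spread_pmorph (X : seq L) :
  exists t : L -> UPdiff U K, pmorph X t /\ forall x, f x \in X -> t (f x) = h x.
Proof.
have [ys hys [G [c [g [E [e [k [[gc geng] gys se kc lift]]]]]]]] := spread_exists (X ++ [seq der x | x <- X]).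
have [D [dD eD]] := adapt_deriv gc geng gys.
have [||D' [hD' eD']] := lift E (fun i => idfun) (k \o D).
- split=> x y; rewrite /= ?(der_D dD) ?(der_M dD) ?rmorphD ?rmorphM //=.
  by rewrite !UPmap_id.
- move=> x; rewrite /= (eD _ (c (der x))); last by rewrite !gc df.
  by rewrite kc dh.
have [inv hinv] : exists inv : L -> G, forall z, z \in ys -> g (inv z) = z.
  have /choice[inv hinv] : forall z, exists b, z \in ys -> g b = z.
    move=> z; have [/gys[b hb]|nz] := boolP (z \in ys); first by exists b.
    by exists 0.
  by exists inv.
have Xys x : x \in X -> x \in ys by move=> xX; apply: hys; rewrite mem_cat xX.
have dXys x : x \in X -> der x \in ys.
  by move=> xX; apply: hys; rewrite mem_cat (map_f _ xX) orbT.
have gI : injective g by apply: fmorph_inj.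
pose t0 z := k (inv z); pose th i z : E i := urep (t0 z) i.
pose P i := deriv_over (@idfun (E i)) (D' i) /\ forall x, D' i (e i x) = e i (der x).
have hadd : U (fun i => forall x, x \in X -> forall y, y \in X -> x + y \in X ->
    th i (x + y) = th i x + th i y).
  apply: large_seq => x xX; apply: large_seq => y yX.
  have [sX|/negP nX] := boolP (x + y \in X); last exact: large_true.
  have : upi (urep (t0 (x + y))) = upi (urep (t0 x) + urep (t0 y)).
    rewrite rmorphD !urepK /t0; have -> : inv (x + y) = inv x + inv y; last by rewrite (rmorphD k);
      congr (_ + _); apply/esym/urepK.
    by apply: gI; rewrite rmorphD !hinv ?Xys.
  by move/upi_eq => hh; apply: largeS hh _ => i ei _.
have hmul : U (fun i => forall x, x \in X -> forall y, y \in X -> x * y \in X ->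
    th i (x * y) = th i x * th i y).
  apply: large_seq => x xX; apply: large_seq => y yX.
  have [sX|/negP nX] := boolP (x * y \in X); last exact: large_true.
  have : upi (urep (t0 (x * y))) = upi (urep (t0 x) * urep (t0 y)).
    rewrite rmorphM !urepK /t0; have -> : inv (x * y) = inv x * inv y; last by rewrite (rmorphM k);
      congr (_ * _); apply/esym/urepK.
    by apply: gI; rewrite rmorphM !hinv ?Xys.
  by move/upi_eq => hh; apply: largeS hh _ => i ei _.
have hone : U (fun i => 1 \in X -> th i 1 = 1).
  have [sX|/negP nX] := boolP (1 \in X); last exact: large_true.
  have : upi (urep (t0 1)) = upi 1.
    have -> : upi (1 : uprod U E) = k 1; last by rewrite urepK /t0; have -> : inv 1 = 1 by apply: gI;
      rewrite rmorph1 hinv ?Xys.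
    by rewrite !rmorph1.
  by move/upi_eq => hh; apply: largeS hh _ => i ei _.
have hder : U (fun i => forall x, x \in X -> der x \in X -> th i (der x) = D' i (th i x)).
  apply: large_seq => x xX.
  have : upi (urep (t0 (der x))) = upi (fun i => D' i (urep (t0 x) i)).
    rewrite urepK -(UPmapE D') urepK -eD' /t0 /=.
    by rewrite (eD _ (inv (der x))) // (hinv _ (Xys _ xX)) (hinv _ (dXys _ xX)).
  by move/upi_eq => hh; apply: largeS hh _ => i ei _.
have hfix : U (fun i => forall x, x \in X -> forall z, f z = x -> th i x = e i (urep (h z) i)).
  apply: large_seq => x xX; have [[z ez]|nz] := pselect (exists z, f z = x); last first.
    by apply: large_true => i z fz; case: nz; exists z.
  rewrite -ez in xX *.
  have : upi (urep (t0 (f z))) = upi (fun i => e i (urep (h z) i)).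
    rewrite urepK -(UPmapE (fun i => e i)) urepK -kc /t0; have -> // : inv (f z) = c z.
    by apply: gI; rewrite gc hinv // Xys.
  move/upi_eq => hh; apply: largeS hh _ => i ei z' /(fmorph_inj f) ->; exact: ei.
have /dchoice[t ht] : forall i, exists t : L -> K i, P i ->
    (forall x, x \in X -> forall y, y \in X -> x + y \in X -> th i (x + y) = th i x + th i y) ->
    (forall x, x \in X -> forall y, y \in X -> x * y \in X -> th i (x * y) = th i x * th i y) ->
    (1 \in X -> th i 1 = 1) ->
    (forall x, x \in X -> der x \in X -> th i (der x) = D' i (th i x)) ->
    (forall x, x \in X -> forall z, f z = x -> th i x = e i (urep (h z) i)) ->
    pmorph X t /\ forall z, f z \in X -> t (f z) = urep (h z) i.
  move=> i; have [[dP eP]|nP] := pselect (P i); last by exists (fun=> 0).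
  have dD1 : {morph D' i : x y / x + y} by move=> x y; rewrite (der_D dP).
  have dM1 x y : D' i (x * y) = D' i x * y + x * D' i y by rewrite (der_M dP).
  pose Ei := @DiffField (E i) (D' i) dD1 dM1.
  have de : @diff_emb (K i) Ei (e i) by move=> x; rewrite [RHS]/= eP.
  have [t' [[a1 a2 a3 a4] fx]] := @cK i Ei (e i) de (se i) [seq th i x | x <- X].
  exists (t' \o th i) => _ b1 b2 b3 b4 b5; split; last first.
    move=> z zX /=; have ez := b5 _ zX z erefl.
    by rewrite ez fx // -ez; apply: map_f.
  split=> [x y xX yX sX|x y xX yX sX|oX|x xX dX] /=.
  - by rewrite b1 // a1 ?map_f // -b1 // map_f.
  - by rewrite b2 // a2 ?map_f // -b2 // map_f.
  - by rewrite b3 // a3 // -b3 // map_f.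
  by rewrite b4 // -[D' i _]/(@der Ei _) a4 ?map_f // [@der Ei _]/= -b4 // map_f.
have good := largeI (largeI hadd hmul) (largeI (largeI hone hder) (largeI hfix hD')).
exists (fun x => upi (fun i => t i x)); split.
  by apply: pmorph_ultra; apply: largeS good _ => i [[g1 g2] [[g3 g4] [g5 g6]]]; case: (ht i).
move=> x xX; rewrite -[RHS]urepK; apply/upi_eq.
apply: largeS good _ => i [[g1 g2] [[g3 g4] [g5 g6]]].
by have [_ ->] := ht i g6 g1 g2 g3 g4 g5.
Qed.

End Spread.

(** The previous lemma with the ultraproduct itself as base field and the identity as its
    embedding. *)
Lemma sem_closed_ultra (p : nat) (I : Type) (U : ultrafilter I) (K : I -> diffField) :
  (forall i, p \in [pchar K i]) -> (forall i, sem_closed p (K i)) -> sem_closed p (UPdiff U K).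
Proof.
move=> chK cK E f df sf X.
exact: (@spread_pmorph p I U K (UPdiff U K) E idfun f chK (fun=> erefl) df sf cK X).
Qed.

(** * Constants and separability *)

Lemma const_subfield (C : diffField) : subfield_pred (@is_constant C).
Proof.
have hC := der_deriv C; rewrite /is_constant; split; first exact: (der_1 hC).
- by move=> x y dx dy; rewrite (der_B hC) dx dy subrr.
- by move=> x y dx dy; rewrite derM dx dy mul0r mulr0 addr0.
move=> x dx; have [->|x0] := eqVneq x 0; first by rewrite invr0 (der_0 hC).
by rewrite -[x^-1]mul1r (der_div hC) // (der_1 hC) dx mul0r mulr0 subrr mul0r.
Qed.

Lemma const_Xp (p : nat) (C : diffField) (chC : p \in [pchar C]) (x : C) :
  is_constant (x ^+ p).
Proof. exact: (der_Xp (der_deriv C) chC). Qed.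

Section Constants.
Variables (C N : diffField) (f : {rmorphism C -> N}).
Hypothesis df : diff_emb f.

(* Expand the c t over a maximal C-independent subfamily: differentiating shows
   that the coefficients are constants of C. This replaces Wronskians. *)
Lemma diff_emb_disjoint (T : finType) (A : {set T}) (h : T -> C) :
  (forall c : T -> C, (forall t, is_constant (c t)) ->
     \sum_(t in A) c t * h t = 0 -> forall t, t \in A -> c t = 0) ->
  forall c : T -> N, (forall t, is_constant (c t)) ->
     \sum_(t in A) c t * f (h t) = 0 -> forall t, t \in A -> c t = 0.
Proof.
move=> hA c cc hc t0 t0A; have [D indD [v hv]] := exists_max_indep_morph f c.
have dv t d : d \in D -> der (v t d) = 0.
  move=> dD; apply: (indD (fun d => der (v t d))) => //.
  transitivity (der (c t)); last exact: cc.
  rewrite [in RHS](hv t) (der_sum (der_deriv N)).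
  by apply: eq_bigr => s _; rewrite derM [der (c s)]cc mulr0 addr0 df.
rewrite (hv t0) big1 // => d dD.
suff -> : v t0 d = 0 by rewrite rmorph0 mul0r.
apply: (hA (fun t => v t d)) => // [t|]; first exact: dv.
apply: (indD (fun d => \sum_(t in A) v t d * h t)) => //.
rewrite -[RHS]hc; under [RHS]eq_bigr => t _ do rewrite [X in X * _](hv t) mulr_suml.
rewrite [RHS]exchange_big /=; apply: eq_bigr => s _; rewrite rmorph_sum mulr_suml.
by apply: eq_bigr => t _; rewrite rmorphM mulrAC.
Qed.

Variable p : nat.
Hypotheses (chC : p \in [pchar C]).
Let chN : p \in [pchar N]. Proof. by rewrite (fmorph_pchar f). Qed.

(** A family is expanded over elements independent over the constants, and the constant coefficients
    over a p-independent family. As p-th powers are constants, the products of the two kinds stay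
    p-independent by [diff_emb_disjoint], and [sep_span] applies. *)
Lemma sep_const :
  (forall (T : finType) (A : {set T}) (g : T -> C), (forall t, is_constant (g t)) ->
     pind p A g -> pind p A (f \o g)) -> sep p f.
Proof.
move=> H; apply: (sep_span chC chN) => T g.
have [A indA sA] := exists_max_indep (const_subfield C) g.
have /choice[u hu] : forall t, exists u : T -> C,
    (forall s, is_constant (u s)) /\ g t = \sum_(s in A) u s * g s.
  by move=> t; have [u u1 u2] := sA t; exists u.
pose v (ts : T * T) := u ts.1 ts.2.
have [R indR [w hw]] := exists_max_pind chC v.
have indfR : pind p R (f \o v) by apply: H => // ts; case: (hu ts.1) => h _; apply: h.
exists (fun=> 1); first by move=> _; apply: oner_neq0.
pose B := [set x : T * (T * T) | (x.1 \in A) && (x.2 \in R)].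
exists (T * (T * T))%type, B, (fun x => f (v x.2) * f (g x.1)), (fun t x => w (t, x.1) x.2).
have bE (F : T * (T * T) -> N) : \sum_(x in B) F x = \sum_(s in A) \sum_(r in R) F (s, r).
  by rewrite pair_big /=; apply: eq_big => [[s r]|[s r] _] //=; rewrite inE.
split=> [y|t].
  rewrite bE => hy [s r]; rewrite inE /= => /andP[sA' rR].
  apply: (indfR (fun r => y (s, r))) => //.
  apply: (diff_emb_disjoint indA (c := fun s => \sum_(r in R) y (s, r) ^+ p * (f \o v) r)) => //.
    move=> q; apply: (subf_sum (const_subfield N)) => r' _.
    apply: (subfM (const_subfield N)); first exact: const_Xp.
    by rewrite /is_constant /= -df; case: (hu r'.1) => cu _; rewrite [der _]cu rmorph0.
  rewrite -[RHS]hy; apply: eq_bigr => q _; rewrite mulr_suml; apply: eq_bigr => r' _.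
  by rewrite mulrA.
rewrite rmorph1 expr1n mulr1 bE; case: (hu t) => _ {1}->; rewrite rmorph_sum.
apply: eq_bigr => s _; rewrite -[u t s]/(v (t, s)) [v (t, s)]hw rmorphM rmorph_sum mulr_suml.
by apply: eq_bigr => r _; rewrite rmorphM rmorphXn mulrA.
Qed.

End Constants.

(** * The field [K^p(C)] and elements outside it *)

Section Pspan.
Variables (p : nat) (C K : fieldType) (j : {rmorphism C -> K}).
Hypothesis chK : p \in [pchar K].
Let chC : p \in [pchar C]. Proof. by rewrite -(fmorph_pchar j). Qed.

(** These sums already form the field generated by [K^p] and the image of [C]: the inverse of [x] is
    [x ^+ p.-1] times the p-th power of [x^-1]. *)
Definition pspan (x : K) : Prop :=
  exists (T : finType) (z : T -> K) (c : T -> C), x = \sum_t z t ^+ p * j (c t).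

Lemma pspan_base c : pspan (j c).
Proof.
exists unit, (fun=> 1), (fun=> c); rewrite (big_pred1 tt) ?expr1n ?mul1r //.
Qed.

Lemma pspan_Xp x : pspan (x ^+ p).
Proof.
exists unit, (fun=> x), (fun=> 1); rewrite (big_pred1 tt) ?rmorph1 ?mulr1 //.
Qed.

Lemma pspan_subfield : subfield_pred pspan.
Proof.
have hM x y : pspan x -> pspan y -> pspan (x * y).
  move=> [T [z [c ->]]] [T' [z' [c' ->]]].
  exists (T * T')%type, (fun t => z t.1 * z' t.2), (fun t => c t.1 * c' t.2).
  rewrite big_distrlr pair_big /=; apply: eq_bigr => -[t t'] _ /=.
  by rewrite exprMn rmorphM mulrACA.
have h1 : pspan 1 by rewrite -(rmorph1 j); apply: pspan_base.
split=> // [x y [T [z [c ->]]] [T' [z' [c' ->]]]|x hx].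
  exists (T + T')%type, (fun t => match t with inl t => z t | inr t => z' t end),
    (fun t => match t with inl t => c t | inr t => - c' t end).
  rewrite big_sumType /=; congr (_ + _); rewrite -sumrN; apply: eq_bigr => t _.
  by rewrite rmorphN mulrN.
have p0 := prime_gt0 (pcharf_prime chK).
have [->|x0] := eqVneq x 0; first by rewrite invr0 -(rmorph0 j); apply: pspan_base.
have -> : x^-1 = x ^+ p.-1 * x^-1 ^+ p.
  by rewrite -[in RHS](prednK p0) exprS mulrCA -exprMn divff // expr1n mulr1.
apply: (hM _ _); last exact: pspan_Xp.
by elim: (p.-1) => [|n IH]; [rewrite expr0 | rewrite exprS; apply: (hM _ _)].
Qed.

(** Members of [K^p(C)] are combinations over [K^p] of elements of [C]. Expanding these over a
    p-independent family of [C], which remains so in [N], gives the spanning family that [span_pind]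
    asks for. *)
Lemma pspan_pind (N : fieldType) (f : {rmorphism K -> N}) (j' : {rmorphism C -> N}) :
  (forall c, f (j c) = j' c) -> sep p j' ->
  forall (T : finType) (A : {set T}) (g : T -> K), (forall t, pspan (g t)) ->
  pind p A g -> pind p A (f \o g).
Proof.
move=> fj sj' T A g hg.
have /dchoice[X hX] : forall t, exists S : finType, exists (z : S -> K) (c : S -> C),
  g t = \sum_s z s ^+ p * j (c s) by [].
have /dchoice[z hz] : forall t, exists z : X t -> K, exists c : X t -> C,
  g t = \sum_s z s ^+ p * j (c s) by [].
have /dchoice[c hc] : forall t, exists c : X t -> C,
  g t = \sum_s z t s ^+ p * j (c s) by [].
pose h (s : {t & X t}) := c (tag s) (tagged s).
have [B indB [u hu]] := exists_max_pind chC h.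
have chN : p \in [pchar N] by rewrite (fmorph_pchar f).
apply: (@span_pind p K N f chK chN T {t & X t} A B g (fun=> 1) (j' \o h)
  (fun t s => \sum_q z t q * j (u (Tagged X q) s))); [by move=> _; apply: oner_neq0 | exact: sj' |].
move=> t; rewrite rmorph1 expr1n mulr1 hc rmorph_sum.
transitivity (\sum_q \sum_(s in B) (f (z t q * j (u (Tagged X q) s))) ^+ p * (j' \o h) s).
  apply: eq_bigr => q _; rewrite -[c t q]/(h (Tagged X q)) [h _]hu rmorph_sum mulr_sumr rmorph_sum.
  apply: eq_bigr => s _; rewrite (rmorphM j) (rmorphXn j) mulrA -exprMn.
  by rewrite (rmorphM f) (rmorphXn f) fj.
rewrite exchange_big /=; apply: eq_bigr => s _.
by rewrite rmorph_sum (pcharP_sum chN) mulr_suml.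
Qed.

End Pspan.

Lemma hm_poly (G Q : fieldType) (i : {rmorphism G -> Q}) (x : Q) n (c : nat -> G) :
  hm i x (\poly_(k < n) c k) = \sum_(k < n) i (c k) * x ^+ k.
Proof.
rewrite poly_def rmorph_sum; apply: eq_bigr => k _.
by rewrite -mul_polyC rmorphM rmorphXn hmC hmX.
Qed.

Section Transcendental.
Variables (p : nat) (C K : fieldType) (j : {rmorphism C -> K}) (g : K).
Hypotheses (chK : p \in [pchar K]) (hg : ~ pspan p j g).
Let chC : p \in [pchar C]. Proof. by rewrite -(fmorph_pchar j). Qed.

(** [g] is a p-th root of an element of [K^p(C)] and lies outside that field, hence has degree p
    over it. *)
Lemma pspan_free (s : 'I_p -> K) : (forall k, pspan p j (s k)) ->
  \sum_k s k * g ^+ k = 0 -> forall k, s k = 0.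
Proof.
move=> hs e k; have [S [i hi]] := subfield_exists (pspan_subfield j chK).
have chS : p \in [pchar S] by rewrite -(fmorph_pchar i).
have /choice[u hu] : forall k, exists u, i u = s k by move=> q; apply/hi.
have [a ha] : exists a, i a = g ^+ p by apply/hi; apply: pspan_Xp.
pose P := \poly_(q < p) (if insub q is Some q' then u q' else 0).
have Pu (q : 'I_p) : P`_q = u q by rewrite coef_poly ltn_ord valK.
have ig b : i b <> g by move=> ib; apply: hg; apply/hi; exists b.
have Pg : hm i g P = 0 by rewrite hm_poly -[RHS]e; apply: eq_bigr => q _; rewrite valK hu.
have P0 := dvdp_leq _ (inseparable_dvdp chS (esym ha) ig Pg).
have [PE|/P0] := eqVneq P 0; first by rewrite -hu -Pu PE coef0 rmorph0.
rewrite size_XnsubC ?(prime_gt0 (pcharf_prime chK)) // => h.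
by have := leq_trans h (size_poly _ _); rewrite ltnn.
Qed.

(** Over [K^p(C)] a relation [P] of [g] is a multiple of ['X^p - (g ^+ p)%:P], so its derivative
    vanishes at [g] and is zero by induction. Then [P] is a polynomial in ['X^p], and separability
    extracts p-th roots, which are relations of smaller degree. *)
Lemma pspan_transcendental (sj : sep p j) (P : {poly C}) : hm j g P = 0 -> P = 0.
Proof.
have p1 := prime_gt1 (pcharf_prime chK); have p0 := ltnW p1.
have [n] := ubnP (size P); elim: n P => // n IH P; rewrite ltnS => Pn Pg.
have [P1|P1] := leqP (size P) 1.
  move: Pg; rewrite (size1_polyC P1) hmC => /eqP; rewrite fmorph_eq0 => /eqP ->.
  by rewrite polyC0.
have [S [i hi]] := subfield_exists (pspan_subfield j chK).
have chS : p \in [pchar S] by rewrite -(fmorph_pchar i).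
have [|c hc] := @lift_rmorphism C S K i j.
  by move=> x; have [a <-] : exists a, i a = j x by [apply/hi; apply: pspan_base]; exists a.
have [a ha] : exists a, i a = g ^+ p by apply/hi; apply: pspan_Xp.
have ic Q : hm i g (map_poly c Q) = hm j g Q.
  by rewrite !hmE -map_poly_comp; congr _.[_]; apply: eq_map_poly => x; apply: hc.
have P'0 : P^`() = 0.
  apply: IH.
    by apply: leq_trans Pn; apply: lt_size_deriv; rewrite -size_poly_gt0 (ltn_trans _ P1).
  have /dvdpP[Q eQ] : 'X^p - a%:P %| map_poly c P.
    apply: (inseparable_dvdp chS (esym ha)) => [b ib|]; last by rewrite ic.
    by apply: hg; apply/hi; exists b.
  rewrite -ic -deriv_map eQ derivM derivB derivXn derivC subr0.
  have -> : 'X^(p.-1) *+ p = 0 :> {poly S} by rewrite -mulr_natr -polyC_natr (pcharf0 chS) polyC0 mulr0.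
  by rewrite mulr0 addr0 rmorphM rmorphB rmorphXn hmX hmC ha subrr mulr0.
have Pz k : ~~ (p %| k)%N -> P`_k = 0.
  case: k => [|k] pk; first by rewrite dvdn0 in pk.
  have : P^`()`_k = 0 by rewrite P'0 coef0.
  rewrite coef_deriv => /eqP; rewrite -mulr_natr mulf_eq0 => /orP[/eqP //|].
  by rewrite -(dvdn_pcharf chC) (negPf pk).
(* The number of exponents divisible by p up to the degree; it is below [size P] because [P] is not
   constant. *)
pose m := ((size P).-1 %/ p).+1.
have mP : (m < size P)%N.
  rewrite /m -ltnS; case: (size P) P1 => // q q0 /=; rewrite ltnS.
  by apply: ltn_Pdiv.
have PE : P = (\poly_(k < m) P`_(k * p)) \Po 'X^p.
  apply/polyP => k; rewrite coef_comp_poly_Xn //; case: ifPn => [pk|/Pz //].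
  rewrite coef_poly divnK // ltnS; case: ifPn => //.
  rewrite -ltnNge => h; rewrite nth_default // leqNgt; apply: contraL h => h.
  by rewrite -leqNgt leq_div2r // -ltnS prednK // (ltn_trans _ P1).
have [] := @sep_relP p C K j chC chK sj 'I_m setT (fun k => P`_(k * p)) (fun k => g ^+ k).
  rewrite big_setT -[RHS]Pg [in RHS]PE hmE map_comp_poly horner_comp map_polyXn hornerXn -hmE hm_poly.
  by apply: eq_bigr => k _; rewrite -!exprM mulnC mulrC.
move=> B [u [hu hB]]; rewrite PE.
suff -> : \poly_(k < m) P`_(k * p) = 0 by rewrite comp_poly0.
apply/polyP => k; rewrite coef0 coef_poly; case: ltnP => // km.
rewrite (hu (Ordinal km)) big1 // => s sB.
suff -> : u (Ordinal km) s = 0 by rewrite expr0n eqn0Ngt p0 mul0r.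
pose Q := \poly_(q < m) (if insub q is Some q' then u q' s else 0).
have : Q = 0.
  apply: IH; first by apply: leq_trans Pn; apply: leq_ltn_trans mP; apply: size_poly.
  rewrite hm_poly -[RHS](hB s sB) big_setT; apply: eq_bigr => q _.
  by rewrite valK mulrC.
by move=> /(congr1 (fun R : {poly C} => R`_k)); rewrite coef0 coef_poly km insubT.
Qed.

End Transcendental.

Section SimpleExtension.
Variables (p : nat) (C K Q : fieldType) (j : {rmorphism C -> K}) (g : K).
Variables (i : {rmorphism C -> Q}) (x : Q) (r : {rmorphism Q -> K}).
Hypotheses (chK : p \in [pchar K]) (hg : ~ pspan p j g) (sj : sep p j).
Hypotheses (gx : frac_gen i x) (ri : forall c, r (i c) = j c) (rx : r x = g).
Let chC : p \in [pchar C]. Proof. by rewrite -(fmorph_pchar j). Qed.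
Let chQ : p \in [pchar Q]. Proof. by rewrite -(fmorph_pchar r). Qed.
Let p0 : (0 < p)%N. Proof. exact: prime_gt0 (pcharf_prime chK). Qed.

(* A spanning family: p-independent elements of C times the powers of g below p. *)
Lemma frac_gen_sep : sep p r.
Proof.
apply: (sep_span chQ chK) => T f.
have /choice[P hP] : forall t, exists P, exists R : {poly C},
  hm i x R != 0 /\ f t = hm i x P / hm i x R by move=> t; apply: gx.
have /choice[R hR] := hP; pose b t := hm i x (R t).
exists b; first by move=> t; case: (hR t).
(* The value of [P / R * R ^+ p]: multiplying [f t] by the p-th power of its denominator leaves a
   polynomial in [x] over [C]. *)
pose M t := P t * R t ^+ p.-1.
pose n := \max_t size (M t).
pose v (y : T * 'I_n) := (M y.1)`_y.2.
have [B indB [u hu]] := exists_max_pind chC v.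
(* The power [g ^+ k] is [g ^+ (k %% p)] times the p-th power of [g ^+ (k %/ p)], so only residues
   modulo p remain in the spanning family. *)
pose pr (k : 'I_n) : 'I_p := Ordinal (ltn_pmod k p0).
exists ((T * 'I_n) * 'I_p)%type, [set y | y.1 \in B], (fun y : (T * 'I_n) * 'I_p => j (v y.1) * g ^+ y.2),
  (fun t (y : (T * 'I_n) * 'I_p) => \sum_(k | pr k == y.2) i (u (t, k) y.1) * x ^+ (k %/ p)).
have bE (F : (T * 'I_n) * 'I_p -> K) :
    \sum_(y in [set y | y.1 \in B]) F y = \sum_(s in B) \sum_q F (s, q).
  by rewrite pair_big /=; apply: eq_big => [[s q]|[s q] _] //=; rewrite inE andbT.
split.
  move=> z; rewrite bE exchange_big /= => e [s q]; rewrite inE /= => sB.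
  apply: (sj indB (c := fun s => z (s, q))) => //.
  apply: (pspan_free chK hg (s := fun q => \sum_(s in B) z (s, q) ^+ p * j (v s))).
    move=> k; apply: (subf_sum (pspan_subfield j chK)) => s' _.
    by apply: (subfM (pspan_subfield j chK)); [apply: pspan_Xp | apply: pspan_base].
  rewrite -[RHS]e; apply: eq_bigr => k _; rewrite mulr_suml; apply: eq_bigr => s' _.
  by rewrite mulrA.
move=> t; rewrite bE; have [b0 ft] := hR t.
have -> : r (f t) * r (b t) ^+ p = hm j g (M t).
  have e : f t * b t ^+ p = hm i x (M t).
    by rewrite ft -[hm i x (R t)]/(b t) rmorphM rmorphXn -[in LHS](prednK p0) exprS mulrA divfK.
  by rewrite -rmorphXn -rmorphM e -rx -hm_comp !hmE; congr _.[_]; apply: eq_map_poly => c; rewrite /= ri.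
have -> : M t = \poly_(k < n) (M t)`_k.
  apply/polyP => k; rewrite coef_poly; case: ltnP => // nk; rewrite nth_default //.
  by apply: leq_trans nk; apply: (@leq_bigmax _ (fun t => size (M t))).
rewrite hm_poly (partition_big pr xpredT) //= exchange_big /=; apply: eq_bigr => q _.
under [RHS]eq_bigr do rewrite rmorph_sum (pcharP_sum chK) mulr_suml.
rewrite exchange_big /=; apply: eq_bigr => k /eqP kq.
rewrite -[(M t)`_k]/(v (t, k)) hu rmorph_sum mulr_suml; apply: eq_bigr => s _.
rewrite (rmorphM j) (rmorphXn j) (rmorphM r) ri (rmorphXn r) rx exprMn.
rewrite [in LHS](divn_eq k p) exprD exprM -kq /=.
by rewrite -!mulrA; congr (_ * _); rewrite mulrCA.
Qed.

End SimpleExtension.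

(** Both constants are transcendental over [C], so [C(g)] and [C(u)] are isomorphic, and
    differentially so because [g] and [u] have derivative 0. *)
Lemma adjoin_constant (p : nat) (C K1 K2 : diffField) (j1 : {rmorphism C -> K1})
    (j2 : {rmorphism C -> K2}) (g : K1) (u : K2) :
  p \in [pchar K1] -> p \in [pchar K2] ->
  diff_emb j1 -> diff_emb j2 -> sep p j1 -> sep p j2 ->
  is_constant g -> is_constant u -> ~ pspan p j1 g -> ~ pspan p j2 u ->
  exists (C' : diffField) (i : {rmorphism C -> C'}) (q1 : {rmorphism C' -> K1})
    (q2 : {rmorphism C' -> K2}), [/\ diff_emb q1, diff_emb q2, sep p q1, sep p q2 &
    [/\ forall c, q1 (i c) = j1 c, forall c, q2 (i c) = j2 c & exists x, q1 x = g]].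
Proof.
move=> ch1 ch2 d1 d2 s1 s2 cg cu ng nu.
have [|Q [q1 [q2 [i [x [i1 i2 x1 x2 gx]]]]]] := @simple_ext C K1 K2 j1 j2 g u.
  move=> P; split=> [/(pspan_transcendental ch1 ng s1)|/(pspan_transcendental ch2 nu s2)] ->;
  by rewrite rmorph0.
have [|D [hD hM eD]] := @graph_der_exists Q K1 K2 q1 q2.
  have sub := graph_der_subfield q1 q2.
  have hm_der P : exists c', graph_der q1 q2 (hm i x P) c'.
    elim/poly_ind: P => [|P c IH]; first by rewrite rmorph0; apply: subf0 sub.
    rewrite hm_cons; apply: (subfD sub); first apply: (subfM sub) => //.
      exists 0; split; rewrite rmorph0 ?x1 ?x2; by rewrite [RHS]cg || rewrite [RHS]cu.
    by exists (i (der c)); split; rewrite ?i1 ?i2 ?d1 ?d2.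
  by move=> c; have [P [R [_ ->]]] := gx c; apply: (subfM sub) => //; apply: (subfV sub).
pose C' := DiffField hD hM.
exists C', i, q1, q2; split.
- by move=> c; case: (eD c).
- by move=> c; case: (eD c).
- exact: (frac_gen_sep ch1 ng s1 gx i1 x1).
- exact: (frac_gen_sep ch2 nu s2 gx i2 x2).
by split=> //; exists x.
Qed.

(** * Amalgamation in iterated ultraproducts *)

Lemma rmorph_exists (R S : nzRingType) (f : R -> S) :
  {morph f : x y / x + y} -> {morph f : x y / x * y} -> f 1 = 1 ->
  exists g : {rmorphism R -> S}, g =1 f.
Proof.
move=> fD fM f1.
have f0 : f 0 = 0 by apply: (addrI (f 0)); rewrite -fD !addr0.
have fN x : f (- x) = - f x by apply: (addrI (f x)); rewrite -fD !subrr.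
have hB : zmod_morphism f by move=> x y; rewrite fD fN.
have hM : monoid_morphism f by [].
pose fA := GRing.isZmodMorphism.Build R S f hB.
pose fMm := GRing.isMonoidMorphism.Build R S f hM.
pose F : {rmorphism R -> S} := HB.pack f fA fMm.
by exists F.
Qed.

Lemma cone_ultrafilter (T : eqType) :
  exists V : ultrafilter (seq T), forall A : seq T, V (fun X => {subset A <= X}).
Proof.
have := @ultrafilter_exists (seq T) (seq T) (fun A X => {subset A <= X}) nil.
apply=> [A|A B].
  by exists A.
by exists (A ++ B) => X h; split=> x hx; apply: h; rewrite mem_cat hx ?orbT.
Qed.

Lemma upi_rmorph (I : Type) (U : ultrafilter I) (K : fieldType) (N : I -> fieldType)
    (e : forall i, {rmorphism K -> N i}) :
  exists g : {rmorphism K -> UP U N}, forall x, g x = upi (fun i => e i x).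
Proof.
apply: rmorph_exists => [x y|x y|].
- by rewrite -[RHS]rmorphD; congr upi; apply: uprodP => i; rewrite rmorphD.
- by rewrite -[RHS]rmorphM; congr upi; apply: uprodP => i; rewrite rmorphM.
by rewrite -[RHS](rmorph1 (@upi I U N)); congr upi; apply: uprodP => i; rewrite rmorph1.
Qed.

Section Imperfection.
Variables (p : nat) (K : diffField).
Hypothesis chK : p \in [pchar K].

(** Unlike the failure of every finite degree, this form passes to ultraproducts one [n] at a
    time. *)
Definition pinfinite : Prop := forall n, exists y : 'I_n -> K,
  (forall t, is_constant (y t)) /\ pind p setT y.

(** If there were more rows [w t] than columns, the rows would satisfy a linear relation, and the
    p-th powers of its coefficients would give a relation between the [y t]. *)
Lemma pind_card n m (y : 'I_n -> K) (x : 'I_m -> K) (w : 'I_n -> 'I_m -> K) :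
  pind p setT y -> (forall t, y t = \sum_s w t s ^+ p * x s) -> (n <= m)%N.
Proof.
move=> indy hy; rewrite leqNgt; apply/negP => mn.
pose W := \matrix_(t < n, s < m) w t s.
have : kermx W != 0.
  by rewrite kermx_eq0 /row_free; apply: contraL mn => /eqP <-; rewrite -leqNgt rank_leq_col.
rewrite -nz_row_eq0; set v := nz_row _ => v0.
have /sub_kermxP vW : (v <= kermx W)%MS by apply: nz_row_sub.
case/eqP: v0; apply/rowP => t; rewrite mxE.
apply: (indy (v ord0)) => //; rewrite big_setT.
under eq_bigr => s _ do rewrite hy mulr_sumr.
rewrite exchange_big /= big1 // => s _.
under eq_bigr => r _ do rewrite mulrA -exprMn.
rewrite -mulr_suml -(pcharP_sum chK).
have -> : \sum_i v ord0 i * w i s = (v *m W) ord0 s.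
  by rewrite mxE; apply: eq_bigr => i _; rewrite mxE.
by rewrite vW mxE expr0n eqn0Ngt (prime_gt0 (pcharf_prime chK)) mul0r.
Qed.

Lemma imperfection_pinfinite : imperfection_infinite p K -> pinfinite.
Proof.
move=> inf; elim=> [|n [y [cy indy]]].
  by exists (fun=> 0); split=> [[]|c _ []].
apply: contrapT => nex; apply: (inf n); exists y; split=> //.
  by apply/(lin_indep_pind chK).
move=> x cx; pose y' (t : 'I_n.+1) := if unlift ord_max t is Some s then y s else x.
have /existsNP[c /not_implyP[cs nc]] : ~ pind p setT y'.
  by move=> h; apply: nex; exists y'; split=> // t; rewrite /y'; case: unlift.
move: cs; rewrite big_setT big_ord_recr /= {2}/y' unlift_none => cs.
have widen (t : 'I_n) : y' (widen_ord (leqnSn n) t) = y t.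
  rewrite /y'; have -> : widen_ord (leqnSn n) t = lift ord_max t.
    by apply: val_inj; rewrite /= /bump leqNgt ltn_ord.
  by rewrite liftK.
have c0 : c ord_max != 0.
  apply/eqP => cm; apply: nc; rewrite cm expr0n eqn0Ngt (prime_gt0 (pcharf_prime chK)) mul0r addr0 in cs.
  have h := indy (fun t => c (widen_ord (leqnSn n) t)).
  move=> t _; have [->|tm] := eqVneq t ord_max; first by [].
  have tn : (t < n)%N by rewrite ltn_neqAle -ltnS ltn_ord andbT; apply: contra tm => /eqP e;
    apply/eqP/val_inj.
  have -> : t = widen_ord (leqnSn n) (Ordinal tn) by apply: val_inj.
  by apply: h; rewrite ?inE // big_setT -[RHS]cs; apply: eq_bigr => s _; rewrite widen.
exists (fun t => (- (c (widen_ord (leqnSn n) t) / c ord_max)) ^+ p).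
  by move=> t; eexists.
apply: (mulfI (expf_neq0 p c0)).
move/eqP: cs; rewrite addrC addr_eq0 => /eqP ->; rewrite -sumrN mulr_sumr.
apply: eq_bigr => t _; rewrite widen mulrA -exprMn mulrN mulrCA divff // mulr1.
by rewrite (pcharP_opp chK) mulNr.
Qed.

Lemma pinfinite_new (X : seq K) : pinfinite ->
  exists2 u : K, is_constant u & forall w : 'I_(size X) -> K, u <> \sum_i w i ^+ p * X`_i.
Proof.
move=> inf; have [y [cy indy]] := inf (size X).+1.
apply: contrapT => h.
have /choice[w hw] : forall t, exists w : 'I_(size X) -> K, y t = \sum_i w i ^+ p * X`_i.
  move=> t; apply: contrapT => h'; apply: h; exists (y t) => // w e; apply: h'; by exists w.
by have := pind_card (x := fun i : 'I_(size X) => X`_i) indy hw; rewrite ltnn.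
Qed.

End Imperfection.

Lemma UPdiff_pind (p : nat) (I : Type) (U : ultrafilter I) (N : I -> diffField)
    (T : finType) (A : {set T}) (y : T -> forall i, N i) :
  pind p A (fun t => upi (y t) : UPdiff U N) <-> U (fun i => pind p A (fun t => y t i)).
Proof. exact: (@upi_pind p I U (fun i => N i) T A y). Qed.

(* Iterated ultraproducts, all of whose factors are elementary extensions of K. *)
Inductive Ext (K : diffField) : forall N : diffField, (K -> N) -> Prop :=
| Ext_refl : @Ext K K id
| Ext_up (I : Type) (U : ultrafilter I) (N : I -> diffField) (e : forall i, K -> N i) :
    (forall i, Ext (e i)) -> @Ext K (UPdiff U N) (fun x => upi (fun i => e i x)).

Section Ext.
Variables (p : nat) (K : diffField).
Hypothesis chK : p \in [pchar K].

Lemma Ext_rmorph (N : diffField) (e : K -> N) : Ext e ->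
  exists2 g : {rmorphism K -> N}, Ext g & g =1 e.
Proof.
move=> h; suff [g hg] : exists g : {rmorphism K -> N}, g =1 e.
  by exists g => //; have -> : GRing.RMorphism.sort g = e by apply/funext.
elim: {N e} h => [|I U N e _ IH]; first by exists (idfun : {rmorphism K -> K}).
have /dchoice[g hg] := IH; have [f hf] := upi_rmorph U g.
by exists f => x; rewrite hf; congr upi; apply: uprodP => i; rewrite hg.
Qed.

Lemma Ext_comp (N N' : diffField) (e : K -> N) (e' : N -> N') :
  Ext e -> Ext e' -> Ext (e' \o e).
Proof.
move=> he h; elim: {N' e'} h => [//|I U N' e' _ IH].
exact: (@Ext_up K I U N' (fun i => e' i \o e)).
Qed.

Lemma Ext_diff (N : diffField) (e : K -> N) : Ext e -> diff_emb e.
Proof.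
elim=> {N e} [x //|I U N e _ IH x]; rewrite UPdiffE; congr upi.
by apply: uprodP => i; apply: IH.
Qed.

Lemma Ext_pchar (N : diffField) (e : K -> N) : Ext e -> p \in [pchar N].
Proof. by move/Ext_rmorph => [g _ _]; rewrite (fmorph_pchar g). Qed.

Lemma Ext_sep (N : diffField) (e : K -> N) : Ext e -> sep p e.
Proof.
elim=> {N e} [T A g //|I U N e he IH T A g hg].
by apply/(UPdiff_pind p U A (fun t i => e i (g t))); apply: large_true => i; apply: IH.
Qed.

Lemma Ext_closed (N : diffField) (e : K -> N) : Ext e -> sem_closed p K -> sem_closed p N.
Proof.
move=> h hK; elim: {N e} h => [//|I U N e he IH].
by apply: sem_closed_ultra => // i; apply: Ext_pchar (he i).
Qed.

Lemma UPdiff_pinfinite (I : Type) (U : ultrafilter I) (N : I -> diffField) :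
  (forall i, pinfinite p (N i)) -> pinfinite p (UPdiff U N).
Proof.
move=> inf n; have /dchoice[y hy] := fun i => inf i n.
exists (fun t => upi (fun i => y i t)); split.
  move=> t; rewrite /is_constant UPdiffE; apply/upi_eq0; apply: large_true => i.
  by case: (hy i) => h _; apply: h.
by apply/(UPdiff_pind p U setT (fun t i => y i t)); apply: large_true => i; case: (hy i).
Qed.

Lemma Ext_pinfinite (N : diffField) (e : K -> N) : Ext e -> pinfinite p K -> pinfinite p N.
Proof.
move=> h hK; elim: {N e} h => [//|I U N e he IH].
exact: UPdiff_pinfinite.
Qed.

(** For each finite [X] in [K] take a constant outside its [K^p]-span. The class of these constants
    escapes the p-span of [K], since finitely many elements of [K] lie in almost all [X]. *)
Lemma Ext_new_constant : pinfinite p K ->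
  exists (N : diffField) (e : {rmorphism K -> N}) (u : N),
    [/\ Ext e, is_constant u & ~ pspan p e u].
Proof.
move=> inf; have [V hV] := cone_ultrafilter K.
have /choice[u hu] : forall X : seq K, exists u : K, is_constant u /\
    forall w : 'I_(size X) -> K, u <> \sum_i w i ^+ p * X`_i.
  by move=> X; have [u cu hu] := pinfinite_new chK X inf; exists u.
have [e he eE] := Ext_rmorph (@Ext_up K _ V (fun=> K) (fun=> id) (fun=> Ext_refl K)).
exists (UPdiff V (fun=> K)), e, (upi u); split=> //.
  by rewrite /is_constant UPdiffE; apply/upi_eq0; apply: large_true => X; case: (hu X).
move=> [T [z [c hz]]].
pose f t := urep (z t).
have : @upi _ V (fun=> K) u = upi (fun X => \sum_t f t X ^+ p * c t).
  rewrite [LHS]hz -(upi_psum p _ predT f (fun t => fun=> c t)); apply: eq_bigr => t _.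
  by rewrite eE urepK.
move/upi_eq => h; have [X [eX sX]] := large_ex (largeI h (hV [seq c t | t <- enum T])).
(* Several [t] may name the same element of [X], so the roots of their coefficients are added. *)
case: (hu X) => _ /(_ (fun i => \sum_(t | index (c t) X == i) f t X)); apply.
have ci t : (index (c t) X < size X)%N by rewrite index_mem sX // map_f // mem_enum.
rewrite eX (partition_big (fun t => Ordinal (ci t)) xpredT) //=; apply: eq_bigr => i _.
rewrite (pcharP_sum chK) mulr_suml; apply: eq_big => [t|t /eqP <-]; first by rewrite -val_eqE.
by rewrite nth_index // sX // map_f // mem_enum.
Qed.

End Ext.

Lemma pmorph_limit (L : diffField) (V : ultrafilter (seq L)) (N : seq L -> diffField)
    (t : forall X, L -> N X) :
  (forall A : seq L, V (fun X => {subset A <= X})) -> (forall X, pmorph X (t X)) ->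
  exists j : {rmorphism L -> UPdiff V N}, diff_emb j /\ forall x, j x = upi (fun X => t X x).
Proof.
move=> hV ht; pose f x : UPdiff V N := upi (fun X => t X x).
have pf A : pmorph A f.
  apply: pmorph_ultra; apply: largeS (hV A) _ => X sA; have [a1 a2 a3 a4] := ht X.
  by split=> *; [apply: a1 | apply: a2 | apply: a3 | apply: a4]; apply: sA.
have fD x y : f (x + y) = f x + f y.
  by case: (pf [:: x; y; x + y]) => h _ _ _; apply: h; rewrite !inE eqxx ?orbT.
have fM x y : f (x * y) = f x * f y.
  by case: (pf [:: x; y; x * y]) => _ h _ _; apply: h; rewrite !inE eqxx ?orbT.
have f1 : f 1 = 1 by case: (pf [:: 1]) => _ _ h _; apply: h; rewrite inE.
have [j jE] := rmorph_exists fD fM f1; exists j; split=> x; rewrite !jE //.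
by case: (pf [:: x; der x]) => _ _ _ h; apply: h; rewrite !inE eqxx ?orbT.
Qed.

Section Amalgam.
Variables (p : nat).

(** Spreading over the one-point ultrafilter maps each finite part of [K1] to an ultrapower of [K2]
    over [C], and an ultraproduct over all finite parts glues these maps. Separability of [j] is a
    separate matter, settled in [amalgamation]. *)
Lemma amalgam_morphism (C K1 K2 : diffField) (j1 : {rmorphism C -> K1}) (j2 : {rmorphism C -> K2}) :
  p \in [pchar K2] -> sem_closed p K2 -> diff_emb j1 -> sep p j1 -> diff_emb j2 ->
  exists (N : diffField) (e : {rmorphism K2 -> N}) (j : {rmorphism K1 -> N}),
    [/\ Ext e, diff_emb j & forall c, j (j1 c) = e (j2 c)].
Proof.
move=> ch2 cl2 d1 s1 d2; have [V hV] := cone_ultrafilter K1.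
have [h hE] := upi_rmorph ultra_unit (fun _ : unit => j2).
have dh x : h (der x) = UPder (h x).
  by rewrite !hE -[RHS]/(@der (UPdiff ultra_unit (fun=> K2)) _) UPdiffE; congr upi;
    apply: uprodP => i; apply: d2.
have /choice[t ht] X : exists t : K1 -> UPdiff ultra_unit (fun=> K2),
    pmorph X t /\ forall x, j1 x \in X -> t (j1 x) = h x.
  exact: (@spread_pmorph p unit ultra_unit (fun=> K2) C K1 h j1 (fun=> ch2) dh d1 s1 (fun=> cl2) X).
have [j [dj jE]] := @pmorph_limit K1 V (fun=> UPdiff ultra_unit (fun=> K2)) t hV (fun X => (ht X).1).
have he := @Ext_up K2 _ V _ _ (fun _ : seq K1 => @Ext_up K2 _ ultra_unit (fun=> K2) _ (fun=> Ext_refl K2)).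
have [e ee eE] := Ext_rmorph he.
exists (UPdiff V (fun=> UPdiff ultra_unit (fun=> K2))), e, j; split=> // c.
rewrite jE eE; apply/upi_eq; apply: largeS (hV [:: j1 c]) _ => X sX.
by case: (ht X) => _ ->; rewrite ?hE // sX // inE.
Qed.

Definition covers (C K : diffField) (j : {rmorphism C -> K}) (A : seq K) : Prop :=
  forall a, a \in A -> is_constant a -> pspan p j a.

(** Constants of [A] outside [K1^p(C)] could become p-dependent in an amalgam. Each is adjoined to
    [C] and matched with a new constant in an extension of [K2]. *)
Lemma cover_exists (C K1 K2 : diffField) (j1 : {rmorphism C -> K1}) (j2 : {rmorphism C -> K2})
    (A : seq K1) :
  p \in [pchar K1] -> p \in [pchar K2] -> diff_emb j1 -> sep p j1 -> diff_emb j2 -> sep p j2 ->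
  pinfinite p K2 ->
  exists (C' N : diffField) (i : {rmorphism C -> C'}) (q1 : {rmorphism C' -> K1})
    (e : {rmorphism K2 -> N}) (q2 : {rmorphism C' -> N}),
    [/\ Ext e, diff_emb q1, diff_emb q2, sep p q1 & sep p q2] /\
    [/\ forall c, q1 (i c) = j1 c, forall c, q2 (i c) = e (j2 c) & covers q1 A].
Proof.
move=> ch1 ch2 d1 s1 d2 s2 inf;
  elim: A => [|g A [C' [N [i [q1 [e [q2 [[he dq1 dq2 sq1 sq2] [i1 i2 cov]]]]]]]]].
  exists C, K2, (idfun : {rmorphism C -> C}), j1, (idfun : {rmorphism K2 -> K2}), j2.
  by split; split=> //; apply: Ext_refl.
have [h|/not_implyP[cg ng]] := pselect (is_constant g -> pspan p q1 g).
  exists C', N, i, q1, e, q2; split=> //; split=> // a; rewrite inE => /orP[/eqP -> //|]; exact: cov.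
have chN := Ext_pchar ch2 he.
have [N' [e' [u [he' cu nu]]]] := Ext_new_constant chN (Ext_pinfinite he inf).
have chN' := Ext_pchar chN he'.
have dq2' : diff_emb (e' \o q2 : {rmorphism C' -> N'}).
  by move=> c; rewrite /= dq2; apply: (Ext_diff he').
have sq2' : sep p (e' \o q2 : {rmorphism C' -> N'}) by apply: sep_comp sq2 (@Ext_sep p _ _ _ he').
have nu' : ~ pspan p (e' \o q2 : {rmorphism C' -> N'}) u.
  by move=> [T [z [c eu]]]; apply: nu; exists T, z, (q2 \o c).
have [C2 [i' [r1 [r2 [dr1 dr2 sr1 sr2 [i1' i2' [x xg]]]]]]] :=
  adjoin_constant ch1 chN' dq1 dq2' sq1 sq2' cg cu ng nu'.
exists C2, N', (i' \o i : {rmorphism C -> C2}), r1, (e' \o e : {rmorphism K2 -> N'}), r2.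
split; first by split=> //; apply: Ext_comp.
split=> [c|c|a] /=; first by rewrite i1' i1.
  by rewrite i2' /= i2.
rewrite inE => /orP[/eqP -> _|aA ca]; first by rewrite -xg; apply: pspan_base.
have [T [z [c ->]]] := cov a aA ca; exists T, z, (i' \o c).
by apply: eq_bigr => t _; rewrite /= i1'.
Qed.

(** By [sep_const] only the constants of [K1] matter, and [pspan_pind] settles those in [K1^p(C)].
    These are all constants in the first case; in the second each finite [A] is covered separately,
    and an ultraproduct over all [A] serves every finite family at once. *)
Theorem amalgamation (C K1 K2 : diffField) (j1 : {rmorphism C -> K1}) (j2 : {rmorphism C -> K2}) :
  p \in [pchar K1] -> p \in [pchar K2] -> sem_closed p K2 ->
  diff_emb j1 -> sep p j1 -> diff_emb j2 -> sep p j2 ->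
  (forall x, is_constant x -> pspan p j1 x) \/ pinfinite p K2 ->
  exists (N : diffField) (e : {rmorphism K2 -> N}) (j : {rmorphism K1 -> N}),
    [/\ Ext e, diff_emb j, sep p j & forall c, j (j1 c) = e (j2 c)].
Proof.
move=> ch1 ch2 cl2 d1 s1 d2 s2 [cov|inf].
  have [N [e [j [he dj jj]]]] := amalgam_morphism ch2 cl2 d1 s1 d2.
  exists N, e, j; split=> //; apply: (sep_const dj ch1) => T A g cg.
  apply: (@pspan_pind p C K1 j1 ch1 N j (e \o j2 : {rmorphism C -> N})) => //.
    exact: sep_comp s2 (@Ext_sep p _ _ _ he).
  by move=> t; apply: cov.
have [V hV] := cone_ultrafilter K1.
have /dchoice[N hN] : forall A : seq K1, exists (N : diffField),
  exists (e : {rmorphism K2 -> N}) (j : {rmorphism K1 -> N}),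
  [/\ Ext e, diff_emb j, forall c, j (j1 c) = e (j2 c) &
   forall (T : finType) (B : {set T}) (g : T -> K1), (forall t, g t \in A) ->
     (forall t, is_constant (g t)) -> pind p B g -> pind p B (j \o g)].
  move=> A.
  have [C' [N [i [q1 [e [q2 [[he dq1 dq2 sq1 sq2] [i1 i2 cov]]]]]]]] :=
    cover_exists A ch1 ch2 d1 s1 d2 s2 inf.
  have chN := Ext_pchar ch2 he; have clN := Ext_closed ch2 he cl2.
  have [N' [e' [j [he' dj jj]]]] := amalgam_morphism chN clN dq1 sq1 dq2.
  exists N', (e' \o e : {rmorphism K2 -> N'}), j; split=> // [|c|T B g gA gc].
  - exact: Ext_comp.
  - by rewrite -i1 jj i2.
  apply: (@pspan_pind p C' K1 q1 ch1 N' j (e' \o q2 : {rmorphism C' -> N'})) => //.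
    exact: sep_comp sq2 (@Ext_sep p _ _ _ he').
  by move=> t; apply: cov.
have /dchoice[e /dchoice[j hj]] := hN.
have [e' he' e'E] := Ext_rmorph (@Ext_up K2 _ V N (fun A => e A) (fun A => let: And4 h _ _ _ := hj A in h)).
have [j' j'E] := upi_rmorph V j.
have dj' : diff_emb (j' : {rmorphism K1 -> UPdiff V N}).
  move=> x; rewrite !j'E UPdiffE; congr upi; apply: uprodP => A.
  by case: (hj A) => _ h _ _; apply: h.
exists (UPdiff V N), e', j'; split=> //.
  apply: (sep_const dj' ch1) => T B g cg indg.
  have -> : j' \o g = fun t => upi (fun A => j A (g t)) by apply/funext => t; apply: j'E.
  apply/(UPdiff_pind p V B (fun t A => j A (g t))); apply: largeS (hV [seq g t | t <- enum T]) _ => A sA.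
  by case: (hj A) => _ _ _ h; apply: h => // t; apply: sA; rewrite map_f // mem_enum.
move=> c; rewrite j'E e'E; congr upi; apply: uprodP => A.
by case: (hj A) => _ _ h _; apply: h.
Qed.

End Amalgam.

(** * Quantifier elimination *)

Section Los.
Variable L : signature.

Definition interpretation (K : Type) := forall f : Defs.fsym L, (K ^ arity f)%type -> K.

Definition interp_hom (C K : Type) (JC : interpretation C) (J : interpretation K) (j : C -> K) : Prop :=
  forall f v, j (JC f v) = J f [ffun k => j (v k)].

Lemma eval_hom (C K : Type) (JC : interpretation C) (J : interpretation K) (j : C -> K) n
    (c : (C ^ n)%type) (t : term L n) : interp_hom JC J j ->
  @eval L (Structure J) n [ffun k => j (c k)] t = j (@eval L (Structure JC) n c t).
Proof.
move=> hj; elim: t => [k|f ts IH]; first by rewrite /= ffunE.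
by rewrite /= hj; congr J; apply/ffunP => k; rewrite !ffunE IH.
Qed.

Variables (I : Type) (U : ultrafilter I) (N : I -> diffField) (J : forall i, interpretation (N i)).

Definition UPinterp : interpretation (UPdiff U N) :=
  fun f v => upi (fun i => @J i f [ffun k => urep (v k) i]).

Lemma UPinterpE (f : Defs.fsym L) (w : 'I_(arity f) -> forall i, N i) :
  UPinterp [ffun k => upi (w k)] = upi (fun i => @J i f [ffun k => w k i]).
Proof.
apply/upi_eq.
have h : U (fun i => forall k, urep (upi (w k) : UP U N) i = w k i).
  by apply: large_fin => k; apply: urep_pi.
by apply: largeS h _ => i hi; congr J; apply/ffunP => k; rewrite !ffunE.
Qed.

Lemma UP_eval n (w : 'I_n -> forall i, N i) (t : term L n) :
  @eval L (Structure UPinterp) n [ffun k => upi (w k)] t =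
  upi (fun i => @eval L (Structure (@J i)) n [ffun k => w k i] t).
Proof.
elim: t => [k|f ts IH].
  by rewrite /= ffunE; congr upi; apply: uprodP => i; rewrite ffunE.
rewrite /=;
  transitivity (UPinterp (f := f) [ffun k => upi (fun i => @eval L (Structure (@J i)) n [ffun k => w k i] (ts k))]).
  by congr UPinterp; apply/ffunP => k; rewrite !ffunE.
by rewrite UPinterpE.
Qed.

Lemma UP_sat n (phi : formula L n) (w : 'I_n -> forall i, N i) :
  @sat L (Structure UPinterp) n phi [ffun k => upi (w k)] <->
  U (fun i => @sat L (Structure (@J i)) n phi [ffun k => w k i]).
Proof.
elim: phi w => {n} [n t u|n phi IH|n phi IH psi IH'|n phi IH] w /=.
- by rewrite !UP_eval; apply: upi_eq.
- by rewrite IH; apply: iff_sym; apply: largeN.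
- rewrite IH IH'; split=> [[h1 h2]|h]; first exact: largeI.
  by split; apply: largeS h _ => i [].
have rE (g : forall i, N i) : rcons_ffun [ffun k => upi (w k)] (upi g : UPdiff U N) =
    [ffun k => upi (fun i => if unlift ord_max k is Some j then w j i else g i)].
  by apply/ffunP => k; rewrite !ffunE; case: unlift => [j|] //; rewrite ffunE.
have rE' (g : forall i, N i) i : rcons_ffun [ffun k => w k i] (g i) =
    [ffun k => if unlift ord_max k is Some j then w j i else g i].
  by apply/ffunP => k; rewrite !ffunE; case: unlift => [j|] //; rewrite ffunE.
split=> [[x]|h].
  rewrite -(urepK x) rE IH => h; apply: largeS h _ => i h; exists (urep x i).
  by rewrite rE'.
have /dchoice[g hg] : forall i, exists x : N i,
    (exists x, @sat L (Structure (@J i)) n.+1 phi (rcons_ffun [ffun k => w k i] x)) ->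
    @sat L (Structure (@J i)) n.+1 phi (rcons_ffun [ffun k => w k i] x).
  move=> i; have [[x hx]|nx] := pselect (exists x,
    @sat L (Structure (@J i)) n.+1 phi (rcons_ffun [ffun k => w k i] x)); first by exists x.
  by exists 0.
exists (upi g); rewrite rE IH; apply: largeS h _ => i /hg; by rewrite rE'.
Qed.

End Los.
Arguments UPinterp {L I} U {N} J f v.

(** What the argument asks of either language. [good_base] says that common separable differential
    subfields containing the named constants are common substructures; [good_cover] is the dichotomy
    in [amalgamation]. *)
Record good_class (L : signature) (p : nat) (mem : forall K : diffField, interpretation L K -> Prop) : Prop :=
  GoodClass {
  good_char : forall (K : diffField) (J : interpretation L K), mem K J -> p \in [pchar K];
  good_closed : forall (K : diffField) (J : interpretation L K), mem K J -> sem_closed p K;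
  good_ultra : forall (I : Type) (U : ultrafilter I) (N : I -> diffField) (J : forall i,
    interpretation L (N i)),
    (forall i, mem (N i) (J i)) -> mem (UPdiff U N) (UPinterp U J);
  good_base : forall (C K1 K2 : diffField) (J1 : interpretation L K1) (J2 : interpretation L K2)
      (j1 : {rmorphism C -> K1}) (j2 : {rmorphism C -> K2}),
    mem K1 J1 -> mem K2 J2 -> diff_emb j1 -> diff_emb j2 -> sep p j1 -> sep p j2 ->
    (forall f, arity f = 0%N -> forall v1 v2, exists2 c, j1 c = J1 f v1 & j2 c = J2 f v2) ->
    exists JC : interpretation L C, interp_hom JC J1 j1 /\ interp_hom JC J2 j2;
  good_cover : forall (C K1 K2 : diffField) (JC : interpretation L C) (J1 : interpretation L K1)
      (J2 : interpretation L K2) (j1 : {rmorphism C -> K1}),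
    mem K1 J1 -> mem K2 J2 -> interp_hom JC J1 j1 ->
    (forall x, is_constant x -> pspan p j1 x) \/ pinfinite p K2 }.

Lemma ffun0_eq (T : Type) n (v w : (T ^ n)%type) : n = 0%N -> v = w.
Proof. by move=> n0; apply/ffunP => -[k kn]; exfalso; rewrite n0 in kn. Qed.

Section GoodClass.
Variables (L : signature) (p : nat) (mem : forall K : diffField, interpretation L K -> Prop).
Hypothesis good : good_class p mem.

Lemma Ext_interp (K N : diffField) (e : K -> N) (J : interpretation L K) : Ext e -> mem J ->
  exists JN : interpretation L N, [/\ mem JN, interp_hom J JN e &
    forall n (phi : formula L n) (c : (K ^ n)%type),
      @sat L (Structure JN) n phi [ffun k => e (c k)] <-> @sat L (Structure J) n phi c].
Proof.
move=> h hJ; elim: {N e} h => [|I U N e _ IH].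
  exists J; split=> // [f v|n phi c]; first by congr J; apply/ffunP => k; rewrite ffunE.
  by have -> : [ffun k => id (c k)] = c by apply/ffunP => k; rewrite ffunE.
have /dchoice[JN hJN] := IH; exists (UPinterp U JN); split.
- by apply: (good_ultra good) => i; case: (hJN i).
- move=> f v.
  rewrite (UPinterpE U JN (fun k i => e i (v k))); congr upi; apply: uprodP => i.
  by case: (hJN i) => _ hh _; apply: hh.
move=> n phi c; rewrite (UP_sat U JN phi (fun k i => e i (c k))); split=> [h|h].
  by have [i hi] := large_ex h; case: (hJN i) => _ _ <-.
by apply: large_true => i; case: (hJN i) => _ _ ->.
Qed.

(** Both sides are quantified inside the induction, which handles negation by exchanging them. A
    witness in [K1] is carried by an amalgam to an elementary extension of [K2], where the induction
    hypothesis applies with [K1] itself as common subfield. *)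
Lemma interp_quantifier_elim n (phi : formula L n) :
  forall (C K1 K2 : diffField) (JC : interpretation L C) (J1 : interpretation L K1)
    (J2 : interpretation L K2) (j1 : {rmorphism C -> K1}) (j2 : {rmorphism C -> K2}),
  mem J1 -> mem J2 -> diff_emb j1 -> diff_emb j2 -> sep p j1 -> sep p j2 ->
  interp_hom JC J1 j1 -> interp_hom JC J2 j2 ->
  forall c : (C ^ n)%type, @sat L (Structure J1) n phi [ffun k => j1 (c k)] ->
    @sat L (Structure J2) n phi [ffun k => j2 (c k)].
Proof.
elim: phi => {n} [n t u|n phi IH|n phi IH psi IH'|n phi IH] C K1 K2 JC J1 J2 j1 j2
  m1 m2 d1 d2 s1 s2 h1 h2 c /=.
- rewrite !(eval_hom _ _ h1) !(eval_hom _ _ h2); by move/(@fmorph_inj _ _ j1) => ->.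
- by move=> h h'; apply: h; apply: IH h'; eassumption.
- by move=> [hp hq]; split; [apply: IH hp | apply: IH' hq]; eassumption.
move=> [x hx].
have [N [e [j [he dj sj jj]]]] := amalgamation (good_char good m1) (good_char good m2)
  (good_closed good m2) d1 s1 d2 s2 (good_cover good m1 m2 h1).
have [JN [mN eN elN]] := Ext_interp he m2.
(* The amalgam is built for the differential field structure only. That [j] respects the other
   symbols follows from [good_base] with [K1] as common subfield, the named constants coming from
   [C]. *)
have hj : interp_hom J1 JN j.
  have [||||f f0 v1 v2|JK [k1 k2]] := @good_base L p mem good K1 K1 N J1 JN (idfun :
    {rmorphism K1 -> K1}) j m1 mN.
  - by [].
  - exact: dj.
  - by [].
  - exact: sj.
  - exists (J1 f v1) => //; have v0 : (C ^ arity f)%type := [ffun=> 0].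
    have -> : J1 f v1 = j1 (JC f v0) by rewrite h1; congr J1; apply: ffun0_eq.
    by rewrite jj h2 eN; congr JN; apply: ffun0_eq.
  move=> f v; rewrite -k2; congr (j _).
  by have /= -> := k1 f v; congr J1; apply/ffunP => k; rewrite ffunE.
apply/(elN _ (FEx phi)); exists (j x).
have hid : interp_hom J1 J1 (idfun : {rmorphism K1 -> K1}).
  by move=> f v; congr J1; apply/ffunP => k; rewrite ffunE.
have := IH K1 K1 N J1 J1 JN (idfun : {rmorphism K1 -> K1}) j m1 mN (fun=> erefl) dj
  (fun _ _ _ h => h) sj hid hj (rcons_ffun [ffun k => j1 (c k)] x).
have -> : [ffun k => idfun (rcons_ffun [ffun k => j1 (c k)] x k)] = rcons_ffun [ffun k => j1 (c k)] x.
  by apply/ffunP => k; rewrite ffunE.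
move=> /(_ hx); congr (sat _ _); apply/ffunP => k; rewrite !ffunE.
by case: unlift => [l|] //; rewrite !ffunE jj.
Qed.

End GoodClass.

(** * Exchanging the two factors of an iterated ultrapower *)

Section Swap.
Variables (p : nat) (M : diffField) (I : Type) (U : ultrafilter I).
Hypothesis chM : p \in [pchar M].

Local Notation M1 := (UPdiff U (fun=> M)).
Local Notation N := (UPdiff U (fun=> M1)).

Definition swap1 : {rmorphism M1 -> N} := UPmap (fun=> @diag I U M : {rmorphism M -> M1}).
Definition swap2 : {rmorphism M1 -> N} := @diag I U M1.

Lemma swap1E (w : I -> M) : swap1 (upi w) = upi (fun i => diag U (w i)).
Proof. exact: UPmapE. Qed.

Lemma swap2E y : swap2 y = upi (fun=> y). Proof. by []. Qed.

Lemma swap_diag m : swap1 (diag U m) = swap2 (diag U m).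
Proof. exact: swap1E. Qed.

Lemma ch_M1 : p \in [pchar M1]. Proof. by apply: UP_pchar. Qed.
Lemma ch_N : p \in [pchar N]. Proof. by apply: UP_pchar => _; apply: ch_M1. Qed.

Lemma diag_sep : sep p (@diag I U M).
Proof. by move=> T A g hg; apply/(upi_pind p A (fun t => fun=> g t)); apply: large_true. Qed.

Lemma swap1_diff : diff_emb swap1.
Proof.
elim/UP_ind => w; rewrite (UPdiffE (U := U) (K := fun=> M) w) !swap1E UPdiffE; congr upi.
by apply: uprodP => i; rewrite UPdiffE.
Qed.

Lemma swap2_diff : diff_emb swap2.
Proof. by move=> y; rewrite !swap2E UPdiffE. Qed.

(** At almost every index the relation becomes one between the fixed elements [w t], with the
    coordinates of the [x t] as coefficients in [M]. Expanding [w] over an [M]-independent family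
    gives equations over [M] that almost all these coordinates satisfy, hence the [x t] too. *)
Lemma swap_disjoint (T : finType) (B : {set T}) (x w : T -> M1) :
  (forall c : T -> M, \sum_(t in B) diag U (c t) * x t = 0 -> forall t, t \in B -> c t = 0) ->
  \sum_(t in B) swap1 (x t) * swap2 (w t) = 0 -> forall t, t \in B -> w t = 0.
Proof.
move=> indx e t tB; have [D indD [v hv]] := exists_max_indep_morph (@diag I U M) w.
rewrite hv big1 // => d dD; suff -> : v t d = 0 by rewrite rmorph0 mul0r.
apply: (indx (fun t => v t d)) => //.
pose f s := urep (x s); have xE s : x s = upi (f s) by rewrite urepK.
have h : U (fun i => \sum_(s in B) diag U (f s i) * w s = 0).
  have : @upi _ U (fun=> M1) (fun i => \sum_(s in B) diag U (f s i) * w s) = 0.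
    rewrite -[RHS]e -(upi_sum _ _ (fun s i => diag U (f s i) * w s)); apply: eq_bigr => s _.
    by rewrite [in RHS]xE swap1E swap2E; exact: rmorphM.
  by move/upi_eq0.
transitivity (@upi _ U (fun=> M) (fun i => \sum_(s in B) v s d * f s i)).
  rewrite -(upi_sum _ _ (fun s i => v s d * f s i)); apply: eq_bigr => s _.
  by rewrite xE; apply/esym/rmorphM.
apply/upi_eq0; apply: largeS h _ => i hi.
apply: (indD (fun d => \sum_(s in B) v s d * f s i)) => //.
rewrite -[RHS]hi; under [RHS]eq_bigr => s _ do rewrite [in X in _ * X](hv s) mulr_sumr.
rewrite [RHS]exchange_big /=; apply: eq_bigr => q _; rewrite rmorph_sum mulr_suml.
by apply: eq_bigr => s _; rewrite rmorphM mulrA [diag U (v s q) * _]mulrC.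
Qed.

(** Expanding [x] over an [M]-independent family turns the relation, by disjointness, into equations
    between the [y t] over [M]. There [swap1] and [swap2] agree, so the same equations imply the
    exchanged relation. *)
Lemma swap_zero (T : finType) (x y : T -> M1) :
  \sum_t swap1 (x t) * swap2 (y t) = 0 -> \sum_t swap2 (x t) * swap1 (y t) = 0.
Proof.
move=> e; have [B indB [u hu]] := exists_max_indep_morph (@diag I U M) x.
have h s : s \in B -> \sum_t diag U (u t s) * y t = 0.
  apply: (swap_disjoint indB (w := fun s => \sum_t diag U (u t s) * y t)).
  rewrite -[RHS]e; under [RHS]eq_bigr => t _ do rewrite [X in swap1 X](hu t) rmorph_sum mulr_suml.
  rewrite [RHS]exchange_big /=; apply: eq_bigr => q _; rewrite rmorph_sum mulr_sumr.
  apply: eq_bigr => t _; rewrite !rmorphM swap_diag.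
  by rewrite mulrA [swap1 (x q) * _]mulrC.
under eq_bigr => t _ do rewrite [X in swap2 X](hu t) rmorph_sum mulr_suml.
rewrite exchange_big big1 //= => s sB.
transitivity (swap2 (x s) * swap1 (\sum_t diag U (u t s) * y t)); last by rewrite h // rmorph0 mulr0.
rewrite rmorph_sum mulr_sumr; apply: eq_bigr => t _; rewrite !rmorphM -swap_diag.
by rewrite mulrA [swap2 (x s) * _]mulrC.
Qed.

(** The graph of the exchange of the two copies of [M1], on the subring that they generate. *)
Definition swap_sum (a b : N) : Prop := exists (T : finType) (x y : T -> M1),
  a = \sum_t swap1 (x t) * swap2 (y t) /\ b = \sum_t swap2 (x t) * swap1 (y t).

Lemma swap_sum_pair x y : swap_sum (swap1 x * swap2 y) (swap2 x * swap1 y).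
Proof. by exists unit, (fun=> x), (fun=> y); split; rewrite (big_pred1 tt). Qed.

Lemma swap_sum1 x : swap_sum (swap1 x) (swap2 x).
Proof. by have := swap_sum_pair x 1; rewrite !rmorph1 !mulr1. Qed.

Lemma swap_sum2 x : swap_sum (swap2 x) (swap1 x).
Proof. by have := swap_sum_pair 1 x; rewrite !rmorph1 !mul1r. Qed.

Lemma swap_sumD a b c d : swap_sum a b -> swap_sum c d -> swap_sum (a + c) (b + d).
Proof.
move=> [T [x [y [-> ->]]]] [T' [x' [y' [-> ->]]]].
exists (T + T')%type, (fun t => match t with inl t => x t | inr t => x' t end),
  (fun t => match t with inl t => y t | inr t => y' t end).
by rewrite !big_sumType.
Qed.

Lemma swap_sum_sum (T : Type) (r : seq T) (P : pred T) (a b : T -> N) :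
  (forall t, swap_sum (a t) (b t)) ->
  swap_sum (\sum_(t <- r | P t) a t) (\sum_(t <- r | P t) b t).
Proof.
move=> h; apply: (big_ind2 swap_sum) => //; first by have := swap_sum1 0; rewrite !rmorph0.
by move=> *; apply: swap_sumD.
Qed.

Lemma swap_sumM a b c d : swap_sum a b -> swap_sum c d -> swap_sum (a * c) (b * d).
Proof.
move=> [T [x [y [-> ->]]]] [T' [x' [y' [-> ->]]]].
rewrite !big_distrl; apply: swap_sum_sum => t; rewrite !big_distrr; apply: swap_sum_sum => t' /=.
by have := swap_sum_pair (x t * x' t') (y t * y' t'); rewrite !rmorphM; congr swap_sum; rewrite mulrACA.
Qed.

Lemma swap_sumB a b c d : swap_sum a b -> swap_sum c d -> swap_sum (a - c) (b - d).
Proof.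
move=> h h'; apply: swap_sumD => //.
rewrite -[- c]mulN1r -[- d]mulN1r; apply: swap_sumM => //.
by have := swap_sum1 (-1); rewrite !rmorphN !rmorph1.
Qed.

Lemma swap_sumC a b : swap_sum a b -> swap_sum b a.
Proof.
by move=> [T [x [y [-> ->]]]]; exists T, y, x; split; apply: eq_bigr => t _; rewrite mulrC.
Qed.

Lemma swap_sum0 a b : swap_sum a b -> a = 0 <-> b = 0.
Proof.
move=> h; have [T [x [y [ea eb]]]] := h; have [T' [x' [y' [ea' eb']]]] := swap_sumC h.
by split=> h0; [rewrite eb; apply: swap_zero; rewrite -ea | rewrite eb'; apply: swap_zero; rewrite -ea'].
Qed.

Lemma swap_sum_der a b : swap_sum a b -> swap_sum (der a) (der b).
Proof.
move=> [T [x [y [-> ->]]]]; rewrite !(der_sum (der_deriv N)); apply: swap_sum_sum => t.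
rewrite !derM -!swap1_diff -!swap2_diff; apply: swap_sumD; exact: swap_sum_pair.
Qed.

(** The spanning family has two layers. The second factors are expanded over elements independent
    over [M1^p(M)]; the elements of [M] in the coefficients move to the first factors, which are
    then expanded over a p-independent family. *)
Lemma swap_sep (Q : fieldType) (q : {rmorphism Q -> N}) :
  (forall x, exists c, q c = swap1 x) -> (forall x, exists c, q c = swap2 x) ->
  (forall c, exists a b, [/\ exists a', swap_sum (q a) a', exists b', swap_sum (q b) b',
     b != 0 & c = a / b]) -> sep p q.
Proof.
move=> q1 q2 hq; have p0 := prime_gt0 (pcharf_prime chM).
have chQ : p \in [pchar Q] by rewrite -(fmorph_pchar q); apply: ch_N.
apply: (sep_span chQ ch_N) => T g.
have /choice[b hb] : forall t, exists b, b != 0 /\ exists c, swap_sum (q (g t) * q b ^+ p) c.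
  move=> t; have [a [b [[a' ha] [b' hb] b0 ->]]] := hq (g t); exists b; split=> //.
  exists (a' * b' ^+ p.-1).
  have -> : q (a / b) * q b ^+ p = q a * q b ^+ p.-1.
    by rewrite -(prednK p0) exprS /= mulrA -rmorphM divfK.
  apply: swap_sumM => //; elim: (p.-1) => [|n IH]; last by rewrite !exprS; apply: swap_sumM.
  by rewrite !expr0; have := swap_sum1 1; rewrite !rmorph1.
exists b; first by move=> t; case: (hb t).
have /dchoice[X hX] : forall t, exists S : finType, exists x y : S -> M1,
    q (g t) * q (b t) ^+ p = \sum_s swap1 (x s) * swap2 (y s).
  by move=> t; case: (hb t) => _ [c [S [x [y [h _]]]]]; exists S, x, y.
have /dchoice[x /dchoice[y hxy]] := hX.
pose Y (k : {t & X t}) := y (tag k) (tagged k).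
have chM1 := ch_M1.
(* Independence over [M1^p] would be too weak: in the factors, the coefficients of the [Y l] will
   involve coordinates in [M] of the first factors. *)
have [D indD sD] := exists_max_indep (pspan_subfield (@diag I U M) chM1) Y.
have /choice[s hs] : forall k, exists s : {t & X t} -> M1,
    (forall l, pspan p (@diag I U M) (s l)) /\ Y k = \sum_(l in D) s l * Y l.
  by move=> k; have [s s1 s2] := sD k; exists s.
have /dchoice[Z hZ] : forall kl : {t & X t} * {t & X t}, exists S : finType,
    exists (z : S -> M1) (c : S -> M), s kl.1 kl.2 = \sum_m z m ^+ p * diag U (c m).
  by move=> [k l]; case: (hs k) => h _; apply: h.
have /dchoice[z /dchoice[c hc]] := hZ.
(* The factor from [M] may change sides because [swap1] and [swap2] agree on [M]. *)
pose xi (k : {kl : {t & X t} * {t & X t} & Z kl}) : M1 :=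
  x (tag (tag k).1) (tagged (tag k).1) * diag U (c (tag k) (tagged k)).
have [R indR [u hu]] := exists_max_pind chM1 xi.
pose W t (rl : {kl : {t & X t} * {t & X t} & Z kl} * {t & X t}) : N :=
  \sum_(k : X t) \sum_(m : Z (Tagged X k, rl.2))
    swap2 (z (Tagged X k, rl.2) m) * swap1 (u (Tagged Z m) rl.1).
have sub := im_subfield q.
have /choice[w qw] : forall t, exists w, forall rl, q (w rl) = W t rl.
  move=> t; suff /choice[w hw] : forall rl, exists c, W t rl = q c by exists w.
  move=> rl; apply: (subf_sum sub) => k _; apply: (subf_sum sub) => m _.
  have [a <-] := q2 (z (Tagged X k, rl.2) m); have [a' <-] := q1 (u (Tagged Z m) rl.1).
  by exists (a * a'); rewrite rmorphM.
pose h (rl : {kl : {t & X t} * {t & X t} & Z kl} * {t & X t}) : N := swap1 (xi rl.1) * swap2 (Y rl.2).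
exists _, [set rl | (rl.1 \in R) && (rl.2 \in D)], h, w.
have bE (F : {kl : {t & X t} * {t & X t} & Z kl} * {t & X t} -> N) :
    \sum_(y in [set rl | (rl.1 \in R) && (rl.2 \in D)]) F y = \sum_(r in R) \sum_(l in D) F (r, l).
  by rewrite pair_big /=; apply: eq_big => [[r l]|[r l] _] //=; rewrite inE.
split.
  move=> n; rewrite bE => e [r l]; rewrite inE /= => /andP[rR lD].
  pose f k := urep (n k); pose v k := urep (xi k).
  have hv : U (fun i => pind p R (fun k => v k i)).
    by apply/(upi_pind p R v); rewrite (_ : (fun t => _) = xi) //; apply/funext => k; apply: urepK.
  (* A relation in [N] becomes one in [M1] at almost every index. There [D] separates the [Y l],
     after which p-independence of the [v r i] in [M] and separability of the diagonal make the
     coefficients vanish. *)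
  have he : U (fun i => \sum_(l in D) (\sum_(r in R) f (r, l) i ^+ p * diag U (v r i)) * Y l = 0).
    have : @upi _ U (fun=> M1) (fun i => \sum_(l in D) (\sum_(r in R) f (r, l)
      i ^+ p * diag U (v r i)) * Y l) = 0.
      rewrite -[RHS]e exchange_big -(upi_sum _ _ (fun l i => (\sum_(r in R) f (r, l)
        i ^+ p * diag U (v r i)) * Y l)).
      apply: eq_bigr => l' _.
      transitivity (upi (fun i => \sum_(r in R) f (r, l') i ^+ p * (diag U (v r i) * Y l')) : N).
        congr upi; apply: uprodP => i; rewrite mulr_suml; apply: eq_bigr => r' _; by rewrite mulrA.
      rewrite -(upi_psum p _ _ (fun r => f (r, l')) (fun r i => diag U (v r i) * Y l')).
      apply: eq_bigr => r' _; have xiE : xi r' = upi (v r') by rewrite urepK.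
      rewrite urepK /h [(r', l').1]/= [(r', l').2]/= swap2E xiE swap1E; congr (_ * _).
      exact: rmorphM.
    by move/upi_eq0.
  rewrite -[n _]urepK; apply/upi_eq0; apply: largeS (largeI hv he) _ => i [vi ei].
  have hl : \sum_(r in R) f (r, l) i ^+ p * diag U (v r i) = 0.
    apply: (indD (fun l => \sum_(r in R) f (r, l) i ^+ p * diag U (v r i))) => // l'.
    apply: (subf_sum (pspan_subfield _ chM1)) => r' _.
    by apply: (subfM (pspan_subfield _ chM1)); [apply: pspan_Xp | apply: pspan_base].
  exact: (diag_sep vi (c := fun r => f (r, l) i)).
move=> t; rewrite bE hxy exchange_big /=.
transitivity (\sum_(l in D) \sum_(k : X t) \sum_(m : Z (Tagged X k, l))
    swap2 (z (Tagged X k, l) m) ^+ p * swap1 (xi (Tagged Z m)) * swap2 (Y l)).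
  rewrite exchange_big; apply: eq_bigr => k _ /=.
  rewrite -[y t k]/(Y (Tagged X k)); case: (hs (Tagged X k)) => _ {1}->.
  rewrite (rmorph_sum swap2) mulr_sumr; apply: eq_bigr => l _.
  rewrite (hc (Tagged X k, l)) mulr_suml (rmorph_sum swap2) mulr_sumr; apply: eq_bigr => m _.
  have -> : xi (Tagged Z m) = x t k * diag U (c (Tagged X k, l) m) by [].
  rewrite !(rmorphM swap2) (rmorphXn swap2) (rmorphM swap1) swap_diag.
  by rewrite !mulrA [swap1 (x t k) * _]mulrC.
apply: eq_bigr => l _.
pose G r (k : X t) (m : Z (Tagged X k, l)) : N :=
  (swap2 (z (Tagged X k, l) m) * swap1 (u (Tagged Z m) r)) ^+ p * h (r, l).
transitivity (\sum_(k : X t) \sum_(m : Z (Tagged X k, l)) \sum_(r in R) G r k m).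
  apply: eq_bigr => k _; apply: eq_bigr => m _; rewrite [X in swap1 X]hu (rmorph_sum swap1).
  rewrite mulr_sumr mulr_suml; apply: eq_bigr => r _.
  by rewrite (rmorphM swap1) (rmorphXn swap1) /G exprMn /h !mulrA.
transitivity (\sum_(r in R) \sum_(k : X t) \sum_(m : Z (Tagged X k, l)) G r k m).
  by rewrite [RHS]exchange_big; apply: eq_bigr => k _; rewrite [RHS]exchange_big.
apply: eq_bigr => r _; rewrite qw /W (pcharP_sum ch_N) mulr_suml.
by apply: eq_bigr => k _; rewrite (pcharP_sum ch_N) mulr_suml.
Qed.

End Swap.

Lemma cofinite_ultrafilter : exists U : ultrafilter nat, forall n, U (fun i => n <= i)%N.
Proof.
have := @ultrafilter_exists nat nat (fun n i => n <= i)%N 0%N.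
apply=> [n|j k]; first by exists n.
by exists (maxn j k) => i; rewrite geq_max => /andP.
Qed.

Lemma swap_field_exists (p : nat) (M : diffField) (I : Type) (U : ultrafilter I) :
  p \in [pchar M] ->
  exists (C : diffField) (q1 q2 : {rmorphism C -> UPdiff U (fun=> UPdiff U (fun=> M))}),
    [/\ diff_emb q1, diff_emb q2, sep p q1, sep p q2 &
        forall a b, swap_sum a b -> exists2 c, q1 c = a & q2 c = b].
Proof.
move=> chM; have [|||| Q [q1 [q2 [hQ fQ]]]] := @graph_field_exists _ _ (@swap_sum M I U).
- by have := swap_sum1 (1 : UPdiff U (fun=> M)); rewrite !rmorph1.
- by move=> x y z w; apply: swap_sumB.
- by move=> x y z w; apply: swap_sumM.
- by move=> x y; apply: swap_sum0.
have [|D [hD hM eD]] := @graph_der_exists Q _ _ q1 q2.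
  have sub := graph_der_subfield q1 q2.
  have key a : swap_sum (q1 a) (q2 a) -> exists c', graph_der q1 q2 a c'.
    by move=> /swap_sum_der/hQ[c' h1 h2]; exists c'.
  move=> c; have [a [b [ha hb b0 ->]]] := fQ c.
  by apply: (subfM sub); [apply: key | apply: (subfV sub); apply: key].
exists (DiffField hD hM), q1, q2; split=> // [c|c||].
- by case: (eD c).
- by case: (eD c).
- apply: (swap_sep chM).
  + by move=> x; have [c <- _] := hQ _ _ (swap_sum1 x); exists c.
  + by move=> x; have [c <- _] := hQ _ _ (swap_sum2 x); exists c.
  by move=> c; have [a [b [ha hb b0 ->]]] := fQ c; exists a, b; split=> //; eexists; eassumption.
apply: (swap_sep chM).
- by move=> x; have [c _ <-] := hQ _ _ (swap_sum2 x); exists c.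
- by move=> x; have [c _ <-] := hQ _ _ (swap_sum1 x); exists c.
move=> c; have [a [b [ha hb b0 ->]]] := fQ c; exists a, b.
by split=> //; eexists; apply: swap_sumC; eassumption.
Qed.

Theorem good_class_no_order (L : signature) (p : nat)
    (mem : forall K : diffField, interpretation L K -> Prop) (M : diffField)
    (J : interpretation L M) n m (phi : formula L (n + m))
    (a : nat -> (M ^ n)%type) (b : nat -> (M ^ m)%type) :
  good_class p mem -> mem M J ->
  ~ forall i j, @sat L (Structure J) _ phi (cat_ffun (a i) (b j)) <-> (i < j)%N.
Proof.
move=> good mM ord; have [U hU] := cofinite_ultrafilter; have chM := good_char good mM.
pose J1 := UPinterp U (fun=> J); pose JN := UPinterp U (fun _ : nat => J1).
have m1 : mem _ J1 by apply: (good_ultra good).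
have mN : mem _ JN by apply: (good_ultra good).
have [C [q1 [q2 [d1 d2 s1 s2 hC]]]] := swap_field_exists U chM.
have [|JC [h1 h2]] := good_base good mN mN d1 d2 s1 s2.
  move=> f f0 v1 v2; pose v0 : (M ^ arity f)%type := [ffun=> 0].
  have JNE v : JN f v = swap2 M U (diag U (J f v0)).
    apply/upi_eq; apply: large_true => i; apply/upi_eq; apply: large_true => j.
    by congr J; apply: ffun0_eq.
  have [c e1 e2] := hC _ _ (swap_sum2 (diag U (J f v0))).
  by exists c; rewrite JNE // e2 swap_diag.
pose al k : UPdiff U (fun=> M) := upi (fun i => a i k).
pose be k : UPdiff U (fun=> M) := upi (fun i => b i k).
have /choice[c hc] : forall k : 'I_(n + m), exists c : C,
    q1 c = match split k with inl k => swap1 M U (al k) | inr k => swap2 M U (be k) end /\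
    q2 c = match split k with inl k => swap2 M U (al k) | inr k => swap1 M U (be k) end.
  move=> k; case: split => [k'|k'].
    by have [c e1 e2] := hC _ _ (swap_sum1 (al k')); exists c.
  by have [c e1 e2] := hC _ _ (swap_sum2 (be k')); exists c.
(* Before the exchange the formula says that for almost all [i], almost all [j] satisfy [i < j],
   which is true. After it the inequality is [j < i], which fails for almost all [j]. *)
have := @interp_quantifier_elim L p mem good _ phi C _ _ JC JN JN q1 q2 mN mN d1 d2 s1 s2 h1 h2 (finfun c).
pose w1 k i : UPdiff U (fun=> M) := match split k with inl k => diag U (a i k) | inr k => be k end.
pose w2 k i : UPdiff U (fun=> M) := match split k with inl k => al k | inr k => diag U (b i k) end.
have -> : [ffun k => q1 (finfun c k)] = [ffun k => upi (w1 k)].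
  apply/ffunP => k; rewrite !ffunE; have [-> _] := hc k; rewrite /w1.
  by case: split => // k'; apply: swap1E.
have -> : [ffun k => q2 (finfun c k)] = [ffun k => upi (w2 k)].
  apply/ffunP => k; rewrite !ffunE; have [_ ->] := hc k; rewrite /w2.
  by case: split => // k'; apply: swap1E.
have in1 i : @sat L (Structure J1) _ phi [ffun k => w1 k i] <-> U (fun j => i < j)%N.
  have -> : [ffun k => w1 k i] = [ffun k => upi (fun j => cat_ffun (a i) (b j) k)].
    apply/ffunP => k; rewrite !ffunE /w1 /be.
    have e j : cat_ffun (a i) (b j) k = match split k with inl k => a i k | inr k => b j k end.
      by rewrite ffunE.
    by case: (split k) e => k' e; congr upi; apply: uprodP => j; rewrite e.
  rewrite (UP_sat U (fun=> J) phi (fun k j => cat_ffun (a i) (b j) k)).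
  by split=> h; apply: largeS h _ => j; rewrite ffunK => h; apply/ord.
have in2 i : @sat L (Structure J1) _ phi [ffun k => w2 k i] <-> U (fun j => j < i)%N.
  have -> : [ffun k => w2 k i] = [ffun k => upi (fun j => cat_ffun (a j) (b i) k)].
    apply/ffunP => k; rewrite !ffunE /w2 /al.
    have e j : cat_ffun (a j) (b i) k = match split k with inl k => a j k | inr k => b i k end.
      by rewrite ffunE.
    by case: (split k) e => k' e; congr upi; apply: uprodP => j; rewrite e.
  rewrite (UP_sat U (fun=> J) phi (fun k j => cat_ffun (a j) (b i) k)).
  by split=> h; apply: largeS h _ => j; rewrite ffunK => h; apply/ord.
rewrite !(UP_sat U (fun=> J1)) => h.
have /h/large_ex[i /in2 hi] : U (fun i => @sat L (Structure J1) _ phi [ffun k => w1 k i]).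
  by apply: large_true => i; apply/in1; apply: hU.
have [j [hj ij]] := large_ex (largeI hi (hU i)).
by rewrite ltnNge ij in hj.
Qed.

(** * Compactness *)

Section Rename.
Variable L : signature.

Fixpoint term_rename n k (f : 'I_n -> 'I_k) (t : term L n) : term L k :=
  match t with
  | Var i => Var (f i)
  | App g ts => App g (fun i => term_rename f (ts i))
  end.

Definition lift_fun n k (f : 'I_n -> 'I_k) (i : 'I_n.+1) : 'I_k.+1 :=
  if unlift ord_max i is Some j then lift ord_max (f j) else ord_max.

Fixpoint formula_rename n (phi : formula L n) : forall k, ('I_n -> 'I_k) -> formula L k :=
  match phi in formula _ n return forall k, ('I_n -> 'I_k) -> formula L k with
  | FEq _ t u => fun k f => FEq (term_rename f t) (term_rename f u)
  | FNot _ psi => fun k f => FNot (formula_rename psi f)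
  | FAnd _ psi chi => fun k f => FAnd (formula_rename psi f) (formula_rename chi f)
  | FEx _ psi => fun k f => FEx (formula_rename psi (lift_fun f))
  end.

Variable M : structure L.

Lemma eval_rename n k (f : 'I_n -> 'I_k) (t : term L n) (e : (M ^ k)%type) :
  eval e (term_rename f t) = eval [ffun i => e (f i)] t.
Proof.
elim: t => [i|g ts IH] /=; first by rewrite ffunE.
by congr interp; apply/ffunP => i; rewrite !ffunE.
Qed.

Lemma sat_rename n (phi : formula L n) k (f : 'I_n -> 'I_k) (e : (M ^ k)%type) :
  sat (formula_rename phi f) e <-> sat phi [ffun i => e (f i)].
Proof.
elim: phi k f e => {n} [n t u|n phi IH|n phi IH psi IH'|n phi IH] k f e /=.
- by rewrite !eval_rename.
- by rewrite IH.
- by rewrite IH IH'.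
suff h x : [ffun i => rcons_ffun e x (lift_fun f i)] = rcons_ffun [ffun i => e (f i)] x.
  by split=> -[x hx]; exists x; move: hx; rewrite IH h.
apply/ffunP => i; rewrite !ffunE; case: (unliftP ord_max i) => [j ->|->].
  by rewrite /lift_fun !liftK ffunE.
by rewrite /lift_fun !unlift_none.
Qed.

Fixpoint ex_closure k : formula L k -> sentence L :=
  match k with
  | 0 => id
  | k'.+1 => fun phi => ex_closure (FEx phi)
  end.

Lemma sat_ex_closure k (phi : formula L k) (e0 : (M ^ 0)%type) :
  sat (ex_closure phi) e0 <-> exists e : (M ^ k)%type, sat phi e.
Proof.
elim: k phi => [|k IH] phi /=.
  split=> [h|[e h]]; first by exists e0.
  by rewrite (ffun0_eq e0 e).
rewrite IH; split=> [[e [x h]]|[e h]]; first by exists (rcons_ffun e x).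
exists [ffun i => e (lift ord_max i)], (e ord_max); congr (sat _ _): h.
by apply/ffunP => i; rewrite ffunE; case: unliftP => [j ->|->] //; rewrite ffunE.
Qed.

Variables (n m : nat) (phi : formula L (n + m)).

(** Variables are pairs of a position in the chain and a variable of [phi], so each position carries
    both tuples; the first tuple is taken at [ij.1] and the second at [ij.2]. *)
Definition chain_literal N (ij : 'I_N * 'I_N) : formula L #|{: 'I_N * 'I_(n + m)}| :=
  let psi := formula_rename phi
    (fun l => enum_rank (match split l with inl _ => ij.1 | inr _ => ij.2 end, l)) in
  if (ij.1 < ij.2)%N then psi else FNot psi.

(* The base of the conjunction is a tautology. *)
Definition chain_sentence N : sentence L :=
  ex_closure (foldr (fun ij psi => FAnd (@chain_literal N.+1 ij) psi)
    (FNot (FAnd (chain_literal (ord0, ord0)) (FNot (chain_literal (ord0, ord0)))))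
    (enum {: 'I_N.+1 * 'I_N.+1})).

Lemma sat_chain_sentence N (e0 : (M ^ 0)%type) :
  sat (chain_sentence N) e0 <->
  exists (a : 'I_N.+1 -> (M ^ n)%type) (b : 'I_N.+1 -> (M ^ m)%type),
    forall i j, sat phi (cat_ffun (a i) (b j)) <-> (i < j)%N.
Proof.
rewrite sat_ex_closure.
have foldE (s : seq ('I_N.+1 * 'I_N.+1)) t (e : (M ^ _)%type) :
    sat (foldr (fun ij psi => FAnd (@chain_literal N.+1 ij) psi) t s) e <->
    sat t e /\ forall ij, ij \in s -> sat (chain_literal ij) e.
  elim: s => [|ij s IH] /=; first by split=> [|[]].
  rewrite IH; split=> [[h [ht hs]]|[ht h]].
    by split=> // kl; rewrite inE => /orP[/eqP ->|/hs].
  by split; [apply: h; rewrite mem_head | split=> // kl hkl; apply: h; rewrite inE hkl orbT].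
pose a (e : (M ^ #|{: 'I_N.+1 * 'I_(n + m)}|)%type) i : (M ^ n)%type :=
  [ffun l => e (enum_rank (i, lshift m l))].
pose b (e : (M ^ #|{: 'I_N.+1 * 'I_(n + m)}|)%type) i : (M ^ m)%type :=
  [ffun l => e (enum_rank (i, rshift n l))].
have litE e ij : sat (chain_literal ij) e <->
    (sat phi (cat_ffun (a e ij.1) (b e ij.2)) <-> (ij.1 < ij.2)%N).
  rewrite /chain_literal; set psi := formula_rename _ _.
  have <- : sat psi e <-> sat phi (cat_ffun (a e ij.1) (b e ij.2)).
    rewrite sat_rename; set c1 := [ffun=> _]; set c2 := cat_ffun _ _.
    have -> // : c1 = c2.
    by apply/ffunP => l; rewrite !ffunE; case: split_ordP => l' ->; rewrite ffunE.
  by case: ltnP => _ /=; split=> h; [split | apply/h | split=> // /h | move=> /h].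
split=> [[e /foldE[_ h]]|[a' [b' h]]].
  by exists (a e), (b e) => i j; apply/(litE e (i, j)); apply: h; rewrite mem_enum.
exists [ffun r => let: (i, l) := enum_val r in
  match split l with inl l' => a' i l' | inr l' => b' i l' end].
apply/foldE; split=> [/= [h1 h2] //|ij _]; apply/litE; rewrite -h.
have -> : a [ffun r => let: (i, l) := enum_val r in
    match split l with inl l' => a' i l' | inr l' => b' i l' end] ij.1 = a' ij.1.
  by apply/ffunP => l; rewrite !ffunE enum_rankK (unsplitK (inl l)).
have -> // : b [ffun r => let: (i, l) := enum_val r in
    match split l with inl l' => a' i l' | inr l' => b' i l' end] ij.2 = b' ij.2.
by apply/ffunP => l; rewrite !ffunE enum_rankK (unsplitK (inr l)).
Qed.

End Rename.

(** If no member contained a chain of some finite length, the negated chain sentence would belong to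
    [T], against the given model. Members with ever longer chains have an ultraproduct in the class
    with an infinite chain, which [good_class_no_order] excludes. *)
Theorem good_class_stable (L : signature) (p : nat)
    (mem : forall K : diffField, interpretation L K -> Prop) (T : theory L) :
  good_class p mem ->
  (forall s, (forall (K : diffField) (J : interpretation L K), mem K J -> holds (Structure J) s) -> T s) ->
  stable T.
Proof.
move=> good hT n m phi [M [a [b [MT ord]]]].
have /dchoice[K hK] : forall N, exists K : diffField, exists J : interpretation L K, mem K J /\
    exists (a : nat -> (K ^ n)%type) (b : nat -> (K ^ m)%type), forall i j, (i <= N)%N -> (j <= N)%N ->
      @sat L (Structure J) _ phi (cat_ffun (a i) (b j)) <-> (i < j)%N.
  move=> N; apply: contrapT => hN.
  have /MT : T (FNot (chain_sentence phi N)).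
    apply: hT => K J mJ e /= /sat_chain_sentence[a' [b' h']]; apply: hN.
    exists K, J; split=> //; exists (fun i => a' (inord i)), (fun j => b' (inord j)) => i j iN jN.
    by rewrite h' !inordK.
  have e : (M ^ 0)%type := [ffun i : 'I_0 => False_rect _ (notF (valP i))].
  move=> /(_ e) /=; apply; apply/sat_chain_sentence.
  by exists (fun i => a i), (fun j => b j) => i j; apply: ord.
have /dchoice[J hJ] := hK.
have /dchoice[a' ha] : forall N, exists a : nat -> (K N ^ n)%type, exists b : nat -> (K N ^ m)%type,
    forall i j, (i <= N)%N -> (j <= N)%N ->
    @sat L (Structure (J N)) _ phi (cat_ffun (a i) (b j)) <-> (i < j)%N.
  by move=> N; case: (hJ N).
have /dchoice[b' hab] := ha.
have [U hU] := cofinite_ultrafilter.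
pose A i : (UPdiff U K ^ n)%type := [ffun k => upi (fun N => a' N i k)].
pose B i : (UPdiff U K ^ m)%type := [ffun k => upi (fun N => b' N i k)].
have mU : mem _ (UPinterp U J) by apply: (good_ultra good) => N; case: (hJ N).
apply: (@good_class_no_order L p mem _ (UPinterp U J) n m phi A B good mU) => i j.
have -> : cat_ffun (A i) (B j) = [ffun k => upi (fun N => cat_ffun (a' N i) (b' N j) k)].
  apply/ffunP => k; rewrite !ffunE.
  have e N : cat_ffun (a' N i) (b' N j) k = match split k with inl k => a' N i k | inr k => b' N j k end.
    by rewrite ffunE.
  by case: (split k) e => k' e; rewrite ffunE; congr upi; apply: uprodP => N; rewrite e.
rewrite (UP_sat U J phi (fun k N => cat_ffun (a' N i) (b' N j) k)); split=> [h|ij].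
  have [N [hN [iN jN]]] := large_ex (largeI h (largeI (hU i) (hU j))).
  by rewrite ffunK in hN; apply/(hab N i j).
apply: largeS (largeI (hU i) (hU j)) _ => N [iN jN]; rewrite ffunK; exact/(hab N i j).
Qed.

(** * The two languages *)

Lemma df_interp_hom (C K : diffField) (j : {rmorphism C -> K}) (dj : diff_emb j) g
    (v : (C ^ df_arity g)%type) :
  j (@df_interp C g v) = @df_interp K g [ffun k => j (v k)].
Proof.
by case: g v => v /=; rewrite ?ffunE ?rmorph0 ?rmorph1 ?rmorphD ?rmorphN ?rmorphM ?fmorphV ?dj.
Qed.

Lemma UP_df_interp (I : Type) (U : ultrafilter I) (N : I -> diffField) g
    (v : (UPdiff U N ^ df_arity g)%type) :
  upi (fun i => @df_interp (N i) g [ffun k => urep (v k) i]) = @df_interp (UPdiff U N) g v.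
Proof.
case: g v => v /=.
- by rewrite -[RHS](rmorph0 (@upi I U N)).
- by rewrite -[RHS](rmorph1 (@upi I U N)).
- rewrite -[in RHS](urepK (v ord0)) -[in RHS](urepK (v ord_max)) -[RHS]rmorphD; congr upi.
  by apply: uprodP => i; rewrite !ffunE.
- rewrite -[in RHS](urepK (v ord0)) -[RHS]rmorphN; congr upi.
  by apply: uprodP => i; rewrite !ffunE.
- rewrite -[in RHS](urepK (v ord0)) -[in RHS](urepK (v ord_max)) -[RHS]rmorphM; congr upi.
  by apply: uprodP => i; rewrite !ffunE.
- rewrite -[in RHS](urepK (v ord0)) [RHS]upiV; congr upi.
  by apply: uprodP => i; rewrite !ffunE.
rewrite -[in RHS](urepK (v ord0)) /UPder UPmapE; congr upi.
by apply: uprodP => i; rewrite !ffunE.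
Qed.

Lemma UP_constant (I : Type) (U : ultrafilter I) (N : I -> diffField) (f : forall i, N i) :
  is_constant (upi f : UPdiff U N) <-> U (fun i => is_constant (f i)).
Proof. by rewrite /is_constant UPdiffE; apply: upi_eq0. Qed.

Lemma rmorph_pmonomial (C K : fieldType) (j : {rmorphism C -> K}) p n (e : {ffun 'I_n -> 'I_p})
    (a : (C ^ n)%type) : j (pmonomial e a) = pmonomial e [ffun k => j (a k)].
Proof. by rewrite /pmonomial rmorph_prod; apply: eq_bigr => k _; rewrite rmorphXn ffunE. Qed.

Lemma upi_pmonomial (I : Type) (U : ultrafilter I) (N : I -> fieldType) p n
    (e : {ffun 'I_n -> 'I_p}) (a : 'I_n -> forall i, N i) :
  pmonomial e [ffun k => upi (a k) : UP U N] = upi (fun i => pmonomial e [ffun k => a k i]).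
Proof.
rewrite /pmonomial; transitivity (upi (\prod_(k < n) (a k : uprod U N) ^+ e k)).
  by rewrite rmorph_prod; apply: eq_bigr => k _; rewrite ffunE rmorphXn.
congr upi; apply: uprodP => i; rewrite -[LHS]/(uev i _) rmorph_prod.
by apply: eq_bigr => k _; rewrite rmorphXn ffunE.
Qed.

Section Independence.
Variables (p : nat).

Lemma diff_p_indep_pind (K : diffField) (chK : p \in [pchar K]) n (a : (K ^ n)%type) :
  diff_p_indep p a <-> (forall k, is_constant (a k)) /\
    pind p setT (fun e : {ffun 'I_n -> 'I_p} => pmonomial e a).
Proof. by rewrite /diff_p_indep (lin_indep_pind chK). Qed.

Lemma UP_diff_p_indep (I : Type) (U : ultrafilter I) (N : I -> diffField) n
    (a : 'I_n -> forall i, N i) : (forall i, p \in [pchar N i]) ->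
  @diff_p_indep p (UPdiff U N) n [ffun k => upi (a k)] <->
  U (fun i => diff_p_indep p [ffun k => a k i]).
Proof.
move=> chN; rewrite (@diff_p_indep_pind (UPdiff U N)); last exact: UP_pchar.
have -> : (fun e : {ffun 'I_n -> 'I_p} => @pmonomial (UPdiff U N) p n e [ffun k => upi (a k)]) =
    fun e => upi (fun i => pmonomial e [ffun k => a k i]).
  by apply/funext => e; apply: upi_pmonomial.
rewrite (UPdiff_pind p U setT (fun e i => pmonomial e [ffun k => a k i])).
split=> [[h1 h2]|h].
  have h3 : U (fun i => forall k, is_constant (a k i)).
    by apply: large_fin => k; apply/UP_constant; have := h1 k; rewrite ffunE.
  apply: largeS (largeI h3 h2) _ => i [h4 h5]; apply/(diff_p_indep_pind (chN i)); split=> // k.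
  by rewrite ffunE.
split=> [k|]; last by apply: largeS h _ => i /(diff_p_indep_pind (chN i))[].
by rewrite ffunE; apply/UP_constant; apply: largeS h _ => i [/(_ k)]; rewrite ffunE.
Qed.

Lemma diff_emb_constant (C K : diffField) (j : {rmorphism C -> K}) (dj : diff_emb j) x :
  is_constant (j x) <-> is_constant x.
Proof.
rewrite /is_constant -dj; split=> [e|->]; last exact: rmorph0.
by apply: (fmorph_inj j); rewrite rmorph0.
Qed.

Lemma sep_diff_p_indep (C K : diffField) (j : {rmorphism C -> K}) n (a : (C ^ n)%type) :
  p \in [pchar K] -> diff_emb j -> sep p j ->
  diff_p_indep p [ffun k => j (a k)] <-> diff_p_indep p a.
Proof.
move=> chK dj sj; have chC : p \in [pchar C] by rewrite -(fmorph_pchar j).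
rewrite (diff_p_indep_pind chK) (diff_p_indep_pind chC).
have -> : (fun e : {ffun 'I_n -> 'I_p} => pmonomial e [ffun k => j (a k)]) =
    j \o (fun e => pmonomial e a) by apply/funext => e; rewrite /= rmorph_pmonomial.
rewrite (sep_pind sj); split=> -[h1 h2]; split=> // k; have := h1 k; rewrite ffunE diff_emb_constant //.
Qed.

Variables (mon : monomial_enum p).
Hypothesis hmon : forall n, bijective (@mon n).

Lemma mon_pind (K : diffField) (chK : p \in [pchar K]) n (a : (K ^ n)%type) : diff_p_indep p a ->
  pind p setT (fun i : 'I_(p ^ n) => pmonomial (mon i) a).
Proof.
move/(diff_p_indep_pind chK) => [_ h].
exact: (pind_inj chK (in2W (bij_inj (hmon n))) (fun _ _ => in_setT _) h).
Qed.

Lemma pind_unique (K : fieldType) (chK : p \in [pchar K]) (T : finType) (y c d : T -> K) :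
  pind p setT y -> \sum_t c t ^+ p * y t = \sum_t d t ^+ p * y t -> c =1 d.
Proof.
move=> hy e t; apply/eqP; rewrite -subr_eq0; apply/eqP.
apply: (hy (fun t => c t - d t)) => //; rewrite big_setT.
transitivity (\sum_s (c s ^+ p * y s - d s ^+ p * y s)); last by rewrite sumrB e subrr.
apply: eq_bigr => s _; rewrite -mulrBl; congr (_ * _).
exact: (rmorphB (pFrobenius_aut chK)).
Qed.

(** Separability over [C] puts coefficients of [b] in [C], and coefficients over p-independent
    monomials are unique; so the values on both sides are images of one family in [C]. *)
Lemma ell_descend (C K1 K2 : diffField) (j1 : {rmorphism C -> K1}) (j2 : {rmorphism C -> K2}) n
    (a : (C ^ n)%type) (b : C) (l1 : 'I_(p ^ n) -> K1) (l2 : 'I_(p ^ n) -> K2) :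
  p \in [pchar K1] -> p \in [pchar K2] -> diff_emb j1 -> diff_emb j2 -> sep p j1 -> sep p j2 ->
  diff_p_indep p a ->
  j1 b = \sum_i l1 i ^+ p * pmonomial (mon i) [ffun k => j1 (a k)] ->
  j2 b = \sum_i l2 i ^+ p * pmonomial (mon i) [ffun k => j2 (a k)] ->
  exists u : 'I_(p ^ n) -> C, forall i, j1 (u i) = l1 i /\ j2 (u i) = l2 i.
Proof.
move=> ch1 ch2 d1 d2 s1 s2 ha e1 e2; have chC : p \in [pchar C] by rewrite -(fmorph_pchar j1).
have [|u hu] := sep_descend chC ch1 s1 (g := fun i => pmonomial (mon i) a) (b := b) (z := l1).
  by rewrite e1; apply: eq_bigr => i _; rewrite rmorph_pmonomial.
have key (K : diffField) (j : {rmorphism C -> K}) l : p \in [pchar K] -> diff_emb j -> sep p j ->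
    j b = \sum_i l i ^+ p * pmonomial (mon i) [ffun k => j (a k)] -> (fun i => j (u i)) =1 l.
  move=> chK dj sj e; apply: (pind_unique chK (mon_pind chK ((sep_diff_p_indep a chK dj sj).2 ha))).
  rewrite -e hu rmorph_sum; apply: eq_bigr => i _.
  by rewrite rmorphM rmorphXn rmorph_pmonomial.
by exists u => i; split; [apply: (key _ _ _ ch1) | apply: (key _ _ _ ch2)].
Qed.

End Independence.

Section Finite.
Variables (p n : nat) (mon : monomial_enum p).
Hypothesis hmon : forall k, bijective (@mon k).
Local Notation L := (fin_signature p n).

(** Each clause passes to ultraproducts. The degree of imperfection is encoded in the last one: it
    makes [a] a differential p-basis. *)
Definition mem_fin (K : diffField) (J : interpretation L K) : Prop :=
  [/\ p \in [pchar K], sem_closed p K,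
      forall g v, J (FinDF p n g) v = @df_interp K g v &
      exists (a : (K ^ n)%type) (ell : 'I_(p ^ n) -> K -> K),
        [/\ forall k v, J (FinConst p k) v = a k,
            forall i v, J (FinEll i) v = ell i (v ord0),
            diff_p_indep p a & fin_ell_spec mon a ell]].

Lemma good_fin : good_class p mem_fin.
Proof.
split.
- by move=> K J [].
- by move=> K J [].
- move=> I U N J hJ.
  have chN i : p \in [pchar N i] by case: (hJ i).
  have cl i : sem_closed p (N i) by case: (hJ i).
  have hdf i g v : J i (FinDF p n g) v = @df_interp (N i) g v by case: (hJ i) => _ _ h _; apply: h.
  have /dchoice[a ha] : forall i, exists a : (N i ^ n)%type, exists ell : 'I_(p ^ n) -> N i -> N i,
        [/\ forall k v, J i (FinConst p k) v = a k,
            forall k v, J i (FinEll k) v = ell k (v ord0),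
            diff_p_indep p a & fin_ell_spec mon a ell] by move=> i; case: (hJ i).
  have /dchoice[ell hell] := ha.
  split; [exact: UP_pchar | exact: sem_closed_ultra | |].
    move=> g v; rewrite -UP_df_interp; congr upi; apply: uprodP => i; exact: hdf.
  exists [ffun k => upi (fun i => a i k)], (fun k b => upi (fun i => ell i k (urep b i))).
  split.
  + move=> k v; rewrite ffunE; congr upi; apply: uprodP => i.
    by case: (hell i) => h _ _ _; apply: h.
  + move=> k v; congr upi; apply: uprodP => i.
    by case: (hell i) => _ h _ _; rewrite h ffunE.
  + apply/(UP_diff_p_indep U (fun k i => a i k) chN); apply: large_true => i.
    by rewrite ffunK; case: (hell i).
  move=> b; have cb : is_constant b <-> U (fun i => is_constant (urep b i)).
    by rewrite -(UP_constant U (urep b)) [upi _]urepK.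
  split=> [/cb/largeN h k|/cb h].
    apply/upi_eq0; apply: largeS h _ => i nc.
    by case: (hell i) => _ _ _ /(_ (urep b i))[h _]; apply: h.
  transitivity (upi (urep b)); first by rewrite [RHS]urepK.
  under eq_bigr => k _ do rewrite (upi_pmonomial U (mon k) (fun k i => a i k)).
  rewrite (upi_psum p _ _ (fun k i => ell i k (urep b i))
    (fun k i => pmonomial (mon k) [ffun q => a i q])).
  apply/upi_eq; apply: largeS h _ => i c; case: (hell i) => _ _ _ /(_ (urep b i))[_ h].
  by rewrite {1}h //; apply: eq_bigr => k _; rewrite ffunK.
- move=> C K1 K2 J1 J2 j1 j2 [ch1 cl1 df1 [a1 [ell1 [Ja1 Jl1 i1 sp1]]]]
    [ch2 cl2 df2 [a2 [ell2 [Ja2 Jl2 i2 sp2]]]] d1 d2 s1 s2 h0.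
  have /choice[a ha] : forall k, exists c, j1 c = a1 k /\ j2 c = a2 k.
    move=> k; have [c e1 e2] := h0 (FinConst p k) erefl [ffun=> 0] [ffun=> 0].
    by exists c; rewrite e1 e2 Ja1 Ja2.
  have a1E : a1 = [ffun k => j1 (finfun a k)] by apply/ffunP => k; rewrite !ffunE; case: (ha k).
  have a2E : a2 = [ffun k => j2 (finfun a k)] by apply/ffunP => k; rewrite !ffunE; case: (ha k).
  have ia : diff_p_indep p (finfun a) by apply/(sep_diff_p_indep _ ch1 d1 s1); rewrite -a1E.
  have /choice[ell hell] : forall b, exists u : 'I_(p ^ n) -> C,
      forall i, j1 (u i) = ell1 i (j1 b) /\ j2 (u i) = ell2 i (j2 b).
    move=> b; have [cb|nb] := pselect (is_constant b).
      apply: (ell_descend hmon ch1 ch2 d1 d2 s1 s2 ia (b := b)).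
        by rewrite -a1E; apply: (sp1 _).2; apply/diff_emb_constant.
      by rewrite -a2E; apply: (sp2 _).2; apply/diff_emb_constant.
    exists (fun=> 0) => i; rewrite !rmorph0; split.
      by rewrite (sp1 _).1 // => /(diff_emb_constant d1).
    by rewrite (sp2 _).1 // => /(diff_emb_constant d2).
  exists (@interp _ (fin_structure (finfun a) (fun i b => ell b i))); split=> -[g|k|i] v /=.
  + by rewrite (df_interp_hom d1) df1.
  + by rewrite Ja1 ffunE; case: (ha k).
  + by rewrite Jl1 ffunE; case: (hell (v ord0) i).
  + by rewrite (df_interp_hom d2) df2.
  + by rewrite Ja2 ffunE; case: (ha k).
  by rewrite Jl2 ffunE; case: (hell (v ord0) i).
(* Every constant is a combination over [K1^p] of monomials in the named constants, and these come
   from [C]. *)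
move=> C K1 K2 JC J1 J2 j1 [ch1 cl1 df1 [a1 [ell1 [Ja1 Jl1 i1 sp1]]]] _ h1; left=> x cx.
pose v0 : (C ^ 0)%type := [ffun=> 0].
pose a : (C ^ n)%type := [ffun k => JC (FinConst p k) v0].
have a1E : a1 = [ffun k => j1 (a k)].
  by apply/ffunP => k; rewrite !ffunE h1 Ja1.
exists 'I_(p ^ n), (fun i => ell1 i x), (fun i => pmonomial (mon i) a).
rewrite {1}(sp1 x).2 //; apply: eq_bigr => i _; by rewrite rmorph_pmonomial -a1E.
Qed.

Lemma SDCF_fin_stable : stable (SDCF_fin mon (n := n)).
Proof.
apply: (good_class_stable good_fin) => s hs K a ell chK cK _ ia sp.
apply: (hs K (@interp _ (fin_structure a ell))); split=> //; first exact: sep_diff_closed_sem.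
by exists a, ell.
Qed.

End Finite.

Section Infinite.
Variables (p : nat) (mon : monomial_enum p).
Hypothesis hmon : forall k, bijective (@mon k).
Local Notation L := (inf_signature p).

Definition mem_inf (K : diffField) (J : interpretation L K) : Prop :=
  [/\ p \in [pchar K], sem_closed p K, pinfinite p K,
      forall g v, J (InfDF p g) v = @df_interp K g v &
      exists ell : forall n, 'I_(p ^ n) -> (K ^ n)%type -> K -> K,
        (forall n (i : 'I_(p ^ n)) v,
           J (InfEll i) v = ell n i [ffun j : 'I_n => v (lift ord_max j)] (v ord_max)) /\
        inf_ell_spec mon ell].

Lemma good_inf : good_class p mem_inf.
Proof.
split.
- by move=> K J [].
- by move=> K J [].
- move=> I U N J hJ.
  have chN i : p \in [pchar N i] by case: (hJ i).
  have cl i : sem_closed p (N i) by case: (hJ i).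
  have inf i : pinfinite p (N i) by case: (hJ i).
  have hdf i g v : J i (InfDF p g) v = @df_interp (N i) g v by case: (hJ i) => _ _ _ h _; apply: h.
  have /dchoice[ell hell] : forall i, exists ell : forall n, 'I_(p ^ n) -> (N i ^ n)%type -> N i -> N i,
      (forall n (k : 'I_(p ^ n)) v,
         J i (InfEll k) v = ell n k [ffun j : 'I_n => v (lift ord_max j)] (v ord_max)) /\
      inf_ell_spec mon ell by move=> i; case: (hJ i).
  split; [exact: UP_pchar | exact: sem_closed_ultra | exact: UPdiff_pinfinite | |].
    move=> g v; rewrite -UP_df_interp; congr upi; apply: uprodP => i; exact: hdf.
  exists (fun n k a b => upi (fun i => ell i n k [ffun j => urep (a j) i] (urep b i))).
  split.
    move=> n k v; congr upi; apply: uprodP => i.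
    case: (hell i) => h _; rewrite h ffunE; congr (ell _ _ _ _ _).
    by apply/ffunP => j; rewrite !ffunE.
  move=> n a b defined.
  pose a' k i := urep (a k) i; pose b' i := urep b i.
  have aE : a = [ffun k => upi (a' k)] by apply/ffunP => k; rewrite ffunE [RHS]urepK.
  have bE : b = upi b' by rewrite [RHS]urepK.
  have abE : rcons_ffun a b = [ffun k => upi (fun i => rcons_ffun [ffun k => a' k i] (b' i) k)].
    apply/ffunP => k; rewrite !ffunE.
    have e i : rcons_ffun [ffun k => a' k i] (b' i) k =
        if unlift ord_max k is Some j then a' j i else b' i.
      by rewrite ffunE; case: unlift => // j; rewrite ffunE.
    case: (unlift ord_max k) e => [j|] e; rewrite -[LHS]urepK; congr upi;
    by apply: uprodP => i; rewrite e.
  pose defd i := [/\ forall j, is_constant ([ffun k => a' k i] j), is_constant (b' i),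
      diff_p_indep p [ffun k => a' k i] & ~ diff_p_indep p (rcons_ffun [ffun k => a' k i] (b' i))].
  (* The domain of the functions passes to ultraproducts in both directions; its negated clause does
     so because an ultrafilter commutes with negation. *)
  have defE : defined <-> U defd.
    have i1 k : is_constant (a k) <-> U (fun i => is_constant (a' k i)).
      by rewrite -UP_constant [upi _]urepK.
    have i2 : is_constant b <-> U (fun i => is_constant (b' i)) by rewrite -UP_constant -bE.
    have i3 : diff_p_indep p a <-> U (fun i => diff_p_indep p [ffun k => a' k i]).
      by rewrite -(UP_diff_p_indep U a' chN) -aE.
    have i4 : diff_p_indep p (rcons_ffun a b) <->
        U (fun i => diff_p_indep p (rcons_ffun [ffun k => a' k i] (b' i))).
      rewrite abE (UP_diff_p_indep U (fun k i => rcons_ffun [ffun k => a' k i] (b' i) k) chN).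
      by split=> h; apply: largeS h _ => i; rewrite ffunK.
    split=> [[h1 /i2 h2 /i3 h3 h4]|h].
      have h5 : U (fun i => forall k, is_constant (a' k i)) by apply: large_fin => k; apply/i1.
      have /largeN h6 := fun h => h4 (i4.2 h).
      apply: largeS (largeI (largeI h5 h2) (largeI h3 h6)) _ => i [[g1 g2] [g3 g4]].
      by split=> // k; rewrite ffunE; apply: g1.
    split; [move=> k; apply/i1 | apply/i2 | apply/i3 | move/i4; apply/largeN];
      apply: largeS h _ => i [g1 g2 g3 g4] //; by have := g1 k; rewrite ffunE.
  split=> [nd k|/defE d].
    apply/upi_eq0; have /largeN := fun h => nd (defE.2 h).
    by move=> h; apply: largeS h _ => i nd'; apply: ((hell i).2 n _ _).1.
  rewrite {1}bE.
  transitivity (\sum_k upi (fun i => ell i n k [ffun j => a' j i] (b' i)) ^+ p *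
     upi (fun i => pmonomial (mon k) [ffun j => a' j i]) : UPdiff U N); last first.
    apply: eq_bigr => k _; congr (_ * _).
    by rewrite [in RHS]aE (upi_pmonomial U (mon k) a').
  rewrite (upi_psum p _ _ (fun k i => ell i n k [ffun j => a' j i] (b' i))
    (fun k i => pmonomial (mon k) [ffun j => a' j i])).
  by apply/upi_eq; apply: largeS d _ => i d'; apply: ((hell i).2 n _ _).2.
- move=> C K1 K2 J1 J2 j1 j2 [ch1 cl1 _ df1 [ell1 [Jl1 sp1]]]
    [ch2 cl2 _ df2 [ell2 [Jl2 sp2]]] d1 d2 s1 s2 _.
  have rE (K : diffField) (j : C -> K) n (a : (C ^ n)%type) b :
      rcons_ffun [ffun k => j (a k)] (j b) = [ffun k => j (rcons_ffun a b k)].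
    by apply/ffunP => k; rewrite !ffunE; case: unlift => // l; rewrite ffunE.
  (* Separable differential embeddings preserve and reflect constants and p-independence, so the
     default value 0 is taken at the same arguments on both sides. *)
  have defE (K : diffField) (j : {rmorphism C -> K}) n (a : (C ^ n)%type) b :
      p \in [pchar K] -> diff_emb j -> sep p j ->
      [/\ forall k, is_constant ([ffun k => j (a k)] k), is_constant (j b),
        diff_p_indep p [ffun k => j (a k)] & ~ diff_p_indep p (rcons_ffun [ffun k => j (a k)] (j b))] <->
      [/\ forall k, is_constant (a k), is_constant b, diff_p_indep p a & ~ diff_p_indep p (rcons_ffun a b)].
    move=> chK dj sj.
    have i3 := sep_diff_p_indep a chK dj sj; have i4 := sep_diff_p_indep (rcons_ffun a b) chK dj sj.
    have i1 k := diff_emb_constant dj (a k); have i2 := diff_emb_constant dj b.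
    rewrite rE; split=> -[h1 /i2 h2 /i3 h3 h4]; split=> //;
      try (by move/i4); move=> k; [have := h1 k | ]; rewrite ffunE.
      by move/i1.
    exact/i1.
  have /dchoice[ell hell] : forall n, exists ell : 'I_(p ^ n) -> (C ^ n)%type -> C -> C, forall i a b,
      j1 (ell i a b) = ell1 n i [ffun k => j1 (a k)] (j1 b) /\
      j2 (ell i a b) = ell2 n i [ffun k => j2 (a k)] (j2 b).
    move=> n; suff /choice[u hu] : forall ab : (C ^ n)%type * C, exists u : 'I_(p ^ n) -> C, forall i,
        j1 (u i) = ell1 n i [ffun k => j1 (ab.1 k)] (j1 ab.2) /\
        j2 (u i) = ell2 n i [ffun k => j2 (ab.1 k)] (j2 ab.2).
      by exists (fun i a b => u (a, b) i) => i a b; apply: (hu (a, b)).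
    move=> [a b] /=.
    have D1 := defE _ j1 n a b ch1 d1 s1; have D2 := defE _ j2 n a b ch2 d2 s2.
    have [hd|nd] := pselect [/\ forall k, is_constant (a k), is_constant b, diff_p_indep p a &
        ~ diff_p_indep p (rcons_ffun a b)].
      apply: (ell_descend hmon ch1 ch2 d1 d2 s1 s2 (a := a) (b := b)); first by case: hd.
        by apply: (sp1 n _ _).2; apply/D1.
      by apply: (sp2 n _ _).2; apply/D2.
    exists (fun=> 0) => i; rewrite !rmorph0; split.
      by rewrite (sp1 n _ _).1 // => /D1.
    by rewrite (sp2 n _ _).1 // => /D2.
  exists (@interp _ (inf_structure ell)); split=> -[g|n i] v /=.
  + by rewrite (df_interp_hom d1) df1.
  + rewrite Jl1 ffunE; case: (hell n i [ffun j => v (lift ord_max j)] (v ord_max)) => -> _.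
    by congr (ell1 _ _ _ _); apply/ffunP => k; rewrite !ffunE.
  + by rewrite (df_interp_hom d2) df2.
  rewrite Jl2 ffunE; case: (hell n i [ffun j => v (lift ord_max j)] (v ord_max)) => _ ->.
  by congr (ell2 _ _ _ _); apply/ffunP => k; rewrite !ffunE.
by move=> C K1 K2 JC J1 J2 j1 _ [_ _ inf _ _] _; right.
Qed.

Lemma SDCF_inf_stable : stable (SDCF_inf mon).
Proof.
apply: (good_class_stable good_inf) => s hs K ell chK cK inf sp.
apply: (hs K (@interp _ (inf_structure ell))); split=> //.
- exact: sep_diff_closed_sem.
- exact: imperfection_pinfinite.
by exists ell.
Qed.

End Infinite.

Theorem theorem6p8 (p : nat) (hp : prime p)
    (mon : monomial_enum p) (hmon : forall n, bijective (mon n))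
    (eps : imperfection) :
  stable (SDCF mon eps).
Proof. by case: eps => [n|]; [apply: SDCF_fin_stable | apply: SDCF_inf_stable]. Qed.
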